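(* For $D\in\{2,3,5,6,21\}$ let $K=\mathbb{Q}(\sqrt{D})$, let $c(D)$ be the number, up to equivalence, of binary quadratic forms over $\mathcal{O}_K$ that are classical and additively indecomposable in the classical sense, and let $i(D)$ be the number, up to equivalence, of binary quadratic forms over $\mathcal{O}_K$ that are additively indecomposable in the non-classical (integral) sense. Then - $c(2)=1$ and $i(2)=7$; - $c(3)=3$ and $i(3)=4$; - $c(5)=1$ and $i(5)=2$; - $c(6)=14$ and $i(6)\geq 26$; - $c(21)=11$ and $i(21)\geq 8$.
   Context: $\mathcal{O}_K$ denotes the ring of integers of $K$. A binary (integral) quadratic form over $\mathcal{O}_K$ is $Q(x,y)=ax^2+bxy+cy^2$ with $a,b,c\in\mathcal{O}_K$; its Gram matrix is $M_Q=\begin{pmatrix} a & b/2 \\ b/2 & c \end{pmatrix}$, and $Q$ is classical if $M_Q$ has entries in $\mathcal{O}_K$ (i.e. $b\in2\mathcal{O}_K$). For $\alpha\in K$, $\alpha\succeq 0$ means $\sigma(\alpha)\geq0$ for every embedding $\sigma:K\to\mathbb{R}$. $Q$ is totally positive semi-definite if $Q(v)\succeq0$ for all $v\in K^2$, and totally positive definite if moreover $Q(v)=0$ implies $v=0$. A classical totally positive definite binary form $Q$ is additively indecomposable in the classical sense if it cannot be written as $Q=Q_1+Q_2$ with $Q_1,Q_2$ nonzero classical totally positive semi-definite binary forms. An integral (classical or not) totally positive definite binary form $Q$ is additively indecomposable in the non-classical (integral) sense if it cannot be written as $Q=Q_1+Q_2$ with $Q_1,Q_2$ nonzero totally positive semi-definite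 binary forms with coefficients in $\mathcal{O}_K$. Two forms $Q,H$ are equivalent if $M_H=NM_QN^t$ for some $N\in\mathcal{O}_K^{2\times2}$ with $\det N\in\mathcal{O}_K^\times$. *)

(* Defs.v *)
From HB Require Import structures.
From mathcomp Require Import all_boot all_order all_algebra all_field.
From mathcomp Require Import boolp classical_sets functions cardinality reals.

Set Implicit Arguments.
Unset Strict Implicit.
Unset Printing Implicit Defensive.

Import Order.TTheory GRing.Theory Num.Theory.

Local Open Scope classical_set_scope.
Local Open Scope ring_scope.

Definition is_quadratic_field (D : nat) (K : fieldExtType rat) : Prop :=
  exists2 s : K, s ^+ 2 = D%:R & <<1; s>>%VS = fullv.

Definition ringint (K : fieldExtType rat) : set K :=
  [set x | integralOver (intr : int -> K) x].

Definition ringint_unit (K : fieldExtType rat) : set K :=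
  [set x | ringint x /\ exists2 y, ringint y & x * y = 1].

Definition totally_nonneg (R : realType) (K : fieldExtType rat) (x : K) : Prop :=
  forall sigma : {rmorphism K -> R}, 0 <= sigma x.

(* The triple (a, b, c) stands for a x^2 + b x y + c y^2; addition of forms and
   the zero form are those of the product Z-module. *)
Definition bform (K : fieldExtType rat) := (K * K * K)%type.

Section Forms.
Variables (R : realType) (K : fieldExtType rat).
Implicit Types (Q H : bform K) (v : 'rV[K]_2) (N : 'M[K]_2).

Definition bf_eval Q v : K :=
  let: (a, b, c) := Q in
  a * v 0 0 ^+ 2 + b * v 0 0 * v 0 1 + c * v 0 1 ^+ 2.

Definition gram Q : 'M[K]_2 :=
  let: (a, b, c) := Q in
  \matrix_(i < 2, j < 2)
    if i == j then (if i == 0 then a else c) else b / 2%:R.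

Definition integral_form Q : Prop :=
  let: (a, b, c) := Q in [/\ ringint a, ringint b & ringint c].

Definition classical_form Q : Prop :=
  integral_form Q /\ forall i j, ringint (gram Q i j).

Definition tot_psd Q : Prop := forall v, totally_nonneg R (bf_eval Q v).

Definition tot_pd Q : Prop :=
  tot_psd Q /\ forall v, bf_eval Q v = 0 -> v = 0.

Definition decomposable_in (P : bform K -> Prop) Q : Prop :=
  exists Q1 Q2 : bform K,
    [/\ Q = Q1 + Q2, Q1 <> 0 /\ Q2 <> 0, P Q1 /\ P Q2 & tot_psd Q1 /\ tot_psd Q2].

Definition classical_indecomposable : set (bform K) :=
  [set Q | [/\ classical_form Q, tot_pd Q & ~ decomposable_in classical_form Q]].

Definition integral_indecomposable : set (bform K) :=
  [set Q | [/\ integral_form Q, tot_pd Q & ~ decomposable_in integral_form Q]].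

Definition bf_equiv Q H : Prop :=
  exists N, [/\ forall i j, ringint (N i j), ringint_unit (\det N)
              & gram H = N *m gram Q *m N^T].

(* H ranges over forms over K, but any H equivalent to an integral Q is
   integral. *)
Definition bf_classes (S : set (bform K)) : set (set (bform K)) :=
  [set [set H | bf_equiv Q H] | Q in S].

End Forms.

(* Main.v *)
Require Import Defs.
From HB Require Import structures.
From Stdlib Require Import ZArith.
From mathcomp Require Import all_boot all_order all_algebra all_field.
From mathcomp Require Import boolp classical_sets functions cardinality reals.
From mathcomp Require Import ssrZ zify ring lra.

Set Implicit Arguments.
Unset Strict Implicit.
Unset Printing Implicit Defensive.

Import Order.TTheory GRing.Theory Num.Theory.

Local Open Scope classical_set_scope.
Local Open Scope card_scope.
Local Open Scope ring_scope.

(** The five counts come from a reduction theory that leaves finitely many forms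
    to inspect.  Let [O] be the ring of integers, [(a, b, c)] a totally positive
    definite form over it and [d = 4 a c - b ^ 2].

    Two facts confine an indecomposable form.  The first is about small values.
    If [N(a)] is minimal among the first coefficients of the equivalent forms,
    then [16 N(a) ^ 2 <= B ^ 2 N(d)] for an explicit rational [B]
    ([norm_minimal_bound]).  Indeed, at either real place the form divided by [a]
    is [(x + y beta) ^ 2 + tau y ^ 2] with [beta = b / 2 a] and
    [tau = d / 4 a ^ 2].  Changing the second basis vector puts [beta] into a
    fundamental rectangle of [K] modulo [O] up to sign, and [tau] into a cone of
    bounded ratio of the two conjugates.  A subdivision of this compact domain,
    each piece of which comes with one vector, shows that [N(tau) <= 1 / B ^ 2]
    would give a vector of smaller norm ([cover], [slabsP]).  The second fact is
    about splitting.  If [al] is totally positive and [4 al Q(x, y) <= d], then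
    subtracting from [Q] the form [al (y X - x Y) ^ 2] of rank one leaves a
    totally positive semi-definite form ([rank_one_split]).  With
    [(x, y) = (1, 0)] this means that in an indecomposable form the point
    [d / 4 a], seen in the plane through its two conjugates, dominates no totally
    positive integer: it lies below a staircase, and once units are used to
    balance its conjugates, its norm is bounded ([stair_cornersP]).

    Together they give [N(a) <= B ^ 2 N(d / 4 a) <= A].  So every class of
    indecomposable forms has a representative, minimal for [N(a)], then for the
    trace of [a], then for the trace of [conj(a) d], whose first coefficient is in
    a finite list ([scalarsP]).  The second coefficient is reduced modulo [2 a] up
    to sign ([middlesP]), and of the third one a coordinate is bounded, while the
    other is the least one for which [d] is totally positive, because [d / 4 a]
    does not dominate [1] ([lastsP]).

    Each form of the resulting list is settled in one of three ways: a vector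
    [(x, 1)] has smaller norm, so that the form is not minimal; or a form of rank
    one splits off; or the form is the image, under a tabulated matrix, of one of
    the listed representatives or of a form with a tabulated decomposition
    ([classification]).  Conversely every representative is indecomposable, since
    the coefficients of a summand are bounded by its own
    ([indecomposable_okP]), and two representatives are inequivalent, since
    equivalent forms have discriminants that differ by the square of a unit and
    represent the same elements ([distinguishedP]).  For the two lower bounds this
    last part suffices.

    All of this is run on pairs of integers, standing for [x + y w] with
    [w ^ 2 = t w + m].  That they model [O] and its two real embeddings is shown
    in [quadratic_order_0] and [quadratic_order_1], according to the residue of
    the radicand modulo four. *)

Delimit Scope Z_scope with coqZ.

(** * Binary quadratic forms over a commutative ring *)

Section CommutativeForms.
Variable A : comNzRingType.
Implicit Types (Q : A * A * A) (N : A * A * A * A).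

Definition form_val Q (x y : A) : A :=
  let: (a, b, c) := Q in a * x ^+ 2 + b * x * y + c * y ^+ 2.

Definition form_disc Q : A := let: (a, b, c) := Q in 4%:R * a * c - b ^+ 2.

Definition form_sub N Q : A * A * A :=
  let: (a, b, c) := Q in let: (x, y, r, s) := N in
  (form_val Q x y,
   2%:R * a * x * r + b * (x * s + y * r) + 2%:R * c * y * s,
   form_val Q r s).

Definition det2 N : A := let: (x, y, r, s) := N in x * s - y * r.

Definition mul2 M N : A * A * A * A :=
  let: (x, y, r, s) := M in let: (x', y', r', s') := N in
  (x * x' + y * r', x * y' + y * s', r * x' + s * r', r * y' + s * s').

Lemma form_disc_sub N Q : form_disc (form_sub N Q) = det2 N ^+ 2 * form_disc Q.
Proof. case: Q => [[a b] c]; case: N => [[[x y] r] s] /=; ring. Qed.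

Lemma form_subD N Q1 Q2 : form_sub N (Q1 + Q2) = form_sub N Q1 + form_sub N Q2.
Proof.
case: Q1 => [[a1 b1] c1]; case: Q2 => [[a2 b2] c2]; case: N => [[[x y] r] s].
by congr (_, _, _); rewrite /form_val /=; ring.
Qed.

Lemma form_sub0 N : form_sub N 0 = 0.
Proof. case: N => [[[x y] r] s]; congr (_, _, _); rewrite /=; ring. Qed.

Lemma form_sub_mul M N Q : form_sub M (form_sub N Q) = form_sub (mul2 M N) Q.
Proof.
case: Q => [[a b] c]; case: N => [[[x y] r] s]; case: M => [[[x' y'] r'] s'].
by congr (_, _, _); rewrite /=; ring.
Qed.

Lemma form_sub1 Q : form_sub (1, 0, 0, 1) Q = Q.
Proof. case: Q => [[a b] c]; congr (_, _, _); rewrite /=; ring. Qed.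

Lemma form_val_sub N Q (u v : A) :
  let: (x, y, r, s) := N in
  form_val (form_sub N Q) u v = form_val Q (u * x + v * r) (u * y + v * s).
Proof. case: Q => [[a b] c]; case: N => [[[x y] r] s] /=; ring. Qed.

End CommutativeForms.

(** * The order Z[w] with w^2 = t w + m *)

Notation qint := (Z * Z)%type.
Notation qform := (qint * qint * qint)%type.
Notation qmat := (qint * qint * qint * qint)%type.

Section QuadraticIntegers.
Variables t m : Z.
Local Open Scope Z_scope.
Implicit Types (e f : qint) (Q : qform) (N : qmat).

Definition qadd e f : qint := (e.1 + f.1, e.2 + f.2).
Definition qsub e f : qint := (e.1 - f.1, e.2 - f.2).
Definition qmul e f : qint :=
  (e.1 * f.1 + m * (e.2 * f.2), e.1 * f.2 + e.2 * f.1 + t * (e.2 * f.2)).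
Definition qscale (k : Z) e : qint := (k * e.1, k * e.2).
Definition qconj e : qint := (e.1 + t * e.2, - e.2).
Definition qnorm e : Z := e.1 * e.1 + t * (e.1 * e.2) - m * (e.2 * e.2).
Definition qtr e : Z := 2 * e.1 + t * e.2.
(** Of two real numbers, both are nonnegative as soon as their sum and their
   product are. *)
Definition qnonneg e : bool := (0 <=? qtr e) && (0 <=? qnorm e).
Definition qpos e : bool := (0 <? qtr e) && (0 <? qnorm e).
Definition qle e f : bool := qnonneg (qsub f e).
Definition qsq e : qint := qmul e e.

Definition qval Q (x y : qint) : qint :=
  let: (a, b, c) := Q in
  qadd (qadd (qmul a (qsq x)) (qmul b (qmul x y))) (qmul c (qsq y)).

Definition qdisc Q : qint :=
  let: (a, b, c) := Q in qsub (qscale 4 (qmul a c)) (qsq b).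

Definition qdet N : qint :=
  let: (x, y, r, s) := N in qsub (qmul x s) (qmul y r).

(** The rows of the matrix are the vectors that replace the basis vectors. *)
Definition qact N Q : qform :=
  let: (a, b, c) := Q in let: (x, y, r, s) := N in
  (qval Q x y,
   qadd (qadd (qscale 2 (qmul a (qmul x r)))
              (qmul b (qadd (qmul x s) (qmul y r))))
        (qscale 2 (qmul c (qmul y s))),
   qval Q r s).

Definition qpsd Q : bool :=
  [&& qnonneg Q.1.1, qnonneg Q.2 & qnonneg (qdisc Q)].

Definition qpd Q : bool :=
  qpos Q.1.1 && qpos (qdisc Q).

End QuadraticIntegers.

Section Evaluation.
Variables (t m : Z) (A : comNzRingType) (w : A).

(** The image of an integer, and below the values at [w] of pairs of integers and
    of the forms and matrices made of them.  [A] is the field [K], or the field of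
    real numbers with one of the two conjugates of [w]. *)
Definition zr (z : Z) : A := (int_of_Z z)%:~R.

Lemma zrD x y : zr (x + y)%coqZ = zr x + zr y.
Proof. by rewrite /zr -[(x + y)%coqZ]/(x + y)%R rmorphD rmorphD. Qed.
Lemma zrN x : zr (- x)%coqZ = - zr x.
Proof. by rewrite /zr -[(- x)%coqZ]/(- x)%R rmorphN rmorphN. Qed.
Lemma zrB x y : zr (x - y)%coqZ = zr x - zr y.
Proof. by rewrite -zrN -zrD. Qed.
Lemma zrM x y : zr (x * y)%coqZ = zr x * zr y.
Proof. by rewrite /zr -[(x * y)%coqZ]/(x * y)%R rmorphM rmorphM. Qed.
Lemma zr0 : zr 0%coqZ = 0. Proof. by []. Qed.
Lemma zr1 : zr 1%coqZ = 1. Proof. by []. Qed.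
Lemma zr2 : zr 2%coqZ = 2%:R. Proof. by []. Qed.
Lemma zr4 : zr 4%coqZ = 4%:R. Proof. by []. Qed.

Hypothesis w_eq : w ^+ 2 = zr t * w + zr m.

Definition qev (e : qint) : A := zr e.1 + zr e.2 * w.

Lemma qevD e f : qev (qadd e f) = qev e + qev f.
Proof. by rewrite /qev /= !zrD; ring. Qed.
Lemma qevB e f : qev (qsub e f) = qev e - qev f.
Proof. by rewrite /qev /= !zrB; ring. Qed.
Lemma qevM e f : qev (qmul t m e f) = qev e * qev f.
Proof. rewrite /qev /= !(zrD, zrM); ring: w_eq. Qed.
Lemma qev_scale k e : qev (qscale k e) = zr k * qev e.
Proof. by rewrite /qev /= !zrM; ring. Qed.
Lemma qev_conj e : qev (qconj t e) = zr e.1 + zr e.2 * (zr t - w).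
Proof. by rewrite /qev /= zrD zrM zrN; ring. Qed.
Lemma qev_norm e : zr (qnorm t m e) = qev e * qev (qconj t e).
Proof. rewrite qev_conj /qev /= !(zrD, zrN, zrB, zrM); ring: w_eq. Qed.
Lemma qev_tr e : zr (qtr t e) = qev e + qev (qconj t e).
Proof. by rewrite qev_conj /qev /= zrD !zrM zr2; ring. Qed.
Lemma qev_sq e : qev (qsq t m e) = qev e ^+ 2.
Proof. by rewrite qevM. Qed.
Lemma qev_int k : qev (k, 0%coqZ) = zr k.
Proof. by rewrite /qev /= zr0; ring. Qed.

Definition qevE := (qevD, qevB, qevM, qev_scale, qev_sq, zr2, zr4).

Definition form_ev (Q : qform) : A * A * A :=
  let: (a, b, c) := Q in (qev a, qev b, qev c).
Definition mat_ev (N : qmat) : A * A * A * A :=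
  let: (x, y, r, s) := N in (qev x, qev y, qev r, qev s).

Lemma qev_val Q x y : qev (qval t m Q x y) = form_val (form_ev Q) (qev x) (qev y).
Proof. by case: Q => [[a b] c] /=; rewrite !qevE; ring. Qed.
Lemma qev_disc Q : qev (qdisc t m Q) = form_disc (form_ev Q).
Proof. by case: Q => [[a b] c] /=; rewrite !qevE; ring. Qed.
Lemma qev_det N : qev (qdet t m N) = det2 (mat_ev N).
Proof. by case: N => [[[x y] r] s] /=; rewrite !qevE; ring. Qed.
Lemma qev_act N Q : form_ev (qact t m N Q) = form_sub (mat_ev N) (form_ev Q).
Proof.
case: Q => [[a b] c]; case: N => [[[x y] r] s] /=.
by congr (_, _, _); rewrite !qevE; ring.
Qed.

End Evaluation.

(** What the rest uses about the quadratic field: its integers are the [x + y w],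
    and its real embeddings send [w] to [w1] or to the smaller [w2]. *)
Record quadratic_order (R : realType) (K : fieldExtType rat) (t m : Z)
    (w : K) (w1 w2 : R) : Prop := QuadraticOrder {
  qo_eq : w ^+ 2 = zr K t * w + zr K m;
  qo_free : forall e : qint, qev w e = 0 -> e = (Z0, Z0);
  qo_int : forall z : K, ringint z <-> exists e, z = qev w e;
  qo_sum : w1 + w2 = zr R t;
  qo_prod : w1 * w2 = - zr R m;
  qo_lt : w2 < w1;
  qo_emb : forall s : {rmorphism K -> R}, s w = w1 \/ s w = w2;
  qo_emb1 : exists s : {rmorphism K -> R}, s w = w1;
  qo_emb2 : exists s : {rmorphism K -> R}, s w = w2
}.

(** * Equivalence of forms over the ring of integers *)
Section Gram.
Variable K : fieldExtType rat.
Implicit Types (Q H : bform K) (N : 'M[K]_2).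

Definition mx_tuple N : K * K * K * K := (N 0 0, N 0 1, N 1 0, N 1 1).
Definition tuple_mx (n : K * K * K * K) : 'M[K]_2 :=
  let: (x, y, r, s) := n in
  \matrix_(i < 2, j < 2)
    if i == 0 then (if j == 0 then x else y) else (if j == 0 then r else s).

Lemma tuple_mxK n : mx_tuple (tuple_mx n) = n.
Proof. by case: n => [[[x y] r] s]; rewrite /mx_tuple !mxE. Qed.

Lemma lift01 : lift ord0 ord0 = 1 :> 'I_2. Proof. exact: val_inj. Qed.

Lemma det_mx_tuple N : \det N = det2 (mx_tuple N).
Proof.
rewrite (expand_det_row _ 0) !big_ord_recl big_ord0 /cofactor !det_mx11 !mxE /=.
rewrite !lift01 (_ : lift 1 0 = 0 :> 'I_2) ?addn0 ?addn1; last exact: val_inj.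
ring.
Qed.

Lemma two_neq0 : 2%:R != 0 :> K.
Proof. by rewrite -[2%:R](rmorph_nat (in_alg K)) fmorph_eq0. Qed.

Lemma gram_form_sub N Q : gram (form_sub (mx_tuple N) Q) = N *m gram Q *m N^T.
Proof.
case: Q => [[a b] c]; apply/matrixP => i j.
rewrite !mxE !big_ord_recl !big_ord0 !mxE !big_ord_recl !big_ord0 !mxE /= !lift01.
have := two_neq0 => h2.
have [->|->] : i = 0 \/ i = 1.
  by case: i => [[|[|//]] Hi]; [left|right]; apply: val_inj.
all: have [->|->] : j = 0 \/ j = 1.
all: try by case: j => [[|[|//]] Hi]; [left|right]; apply: val_inj.
all: by rewrite /=; field.
Qed.

Lemma gram_inj Q H : gram Q = gram H -> Q = H.
Proof.
case: Q => [[a b] c]; case: H => [[a' b'] c'] /matrixP E.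
move: (E 0 0) (E 0 1) (E 1 1); rewrite !mxE /= => -> /eqP E2 ->.
by move: E2; rewrite (inj_eq (mulIf _)) ?invr_eq0 ?two_neq0 // => /eqP->.
Qed.

(** Congruence of Gram matrices is substitution of a unimodular matrix into the
    form, which spares the division by two. *)
Lemma bf_equivP Q H :
  bf_equiv Q H <-> exists x y r s : K,
    [/\ [/\ ringint x, ringint y, ringint r & ringint s],
        ringint_unit (det2 (x, y, r, s)) & H = form_sub (x, y, r, s) Q].
Proof.
split=> [[N [Ni Nu NE]]|[x [y [r [s [[xi yi ri si] Nu ->]]]]]].
  exists (N 0 0), (N 0 1), (N 1 0), (N 1 1); split=> //.
    by rewrite -[(_, _, _, _)]/(mx_tuple N) -det_mx_tuple.
  by apply: gram_inj; rewrite -[(_, _, _, _)]/(mx_tuple N) gram_form_sub.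
exists (tuple_mx (x, y, r, s)); split.
- by move=> i j; rewrite mxE; case: ifP => _; case: ifP.
- by rewrite det_mx_tuple tuple_mxK.
- by rewrite -gram_form_sub tuple_mxK.
Qed.

Lemma classical_formP Q :
  classical_form Q <-> integral_form Q /\ ringint (Q.1.2 / 2%:R).
Proof.
case: Q => [[a b] c]; split=> [[Qi /(_ 0 1)]|[Qi bi]].
  by rewrite mxE /=.
split=> // i j; rewrite mxE; case: Qi => ai _ ci.
by case: ifP => _ //; case: ifP.
Qed.

End Gram.

Section Order.
Variables (R : realType) (K : fieldExtType rat) (t m : Z) (w : K) (w1 w2 : R).
Hypothesis HK : quadratic_order t m w w1 w2.
Implicit Types (e f : qint) (Q H : bform K).

Let wE := qo_eq HK.
Local Notation ev := (qev w).
Local Notation fev := (form_ev w).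
Local Notation qmul := (qmul t m).
Local Notation qnorm := (qnorm t m).

Lemma qev_inj : injective ev.
Proof.
move=> [e1 e2] [f1 f2] /eqP; rewrite -subr_eq0 -qevB => /eqP /(qo_free HK).
by rewrite /qsub /= => -[E1 E2]; congr (_, _); lia.
Qed.

Lemma form_ev_inj : injective fev.
Proof.
move=> [[a b] c] [[a' b'] c'] [].
by move=> /qev_inj-> /qev_inj-> /qev_inj->.
Qed.

Lemma ringint_qev e : ringint (ev e). Proof. by apply/(qo_int HK); exists e. Qed.

Lemma ringintD (z z' : K) : ringint z -> ringint z' -> ringint (z + z').
Proof. by move=> /(qo_int HK)[e ->] /(qo_int HK)[f ->]; rewrite -qevD; apply: ringint_qev. Qed.
Lemma ringintB (z z' : K) : ringint z -> ringint z' -> ringint (z - z').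
Proof. by move=> /(qo_int HK)[e ->] /(qo_int HK)[f ->]; rewrite -qevB; apply: ringint_qev. Qed.
Lemma ringintM (z z' : K) : ringint z -> ringint z' -> ringint (z * z').
Proof. by move=> /(qo_int HK)[e ->] /(qo_int HK)[f ->]; rewrite -(qevM wE); apply: ringint_qev. Qed.
Lemma ringint_zr k : ringint (zr K k). Proof. by rewrite -(qev_int w); apply: ringint_qev. Qed.
Lemma ringint0 : ringint (0 : K). Proof. exact: (ringint_zr 0). Qed.
Lemma ringint1 : ringint (1 : K). Proof. exact: (ringint_zr 1). Qed.
Lemma ringintN (z : K) : ringint z -> ringint (- z).
Proof. by rewrite -sub0r; apply: ringintB ringint0. Qed.

Lemma qnorm_mul e f : qnorm (qmul e f) = (qnorm e * qnorm f)%coqZ.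
Proof. rewrite /qnorm /qmul /=; ring. Qed.

Lemma qnorm_conj e : qnorm (qconj t e) = qnorm e.
Proof. rewrite /qnorm /qconj /=; ring. Qed.

Definition qunit e : bool := (Z.abs (qnorm e) =? 1)%coqZ.

Lemma ringint_unitP e : ringint_unit (ev e) <-> qunit e.
Proof.
split=> [[_ [z /(qo_int HK)[f ->]]]|].
  rewrite -(qevM wE) => E; have /qev_inj E1 : ev (qmul e f) = ev (1, 0)%coqZ.
    by rewrite E qev_int zr1.
  have : qnorm (qmul e f) = 1%coqZ by rewrite E1 /qnorm /= !Z.mul_0_r.
  by rewrite qnorm_mul /qunit => /Z.eq_mul_1[->|->].
rewrite /qunit => He; split; first exact: ringint_qev.
exists (zr K (qnorm e) * ev (qconj t e)).
  by rewrite -qev_scale; apply: ringint_qev.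
rewrite mulrCA -(qev_norm wE) -zrM.
suff -> : (qnorm e * qnorm e = 1)%coqZ by [].
by have [->|->] : qnorm e = 1%coqZ \/ qnorm e = (-1)%coqZ by lia.
Qed.

Lemma bf_equiv_refl Q : bf_equiv Q Q.
Proof.
apply/bf_equivP; exists 1, 0, 0, 1; rewrite form_sub1; split=> //.
  by split; [exact: ringint1|exact: ringint0|exact: ringint0|exact: ringint1].
rewrite /= mulr1 mulr0 subr0; split; first exact: ringint1.
by exists 1; [exact: ringint1|rewrite mulr1].
Qed.

Lemma bf_equiv_trans Q H L : bf_equiv Q H -> bf_equiv H L -> bf_equiv Q L.
Proof.
move=> /bf_equivP[x [y [r [s [[xi yi ri si] [u1 [u' u'i uu]] ->]]]]].
move=> /bf_equivP[x' [y' [r' [s' [[xi' yi' ri' si'] [v1 [v' v'i vv]] ->]]]]].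
apply/bf_equivP; rewrite form_sub_mul /=.
do 4!eexists; split; last reflexivity.
  by split; apply: ringintD; apply: ringintM.
split; first by apply: ringintB; apply: ringintM; apply: ringintD; apply: ringintM.
exists (u' * v'); first exact: ringintM.
transitivity ((det2 (x, y, r, s) * u') * (det2 (x', y', r', s') * v')).
  by rewrite /=; ring.
by rewrite uu vv mulr1.
Qed.

Lemma bf_equiv_sym Q H : bf_equiv Q H -> bf_equiv H Q.
Proof.
move=> /bf_equivP[x [y [r [s [[xi yi ri si] [u1 [u ui uu]] ->]]]]].
apply/bf_equivP; exists (s * u), (- y * u), (- r * u), (x * u); split.
- by split; apply: ringintM => //; apply: ringintN.
- have -> : det2 (s * u, - y * u, - r * u, x * u) = u * (det2 (x, y, r, s) * u).
    by rewrite /=; ring.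
  rewrite uu mulr1; split=> //; exists (det2 (x, y, r, s)) => //.
  by rewrite mulrC.
- rewrite form_sub_mul -[LHS]form_sub1; congr (form_sub _ _).
  by congr (_, _, _, _); rewrite /= -?uu /=; ring.
Qed.

Lemma bf_equiv_act N (Q : qform) : qunit (qdet t m N) -> bf_equiv (fev Q) (fev (qact t m N Q)).
Proof.
case: N => [[[x y] r] s] Nu; apply/bf_equivP.
exists (ev x), (ev y), (ev r), (ev s); split; first by split; apply: ringint_qev.
  by rewrite -/(mat_ev w (x, y, r, s)) -(qev_det wE); apply/ringint_unitP.
by rewrite (qev_act wE).
Qed.

Lemma bf_equiv_act_ex (Q : qform) H : bf_equiv (fev Q) H ->
  exists2 N, qunit (qdet t m N) & H = fev (qact t m N Q).
Proof.
move=> /bf_equivP[x [y [r [s [[]]]]]].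
move=> /(qo_int HK)[x' ->] /(qo_int HK)[y' ->] /(qo_int HK)[r' ->] /(qo_int HK)[s' ->].
rewrite -/(mat_ev w (x', y', r', s')) -(qev_det wE) => /ringint_unitP Nu ->.
by exists (x', y', r', s') => //; rewrite (qev_act wE).
Qed.

Lemma bf_evalE Q (v : 'rV[K]_2) : bf_eval Q v = form_val Q (v 0 0) (v 0 1).
Proof. by []. Qed.

Lemma tot_psdP Q :
  tot_psd R Q <-> forall x y, totally_nonneg R (form_val Q x y).
Proof.
split=> [H x y|H v]; last by rewrite bf_evalE.
have := H (\row_(j < 2) if j == 0 then x else y).
by rewrite bf_evalE !mxE.
Qed.

Lemma tot_pdP Q :
  tot_pd R Q <-> tot_psd R Q /\
    (forall x y, form_val Q x y = 0 -> x = 0 /\ y = 0).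
Proof.
split=> -[Hp H]; split=> //.
  move=> x y E; have := H (\row_(j < 2) if j == 0 then x else y).
  rewrite bf_evalE !mxE /= => /(_ E) /rowP E1.
  by move: (E1 0) (E1 1); rewrite !mxE.
move=> v; rewrite bf_evalE => /H[v0 v1]; apply/rowP => i; rewrite mxE.
case: i => [[|[|//]] Hi]; [rewrite -[RHS]v0|rewrite -[RHS]v1]; congr (v _ _).
  exact: val_inj.
exact: val_inj.
Qed.

Lemma tot_psd_sub x y r s Q : tot_psd R Q -> tot_psd R (form_sub (x, y, r, s) Q).
Proof.
move=> /tot_psdP H; apply/tot_psdP => u v.
by rewrite (form_val_sub (x, y, r, s)); apply: H.
Qed.

(** Definiteness is preserved because the substitution is injective: its
    determinant is a unit. *)
Lemma bf_equiv_tot_pd Q H : bf_equiv Q H -> tot_pd R Q -> tot_pd R H.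
Proof.
move=> /bf_equivP[x [y [r [s [_ [_ [d' _ dd]] ->]]]]] /tot_pdP[Qp Q0].
apply/tot_pdP; split; first exact: tot_psd_sub.
move=> u v; rewrite (form_val_sub (x, y, r, s)) => /Q0[E1 E2].
have dn0 : det2 (x, y, r, s) != 0.
  by apply/eqP => d0; move: dd; rewrite d0 mul0r => /esym/eqP; rewrite oner_eq0.
have Eu : u * det2 (x, y, r, s) = 0.
  by transitivity ((u * x + v * r) * s - (u * y + v * s) * r); rewrite /=; [ring|rewrite E1 E2; ring].
have Ev : v * det2 (x, y, r, s) = 0.
  by transitivity ((u * y + v * s) * x - (u * x + v * r) * y); rewrite /=; [ring|rewrite E1 E2; ring].
by split; apply/eqP; [move/eqP: Eu|move/eqP: Ev]; rewrite mulf_eq0 (negPf dn0) orbF.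
Qed.

(** With [true] this is the classical sense; both senses of indecomposability then
    become instances, up to conversion, of [indecomposable_in]. *)
Definition sense (cl : bool) : bform K -> Prop :=
  if cl then @classical_form K else @integral_form K.

Definition indecomposable_in cl : set (bform K) :=
  [set Q | [/\ sense cl Q, tot_pd R Q & ~ decomposable_in R (sense cl) Q]].

Lemma bf_equiv_integral Q H : bf_equiv Q H -> integral_form Q -> integral_form H.
Proof.
case: Q => [[a b] c] /bf_equivP[x [y [r [s [[xi yi ri si] _ ->]]]]] [ai bi ci].
have i2 : ringint (2%:R : K) by exact: (ringint_zr 2).
by split; rewrite ?expr2; do ?[assumption|apply: ringintD|apply: ringintM].
Qed.

Lemma bf_equiv_sense cl Q H : bf_equiv Q H -> sense cl Q -> sense cl H.
Proof.
case: cl => /=; last exact: bf_equiv_integral.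
move=> QH /classical_formP[Qi bi]; apply/classical_formP.
split; first exact: bf_equiv_integral QH Qi.
case: Q bi Qi QH => [[a b] c] /= bi [ai _ ci].
move=> /bf_equivP[x [y [r [s [[xi yi ri si] _ ->]]]]] /=.
have -> : (2%:R * a * x * r + b * (x * s + y * r) + 2%:R * c * y * s) / 2%:R =
   a * x * r + b / 2%:R * (x * s + y * r) + c * y * s :> K.
  have h2 := two_neq0 K; by field.
by do ?[assumption|apply: ringintD|apply: ringintM].
Qed.

(** An equivalence acts on all forms at once, so that it carries a decomposition
    along. *)
Lemma form_sub_inv Q H : bf_equiv Q H -> exists N M : K * K * K * K,
  [/\ H = form_sub N Q, forall L, form_sub M (form_sub N L) = L,
      forall L, bf_equiv L (form_sub N L) & forall L, bf_equiv L (form_sub M L)].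
Proof.
move=> QH; have := bf_equiv_sym QH.
move: QH => /bf_equivP[x [y [r [s [xi [u1 [u ui uu]] ->]]]]] _.
have E L : form_sub (s * u, - y * u, - r * u, x * u) (form_sub (x, y, r, s) L) = L.
  rewrite form_sub_mul -[RHS]form_sub1; congr (form_sub _ _).
  by congr (_, _, _, _); rewrite /= -?uu /=; ring.
have E' L : form_sub (x, y, r, s) (form_sub (s * u, - y * u, - r * u, x * u) L) = L.
  rewrite form_sub_mul -[RHS]form_sub1; congr (form_sub _ _).
  by congr (_, _, _, _); rewrite /= -?uu /=; ring.
have E3 L : bf_equiv L (form_sub (x, y, r, s) L).
  apply/bf_equivP; exists x, y, r, s; split=> //.
  by split=> //; exists u.
exists (x, y, r, s), (s * u, - y * u, - r * u, x * u); split=> // L.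
by rewrite -{1}[L]E'; apply/bf_equiv_sym/E3.
Qed.

Lemma bf_equiv_decomposable cl Q H :
  bf_equiv Q H -> decomposable_in R (sense cl) H -> decomposable_in R (sense cl) Q.
Proof.
move=> /bf_equiv_sym /form_sub_inv[N [M [-> NM LN LM]]].
move=> [H1 [H2 [-> [H10 H20] [P1 P2] [T1 T2]]]].
exists (form_sub N H1), (form_sub N H2); split.
- exact: form_subD.
- split=> E; [apply: H10|apply: H20]; by rewrite -[LHS]NM E form_sub0.
- by split; [apply: bf_equiv_sense (LN _) P1|apply: bf_equiv_sense (LN _) P2].
- by case: N {NM LN} => [[[x y] r] s]; split; apply: tot_psd_sub.
Qed.

Lemma bf_equiv_indecomposable cl Q H :
  bf_equiv Q H -> indecomposable_in cl Q -> indecomposable_in cl H.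
Proof.
move=> QH [Q1 Q2 Q3]; split; first exact: bf_equiv_sense QH Q1.
  exact: bf_equiv_tot_pd QH Q2.
by move=> /(bf_equiv_decomposable QH).
Qed.

End Order.

(** * Integers and embeddings of a real quadratic field *)
Section Coordinates.
Variables (K : fieldExtType rat) (D : nat) (s : K).
Hypothesis s_sq : s ^+ 2 = D%:R.
Hypothesis s_gen : <<1; s>>%VS = fullv.
Hypothesis D_gt1 : (1 < D)%N.
Hypothesis D_sqf : forall d : nat, (d * d %| D)%N -> d = 1%N.

(** A square in the denominator cannot be cancelled by the squarefree [D]. *)
Lemma square_denom (q : rat) (k : int) : D%:R * q ^+ 2 = k%:~R -> denq q = 1.
Proof.
move=> E; have cop := coprime_num_den q.
have dn0 : (denq q)%:~R != 0 :> rat by rewrite intr_eq0 denq_neq0.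
have E1 : (D%:Z * numq q ^+ 2 = k * denq q ^+ 2)%R.
  apply: (@intr_inj rat); rewrite !intrM -E !numqE -[(D%:Z)%:~R]/(D%:R).
  ring.
have Hd : (`|denq q| * `|denq q| %| D)%N.
  rewrite -(@Gauss_dvdl _ _ (`|numq q| * `|numq q|)); last first.
    by rewrite !mulnn coprimeXl // coprimeXr // coprime_sym.
  by have /(congr1 absz) := E1; rewrite !abszM absz_nat => ->; apply: dvdn_mull.
have /D_sqf d1 := Hd.
by rewrite -[denq q]gez0_abs ?d1 // ltW // denq_gt0.
Qed.

Lemma rat_sq_neq (q : rat) : q ^+ 2 != D%:R.
Proof.
apply/eqP => E.
have dn : denq q = 1.
  apply: (@square_denom q (D%:Z ^+ 2)); rewrite E rmorphXn /=; ring.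
have Eq : q = (numq q)%:~R by rewrite -{1}[q]divq_num_den dn divr1.
have : (`|numq q| * `|numq q| = D)%N.
  have : (numq q) ^+ 2 = D%:Z by apply: (@intr_inj rat); rewrite rmorphXn /= -Eq E.
  by move/(congr1 absz); rewrite abszX absz_nat => <-; rewrite mulnn.
move=> E2; have : `|numq q|%N = 1%N by apply: D_sqf; rewrite E2.
by move=> E3; move: D_gt1; rewrite -E2 E3.
Qed.

Lemma quad_coord_free (x y : rat) : x%:A + y%:A * s = 0 -> x = 0 /\ y = 0.
Proof.
move=> E; have [y0|yn0] := eqVneq y 0.
  move: E; rewrite y0 scale0r mul0r addr0 => /eqP.
  by rewrite scaler_eq0 oner_eq0 orbF => /eqP.
have : ((- x / y) ^+ 2)%:A = (D%:R)%:A :> K.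
  have -> : (D%:R)%:A = s ^+ 2 by rewrite s_sq -(rmorph_nat (in_alg K)).
  rewrite -[LHS]/(in_alg K _) rmorphXn; congr (_ ^+ 2).
  have yA : y%:A != 0 :> K by rewrite scaler_eq0 oner_eq0 orbF.
  apply: (mulfI yA); rewrite -[RHS]subr0 -E fmorph_div rmorphN /=.
  by rewrite mulrCA divff // mulr1; ring.
by move/(fmorph_inj (in_alg K))/eqP; rewrite (negPf (rat_sq_neq _)).
Qed.

Lemma quad_coord_ex (z : K) : exists x y : rat, z = x%:A + y%:A * s.
Proof.
have : z \in <<1; s>>%VS by rewrite s_gen memvf.
case/Fadjoin1_polyP => p ->.
elim/poly_ind: p => [|p c [x [y E]]].
  by exists 0, 0; rewrite rmorph0 horner0 !scale0r mul0r addr0.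
exists (c + y * D%:R), x.
rewrite rmorphD rmorphM /= map_polyX map_polyC /= hornerMXaddC E.
rewrite scalerDl -[(y * _)%:A]/(in_alg K _) rmorphM rmorph_nat /= -s_sq; ring.
Qed.

Lemma quad_coord_pair_ex (z : K) : exists q : rat * rat, z = q.1%:A + q.2%:A * s.
Proof. by have [x [y ->]] := quad_coord_ex z; exists (x, y). Qed.

Definition quad_coord (z : K) : rat * rat := sval (cid (quad_coord_pair_ex z)).

Lemma quad_coordK z : z = (quad_coord z).1%:A + (quad_coord z).2%:A * s.
Proof. exact: svalP (cid (quad_coord_pair_ex z)). Qed.

Lemma quad_coordE (x y : rat) : quad_coord (x%:A + y%:A * s) = (x, y).
Proof.
have E := quad_coordK (x%:A + y%:A * s); rewrite [LHS]surjective_pairing.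
have [] : x - (quad_coord (x%:A + y%:A * s)).1 = 0 /\ y - (quad_coord (x%:A + y%:A * s)).2 = 0.
  apply: quad_coord_free; rewrite !scalerBl; move/eqP: E; rewrite -subr_eq0 => /eqP E.
  by rewrite -[RHS]E; ring.
by move=> /subr0_eq <- /subr0_eq <-.
Qed.

(** Both roots of [D] give an embedding, through the coordinates on [1] and
    [s]. *)
Lemma embedding_ex (R : realType) (r : R) : r ^+ 2 = D%:R ->
  exists f : {rmorphism K -> R}, f s = r.
Proof.
move=> rD; pose f z : R := ratr (quad_coord z).1 + ratr (quad_coord z).2 * r.
have fE x y : f (x%:A + y%:A * s) = ratr x + ratr y * r by rewrite /f quad_coordE.
have fB : zmod_morphism f.
  move=> z z'; rewrite [z]quad_coordK [z']quad_coordK !fE.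
  move: (quad_coord z) (quad_coord z') => [a b] [c d] /=.
  have -> : a%:A + b%:A * s - (c%:A + d%:A * s) = (a - c)%:A + (b - d)%:A * s.
    by rewrite !scalerBl; ring.
  by rewrite fE !rmorphB /=; ring.
have fM : monoid_morphism f.
  split=> [|z z'].
    have -> : 1 = 1%:A + 0%:A * s :> K by rewrite scale1r scale0r mul0r addr0.
    by rewrite fE rmorph1 rmorph0 mul0r addr0.
  rewrite [z]quad_coordK [z']quad_coordK !fE.
  move: (quad_coord z) (quad_coord z') => [a b] [c d] /=.
  have -> : (a%:A + b%:A * s) * (c%:A + d%:A * s) =
      (a * c + b * d * D%:R)%:A + (a * d + b * c)%:A * s.
    rewrite -![(_ + _)%:A]/(in_alg K _) !rmorphD !rmorphM rmorph_nat /= -s_sq; ring.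
  by rewrite fE !rmorphD !rmorphM rmorph_nat /= -rD; ring.
pose F := HB.pack_for {rmorphism K -> R} f
  (GRing.isZmodMorphism.Build K R f fB) (GRing.isMonoidMorphism.Build K R f fM).
exists F; have -> : s = 0%:A + 1%:A * s by rewrite scale1r scale0r mul1r add0r.
by rewrite [LHS]fE rmorph1 rmorph0 mul1r add0r.
Qed.

Lemma embedding_sq (R : realType) (f : {rmorphism K -> R}) :
  f s = Num.sqrt D%:R \/ f s = - Num.sqrt D%:R.
Proof.
have : (f s) ^+ 2 = (Num.sqrt (D%:R : R)) ^+ 2.
  by rewrite -rmorphXn s_sq rmorph_nat sqr_sqrtr.
by move/eqP; rewrite eqf_sqr => /orP[/eqP|/eqP]; [left|right].
Qed.

(** Gauss's lemma: a monic rational divisor of a monic integral polynomial has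
    integral coefficients. *)
Lemma monic_divisor_int (P : {poly int}) (q : {poly rat}) : P \is monic ->
  q \is monic -> q %| map_poly intr P -> forall i, exists k : int, q`_i = k%:~R.
Proof.
move=> Pm qm /dvdpP_rat_int[p [a an0 qE] [r PE]] i.
have lu : lead_coef p * lead_coef r = 1.
  by rewrite -lead_coefM -PE; apply/monicP.
have aE : a * (lead_coef p)%:~R = lead_coef q.
  rewrite qE lead_coefZ; congr (_ * _).
  by rewrite lead_coef_map_inj //; apply: intr_inj.
have aE2 : a = (lead_coef r)%:~R.
  have lu' : (lead_coef p)%:~R * (lead_coef r)%:~R = 1 :> rat by rewrite -intrM lu.
  transitivity (a * ((lead_coef p)%:~R * (lead_coef r)%:~R)); first by rewrite lu' mulr1.
  by rewrite mulrA aE (monicP qm) mul1r.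
by exists (lead_coef r * p`_i); rewrite qE coefZ coef_map /= aE2 rmorphM.
Qed.

Lemma horner_quadratic (b c : rat) (z : K) :
  (map_poly (in_alg K) ('X^2 - b *: 'X + c%:P)).[z] = z ^+ 2 - b%:A * z + c%:A.
Proof.
rewrite rmorphD rmorphB /= map_polyXn map_polyC map_polyZ map_polyX /=.
by rewrite hornerD hornerC hornerD hornerN hornerZ hornerX hornerXn.
Qed.

(** If [y] is not zero, the characteristic polynomial of [x + y s] is its minimal
    polynomial, hence divides every monic polynomial that vanishes there, and is
    integral by Gauss's lemma. *)
Lemma ringint_char_poly (x y : rat) : ringint (x%:A + y%:A * s) ->
  exists k l : int, 2%:R * x = k%:~R /\ x ^+ 2 - D%:R * y ^+ 2 = l%:~R.
Proof.
move=> [P Pm]; rewrite /root.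
have -> : map_poly intr P = map_poly (in_alg K) (map_poly (intr : int -> rat) P).
  by rewrite -map_poly_comp; apply: eq_map_poly => k /=; rewrite -(rmorph_int (in_alg K)).
set Q := map_poly intr P => Qz.
have [y0|yn0] := eqVneq y 0.
  have : root Q x.
    move: Qz; rewrite y0 scale0r mul0r addr0 -[x%:A]/(in_alg K x) horner_map /=.
    by rewrite scaler_eq0 oner_eq0 orbF.
  rewrite -dvdp_XsubCl => /(monic_divisor_int Pm (monicXsubC x)) /(_ 0%N) [k].
  rewrite coefB coefX coefC sub0r => xE.
  exists (- 2%:Z * k), (k ^+ 2); rewrite y0 expr0n mulr0 subr0.
  by rewrite -[x]opprK xE !(rmorphM, rmorphN, rmorphXn) /= sqrrN; split=> //; ring.
pose q : {poly rat} := 'X^2 - (2%:R * x) *: 'X + (x ^+ 2 - D%:R * y ^+ 2)%:P.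
have sq : size q = 3%N.
  rewrite /q -addrA size_polyDl ?size_polyXn // (leq_ltn_trans (size_polyD _ _)) //.
  rewrite gtn_max size_polyN (leq_ltn_trans (size_scale_leq _ _)) ?size_polyX //=.
  by rewrite (leq_ltn_trans (size_polyC_leq1 _)).
have qm : q \is monic.
  by rewrite monicE lead_coefE sq /= !coefD coefN coefZ coefXn coefX coefC /= mulr0 oppr0 !addr0.
have qz : (map_poly (in_alg K) q).[x%:A + y%:A * s] = 0.
  rewrite horner_quadratic.
  have -> : (2%:R * x)%:A = 2%:R * x%:A :> K.
    by rewrite -[LHS]/(in_alg K _) rmorphM rmorph_nat.
  have -> : (x ^+ 2 - D%:R * y ^+ 2)%:A = x%:A ^+ 2 - s ^+ 2 * y%:A ^+ 2 :> K.
    by rewrite -[LHS]/(in_alg K _) rmorphB rmorphXn rmorphM rmorphXn rmorph_nat s_sq.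
  ring.
have qQ : q %| Q.
  have r_size : (size (Q %% q)%R < 3)%N by rewrite -sq ltn_modp -size_poly_eq0 sq.
  have r0 : (map_poly (in_alg K) (Q %% q)).[x%:A + y%:A * s] = 0.
    by move/eqP: Qz; rewrite {1}(divp_eq Q q) rmorphD rmorphM hornerD hornerM qz mulr0 add0r.
  rewrite /dvdp; move: r_size r0; set r := Q %% q => r_size.
  have -> : r = (r`_1) *: 'X + (r`_0)%:P.
    apply/polyP => i; rewrite coefD coefZ coefX coefC.
    case: i => [|[|i]] /=; rewrite ?mulr0 ?mulr1 ?add0r ?addr0 //.
    by rewrite nth_default //; apply: (@leq_trans 2).
  rewrite rmorphD /= linearZ_LR /= map_polyX map_polyC /= !hornerE => E.
  have [] : (r`_0 + r`_1 * x) = 0 /\ r`_1 * y = 0.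
    apply: quad_coord_free; rewrite -[RHS]E -![(_ * _)%:A]/(in_alg K _) -[(_ + _)%:A]/(in_alg K _).
    by rewrite rmorphD !rmorphM /=; ring.
  move=> + /eqP; rewrite mulf_eq0 (negPf yn0) orbF => + /eqP r10.
  by rewrite r10 mul0r addr0 => ->; rewrite scale0r addr0.
have Hq := monic_divisor_int Pm qm qQ.
have [k Ek] := Hq 1%N; have [l El] := Hq 0%N.
have q1 : q`_1 = - (2%:R * x).
  by rewrite !coefD coefN coefZ coefXn coefX coefC /= mulr1 sub0r addr0.
have q0 : q`_0 = x ^+ 2 - D%:R * y ^+ 2.
  by rewrite !coefD coefN coefZ coefXn coefX coefC /= mulr0 oppr0 !add0r.
by exists (- k), l; rewrite mulrNz -Ek -El q1 q0 opprK.
Qed.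

End Coordinates.

(** When [D] is not [1] modulo four, an integer [(X + Y s) / 2] has even
    coordinates: the squares modulo four are [0] and [1]. *)
Lemma even_pair (D X Y M : Z) : (X * X - D * (Y * Y) = 4 * M)%coqZ ->
  (D mod 4 = 2 \/ D mod 4 = 3)%coqZ ->
  exists x y : Z, (X = 2 * x /\ Y = 2 * y)%coqZ.
Proof.
move=> E HD; have DE := Z.div_mod D 4; move: (D / 4)%coqZ (D mod 4)%coqZ DE HD => q r DE HD.
have {}DE : (D = 4 * q + r)%coqZ by apply: DE.
rewrite {}DE in E.
have [[u Eu]|[u Eu]] := Z.Even_or_Odd X; have [[v Ev]|[v Ev]] := Z.Even_or_Odd Y;
  first (by exists u, v); exfalso; rewrite Eu Ev in E; case: HD => rE; rewrite rE in E; lia.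
Qed.

Lemma same_parity (D X Y M : Z) : (X * X - D * (Y * Y) = 4 * M)%coqZ ->
  (D mod 4 = 1)%coqZ -> exists x : Z, (X - Y = 2 * x)%coqZ.
Proof.
move=> E HD; have DE := Z.div_mod D 4; move: (D / 4)%coqZ (D mod 4)%coqZ DE HD => q r DE HD.
have {}DE : (D = 4 * q + r)%coqZ by apply: DE.
rewrite {}DE HD in E.
have [[u Eu]|[u Eu]] := Z.Even_or_Odd X; have [[v Ev]|[v Ev]] := Z.Even_or_Odd Y.
- by exists (u - v)%coqZ; lia.
- by exfalso; rewrite Eu Ev in E; lia.
- by exfalso; rewrite Eu Ev in E; lia.
- by exists (u - v)%coqZ; lia.
Qed.

Lemma zr_nat (A : comNzRingType) n : zr A (Z.of_nat n) = n%:R.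
Proof. by rewrite /zr -[Z.of_nat n]/(Z_of_int n) Z_of_intK. Qed.

Lemma zr_int (A : comNzRingType) (k : int) : zr A (Z_of_int k) = k%:~R.
Proof. by rewrite /zr Z_of_intK. Qed.

Lemma zr_inj_num (A : numDomainType) : injective (zr A).
Proof. by move=> x y /intr_inj /(can_inj int_of_ZK). Qed.

Lemma of_nat_mod4 D r : (D %% 4 = r)%N -> (Z.of_nat D mod 4 = Z.of_nat r)%coqZ.
Proof.
move=> <-; symmetry; apply: (Z.mod_unique_pos _ _ (Z.of_nat (D %/ 4)%N)).
  by have := ltn_pmod D (isT : (0 < 4)%N); lia.
by have := divn_eq D 4; move: (D %/ 4)%N (D %% 4)%N => q k ->; lia.
Qed.

Section QuadraticFields.
Variables (R : realType) (K : fieldExtType rat) (D : nat) (s : K).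
Hypothesis s_sq : s ^+ 2 = D%:R.
Hypothesis s_gen : <<1; s>>%VS = fullv.
Hypothesis D_gt1 : (1 < D)%N.
Hypothesis D_sqf : forall d : nat, (d * d %| D)%N -> d = 1%N.

(** Trace and norm are integral, hence twice an integer has integral coordinates,
    and four divides the norm of its double. *)
Lemma ringint_half (z : K) : ringint z -> exists X Y M : Z,
  2%:R * z = zr K X + zr K Y * s /\ (X * X - Z.of_nat D * (Y * Y) = 4 * M)%coqZ.
Proof.
rewrite {1}[z](quad_coordK s_sq s_gen); move: (quad_coordK s_sq s_gen z).
move: (quad_coord s_sq s_gen z) => [x y] /= zE.
move=> /(ringint_char_poly s_sq D_gt1 D_sqf)[k [l [Ek El]]].
have E2 : D%:R * (2%:R * y) ^+ 2 = (k ^+ 2 - 4%:Z * l)%:~R.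
  by rewrite rmorphB rmorphXn rmorphM /= -Ek -El; ring.
have dn := square_denom D_sqf E2.
have yE : 2%:R * y = (numq (2%:R * y))%:~R by rewrite numqE dn mulr1.
exists (Z_of_int k), (Z_of_int (numq (2%:R * y))), (Z_of_int l); split.
  rewrite !zr_int zE.
  have -> : k%:~R = 2%:R * x%:A :> K.
    by rewrite -(rmorph_int (in_alg K)) -Ek rmorphM rmorph_nat.
  have -> : (numq (2%:R * y))%:~R = 2%:R * y%:A :> K.
    by rewrite -(rmorph_int (in_alg K)) -yE rmorphM rmorph_nat.
  by ring.
apply: (@zr_inj_num rat).
rewrite zrB -[in RHS]/(Z.mul 4 (Z_of_int l)) !zrM zr4 !zr_int zr_nat -yE.
by move: E2; rewrite rmorphB rmorphXn rmorphM /= => E2; move: E2; rewrite !expr2; lra.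
Qed.

Lemma sqrtD : (Num.sqrt D%:R : R) ^+ 2 = D%:R.
Proof. by rewrite sqr_sqrtr. Qed.

Lemma sqrtD_gt0 : 0 < Num.sqrt D%:R :> R.
Proof. by rewrite sqrtr_gt0 ltr0n ltnW. Qed.

Lemma zr_free (x y : Z) : zr K x + zr K y * s = 0 -> x = Z0 /\ y = Z0.
Proof.
have zA k : zr K k = (zr rat k)%:A by rewrite /zr -(rmorph_int (in_alg K)).
rewrite !zA => /(quad_coord_free s_sq D_gt1 D_sqf) [].
by rewrite -!(zr0 rat) => /zr_inj_num-> /zr_inj_num->.
Qed.

Lemma integral_zr k : integralOver (intr : int -> K) (zr K k).
Proof. exact: (integral_id (intr : {rmorphism int -> K})). Qed.

Lemma integral_ev (t m : Z) (w : K) e : w ^+ 2 = zr K t * w + zr K m ->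
  ringint (qev w e).
Proof.
move=> wE; rewrite /qev; apply: integral_add; first exact: integral_zr.
apply: integral_mul; first exact: integral_zr.
exists ('X^2 - (int_of_Z t) *: 'X - (int_of_Z m)%:P).
  rewrite monicE lead_coefDl ?lead_coefDl ?lead_coefXn //.
    rewrite size_polyXn size_polyN (leq_ltn_trans (size_scale_leq _ _)) //.
    by rewrite size_polyX.
  rewrite size_polyN size_polyDl ?size_polyXn.
    by rewrite (leq_ltn_trans (size_polyC_leq1 _)).
  rewrite size_polyN (leq_ltn_trans (size_scale_leq _ _)) //.
  by rewrite size_polyX.
rewrite /root !rmorphB /= map_polyXn map_polyC map_polyZ map_polyX /=.
rewrite !hornerE -/(zr K t) -/(zr K m).
by apply/eqP; move: wE; rewrite expr2 => ->; ring.
Qed.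

Lemma quadratic_order_0 : (D %% 4 = 2 \/ D %% 4 = 3)%N ->
  quadratic_order 0 (Z.of_nat D) s (Num.sqrt D%:R : R) (- Num.sqrt D%:R).
Proof.
move=> D4; have sE : s ^+ 2 = zr K 0 * s + zr K (Z.of_nat D).
  by rewrite zr0 mul0r add0r zr_nat.
split=> //.
- by move=> [x y] /zr_free /= [-> ->].
- move=> z; split=> [/ringint_half[X [Y [M [zE E]]]]|[e ->]]; last exact: integral_ev sE.
  have [|x [y [Ex Ey]]] := even_pair E.
    by case: D4 => /of_nat_mod4 ->; [left|right].
  exists (x, y); apply: (mulfI (two_neq0 K)).
  by rewrite zE Ex Ey !zrM zr2 /qev /=; ring.
- by rewrite zr0 subrr.
- by rewrite mulrN -expr2 sqrtD zr_nat.
- by rewrite -subr_gt0 opprK addr_gt0 // sqrtD_gt0.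
- by move=> f; apply: embedding_sq.
- exact: (embedding_ex s_sq s_gen D_gt1 D_sqf sqrtD).
- by apply: (embedding_ex s_sq s_gen D_gt1 D_sqf); rewrite sqrrN sqrtD.
Qed.

Lemma quadratic_order_1 : (D %% 4 = 1)%N ->
  quadratic_order 1 (Z.of_nat (D %/ 4)%N) ((1 + s) / 2%:R)
    ((1 + Num.sqrt D%:R) / 2%:R : R) ((1 - Num.sqrt D%:R) / 2%:R).
Proof.
move=> D4; set w := (1 + s) / 2%:R.
have DE (A : comNzRingType) : D%:R = 4%:R * (D %/ 4)%N%:R + 1 :> A.
  by rewrite {1}(divn_eq D 4) D4 natrD natrM mulrC.
have h2 := two_neq0 K.
have h4 : 4%:R != 0 :> K.
  by rewrite (_ : 4%:R = 2%:R * 2%:R :> K) ?mulf_neq0 //; ring.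
have wE : w ^+ 2 = zr K 1 * w + zr K (Z.of_nat (D %/ 4)%N).
  rewrite zr1 zr_nat mul1r /w.
  have -> : (D %/ 4)%N%:R = (s ^+ 2 - 1) / 4%:R :> K.
    by rewrite s_sq DE addrK mulrC mulKf.
  by field; rewrite ?h2 ?h4.
have sw : s = 2%:R * w - 1 by rewrite /w mulrC divfK // addrC addKr.
split=> //.
- move=> [x y] /= E.
  have : zr K (2 * x + y)%coqZ + zr K y * s = 0.
    transitivity (2%:R * qev w (x, y)); last by rewrite E mulr0.
    by rewrite zrD zrM zr2 /qev /= sw; ring.
  by move=> /zr_free[Ex Ey]; rewrite Ey; congr (_, _); lia.
- move=> z; split=> [/ringint_half[X [Y [M [zE E]]]]|[e ->]]; last exact: integral_ev wE.
  have [x Ex] := same_parity E (of_nat_mod4 D4).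
  exists (x, Y); apply: (mulfI h2).
  have XE : X = (2 * x + Y)%coqZ by clear -Ex; lia.
  by rewrite zE XE zrD zrM zr2 /qev /= sw; ring.
- by rewrite zr1; field.
- rewrite zr_nat.
  have -> : (D %/ 4)%N%:R = (Num.sqrt D%:R ^+ 2 - 1) / 4%:R :> R.
    by rewrite sqrtD DE addrK mulrC mulKf // pnatr_eq0.
  by field.
- by rewrite ltr_pM2r ?invr_gt0 ?ltr0n // ltrD2l -subr_gt0 opprK addr_gt0 // sqrtD_gt0.
- move=> f; rewrite /w fmorph_div rmorphD rmorph1 rmorph_nat.
  by have [->|->] := embedding_sq s_sq f; [left|right].
- have [f fs] := embedding_ex s_sq s_gen D_gt1 D_sqf sqrtD.
  by exists f; rewrite /w fmorph_div rmorphD rmorph1 rmorph_nat fs.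
- have [|f fs] := @embedding_ex K D s s_sq s_gen D_gt1 D_sqf R (- Num.sqrt D%:R).
    by rewrite sqrrN sqrtD.
  by exists f; rewrite /w fmorph_div rmorphD rmorph1 rmorph_nat fs.
Qed.

End QuadraticFields.

(** * Decompositions and positivity in coordinates *)
Definition qeven (e : qint) : bool := Z.even e.1 && Z.even e.2.
Definition qsense (cl : bool) (Q : qform) : bool := ~~ cl || qeven Q.1.2.
Definition qform_minus (Q H : qform) : qform :=
  (qsub Q.1.1 H.1.1, qsub Q.1.2 H.1.2, qsub Q.2 H.2).
Definition qform0 : qform := ((0, 0), (0, 0), (0, 0))%coqZ.
(** One summand determines the other one, and only one needs to be tested for the
    sense, because the sum has it. *)
Definition qsplits (t m : Z) (cl : bool) (Q Q1 : qform) : bool :=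
  [&& qsense cl Q1, Q1 != qform0, Q1 != Q,
      qpsd t m Q1 & qpsd t m (qform_minus Q Q1)].

Lemma qeven_scale e : qeven (qscale (-2)%coqZ e).
Proof. by rewrite /qeven !Z.even_mul. Qed.

Section RealInequalities.
Variable R : realType.

Lemma zr_le x y : (zr R x <= zr R y) = (x <=? y)%coqZ.
Proof. by rewrite /zr ler_int; lia. Qed.
Lemma zr_lt x y : (zr R x < zr R y) = (x <? y)%coqZ.
Proof. by rewrite /zr ltr_int; lia. Qed.

(** Complete the square; if [a] vanishes then so does [b]. *)
Lemma binary_psd (a b c x y : R) :
  0 <= a -> 0 <= c -> 0 <= 4%:R * a * c - b ^+ 2 ->
  0 <= a * x ^+ 2 + b * x * y + c * y ^+ 2.
Proof.
rewrite le_eqVlt => /orP[/eqP<- c0 d0|a0 c0 d0].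
  have -> : b = 0 by apply/eqP; rewrite -sqrf_eq0; apply/eqP; nra.
  by rewrite !mul0r !add0r mulr_ge0 // sqr_ge0.
rewrite -(pmulr_rge0 _ a0).
have -> : a * (a * x ^+ 2 + b * x * y + c * y ^+ 2) =
  (a * x + b * y / 2%:R) ^+ 2 + (4%:R * a * c - b ^+ 2) * y ^+ 2 / 4%:R by field.
by rewrite addr_ge0 ?sqr_ge0 // divr_ge0 // mulr_ge0 // sqr_ge0.
Qed.

(** At one real place: if [4 al Q(x, y) <= d] then the coefficient [al y ^ 2] of
    the split off form is at most [a], because
    [4 a Q(x, y) = (2 a x + b y) ^ 2 + d y ^ 2]. *)
Lemma rank_one_le (a b c al x y : R) : 0 < a -> 0 < 4%:R * a * c - b ^+ 2 ->
  0 < al ->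
  4%:R * al * (a * x ^+ 2 + b * x * y + c * y ^+ 2) <= 4%:R * a * c - b ^+ 2 ->
  al * y ^+ 2 <= a.
Proof.
move=> a0 d0 al0 H; rewrite -(ler_pM2l d0).
apply: (@le_trans _ _ (al * ((2%:R * a * x + b * y) ^+ 2 +
                             (4%:R * a * c - b ^+ 2) * y ^+ 2))).
  have := mulr_ge0 (ltW al0) (sqr_ge0 (2%:R * a * x + b * y)); lra.
have := ler_wpM2l (ltW a0) H; lra.
Qed.

End RealInequalities.

Section Positivity.
Variables (R : realType) (K : fieldExtType rat) (t m : Z) (w : K) (w1 w2 : R).
Hypothesis HK : quadratic_order t m w w1 w2.
Implicit Types (e f : qint) (Q : qform).

Let wE := qo_eq HK.
Local Notation ev := (qev w).
Local Notation fev := (form_ev w).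
Local Notation ev1 := (qev w1).
Local Notation ev2 := (qev w2).

Lemma w1_eq : w1 ^+ 2 = zr R t * w1 + zr R m.
Proof. by rewrite -(qo_sum HK) -[zr R m]opprK -(qo_prod HK); ring. Qed.
Lemma w2_eq : w2 ^+ 2 = zr R t * w2 + zr R m.
Proof. by rewrite -(qo_sum HK) -[zr R m]opprK -(qo_prod HK); ring. Qed.

Lemma ev1_conj e : ev1 (qconj t e) = ev2 e.
Proof. by rewrite qev_conj /qev -(qo_sum HK); ring. Qed.
Lemma ev2_conj e : ev2 (qconj t e) = ev1 e.
Proof. by rewrite qev_conj /qev -(qo_sum HK); ring. Qed.

Lemma ev_norm e : zr R (qnorm t m e) = ev1 e * ev2 e.
Proof. by rewrite (qev_norm w1_eq) ev1_conj. Qed.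
Lemma ev_tr e : zr R (qtr t e) = ev1 e + ev2 e.
Proof. by rewrite (qev_tr _ w1) ev1_conj. Qed.

Lemma qnonnegP e : qnonneg t m e <-> 0 <= ev1 e /\ 0 <= ev2 e.
Proof.
rewrite /qnonneg -!(zr_le R) !zr0 ev_norm ev_tr; split=> [/andP[]|[]]; first nra.
by move=> *; rewrite addr_ge0 ?mulr_ge0.
Qed.

Lemma qposP e : qpos t m e <-> 0 < ev1 e /\ 0 < ev2 e.
Proof.
rewrite /qpos -!(zr_lt R) !zr0 ev_norm ev_tr; split=> [/andP[]|[]]; first nra.
by move=> *; rewrite addr_gt0 ?mulr_gt0.
Qed.

Lemma qev_eq0 e : ev e = 0 -> e = (Z0, Z0). Proof. exact: qo_free HK e. Qed.

Lemma qnorm_eq0 e : qnorm t m e = Z0 -> e = (Z0, Z0).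
Proof.
move=> E; have : ev e * ev (qconj t e) = 0 by rewrite -(qev_norm wE) E.
move/eqP; rewrite mulf_eq0 => /orP[/eqP/qev_eq0 //|/eqP/qev_eq0].
case: e {E} => x y; rewrite /qconj /= => -[E1 E2];
have y0 : y = Z0 by lia.
by rewrite y0 Z.mul_0_r Z.add_0_r in E1; rewrite E1 y0.
Qed.

Lemma qpos0 : qpos t m (Z0, Z0) = false.
Proof. by rewrite /qpos /qtr /= Z.mul_0_r. Qed.

Lemma qpos_nonneg e : qpos t m e = qnonneg t m e && (e != (Z0, Z0)).
Proof.
apply/idP/andP => [H|[]].
  split; last by apply/eqP => E; rewrite E qpos0 in H.
  by apply/qnonnegP; move/qposP: H => [/ltW-> /ltW->].
move=> /[dup] H /qnonnegP[H1 H2] /eqP E; apply/qposP.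
have : ev1 e * ev2 e != 0.
  apply/eqP; rewrite -ev_norm => E'; apply/E/qnorm_eq0.
  have : (zr R (qnorm t m e) <= zr R 0) && (zr R 0 <= zr R (qnorm t m e)).
    by rewrite E' zr0 lexx.
  by rewrite !zr_le; lia.
by rewrite mulf_eq0 negb_or !lt0r H1 H2 !andbT => /andP[].
Qed.

Lemma rmorph_zr (s : {rmorphism K -> R}) k : s (zr K k) = zr R k.
Proof. by rewrite /zr rmorph_int. Qed.
Lemma rmorph_qev (s : {rmorphism K -> R}) e : s (ev e) = qev (s w) e.
Proof. by rewrite /qev rmorphD rmorphM !rmorph_zr. Qed.

Lemma totally_nonnegP e : totally_nonneg R (ev e) <-> qnonneg t m e.
Proof.
split=> [H|/qnonnegP[H1 H2] s]; last first.
  by rewrite rmorph_qev; case: (qo_emb HK s) => ->.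
apply/qnonnegP; have [s1 E1] := qo_emb1 HK; have [s2 E2] := qo_emb2 HK.
by move: (H s1) (H s2); rewrite !rmorph_qev E1 E2.
Qed.

(** Values on the standard basis give the outer coefficients, and the value at
    [(b, - 2 a)] is [a d].  If [a] vanishes, a nonzero [b] would produce the value
    [-1]. *)
Lemma tot_psd_fev Q : tot_psd R (fev Q) <-> qpsd t m Q.
Proof.
case: Q => [[a b] c]; split=> [/tot_psdP H|]; last first.
  move=> /and3P[/totally_nonnegP Ha /totally_nonnegP Hc /totally_nonnegP Hd].
  move: Ha Hc Hd; rewrite (qev_disc wE) /=; move: (ev a) (ev b) (ev c) => A B C.
  move=> HA HC HD; apply/tot_psdP => x y s /=.
  rewrite !(rmorphD, rmorphM, rmorphXn); apply: binary_psd => //.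
  by have := HD s; rewrite !(rmorphB, rmorphM, rmorphXn) rmorph_nat.
have Hv x y : qnonneg t m (qval t m (a, b, c) x y).
  by apply/totally_nonnegP; rewrite (qev_val wE); apply: H.
have Ha : qnonneg t m a.
  by apply/totally_nonnegP; have := H 1 0 => /=; rewrite expr1n expr0n !mulr0 !addr0 mulr1.
have Hc : qnonneg t m c.
  by apply/totally_nonnegP; have := H 0 1 => /=; rewrite expr1n expr0n !mulr0 !mul0r !add0r mulr1.
apply/and3P; split=> //.
have [a0|an0] := eqVneq a (Z0, Z0).
  suff b0 : ev b = 0.
    apply/totally_nonnegP => s; rewrite (qev_disc wE) /= b0 a0 /qev /= zr0.
    by rewrite !(mulr0, mul0r, addr0, expr0n) /= subr0 rmorph0.
  apply/eqP; apply: contraT => bn0.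
  have := H (- (ev c + 1) / ev b) 1.
  have -> : form_val (fev (a, b, c)) (- (ev c + 1) / ev b) 1 = - 1.
    by rewrite /= a0 /qev /= zr0; field.
  have [s _] := qo_emb1 HK => /(_ s); rewrite rmorphN rmorph1; lra.
have /qposP[a1 a2] : qpos t m a by rewrite qpos_nonneg Ha an0.
have /qnonnegP := Hv b (qscale (-2)%coqZ a).
rewrite !(qev_val w1_eq) !(qev_val w2_eq) => -[h1 h2].
apply/qnonnegP; rewrite (qev_disc w1_eq) (qev_disc w2_eq) /=.
move: h1 h2; rewrite /= !qev_scale (_ : zr R (-2)%coqZ = - 2%:R) //.
move: (ev1 a) (ev1 b) (ev1 c) (ev2 a) (ev2 b) (ev2 c) a1 a2 => x y z x' y' z' a1 a2 h1 h2.
split.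
  rewrite -(pmulr_rge0 _ a1); apply: le_trans h1 _.
  by rewrite le_eqVlt; apply/orP; left; apply/eqP; ring.
rewrite -(pmulr_rge0 _ a2); apply: le_trans h2 _.
by rewrite le_eqVlt; apply/orP; left; apply/eqP; ring.
Qed.

Lemma qpd_psd Q : qpd t m Q -> qpsd t m Q.
Proof.
case: Q => [[a b] c] /andP[/qposP[a1 a2] /qposP[]].
rewrite (qev_disc w1_eq) (qev_disc w2_eq) => /= d1 d2.
apply/and3P; split.
- by apply/qnonnegP; rewrite !ltW.
- apply/qnonnegP; split.
    by rewrite -(pmulr_rge0 _ a1); have := sqr_ge0 (ev1 b); move: d1; lra.
  by rewrite -(pmulr_rge0 _ a2); have := sqr_ge0 (ev2 b); move: d2; lra.
- by apply/qnonnegP; rewrite (qev_disc w1_eq) (qev_disc w2_eq) /= !ltW.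
Qed.

(** One embedding suffices to see that no nonzero vector is isotropic; conversely
    [(b, - 2 a)] is isotropic when [d] vanishes. *)
Lemma tot_pd_fev Q : tot_pd R (fev Q) <-> qpd t m Q.
Proof.
split=> [/tot_pdP[]|H]; last first.
  apply/tot_pdP; split; first exact/tot_psd_fev/qpd_psd.
  case: Q H => [[a b] c] /andP[/qposP[a1 _] /qposP[d1 _]] x y /= E.
  have [s Es] := qo_emb1 HK.
  have F e : s (ev e) = ev1 e by rewrite rmorph_qev Es.
  move: (F a) (F b) (F c) E; move: (ev a) (ev b) (ev c) => A B C Fa Fb Fc E.
  have := congr1 s E; rewrite !(rmorphD, rmorphM, rmorphXn) Fa Fb Fc rmorph0.
  move: d1; rewrite (qev_disc w1_eq) /= => d1 E1.
  have : 4%:R * ev1 a * (ev1 a * s x ^+ 2 + ev1 b * s x * s y + ev1 c * s y ^+ 2) = 0.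
    by rewrite E1 mulr0.
  have -> : 4%:R * ev1 a * (ev1 a * s x ^+ 2 + ev1 b * s x * s y + ev1 c * s y ^+ 2)
    = (2%:R * ev1 a * s x + ev1 b * s y) ^+ 2 +
      (4%:R * ev1 a * ev1 c - ev1 b ^+ 2) * s y ^+ 2 by ring.
  move/eqP; rewrite paddr_eq0 ?sqr_ge0 ?(mulr_ge0 (ltW d1) (sqr_ge0 _)) //.
  case/andP; rewrite sqrf_eq0 => /eqP E2.
  rewrite mulf_eq0 (gt_eqF d1) sqrf_eq0 /= => /eqP E3.
  move: E2; rewrite E3 mulr0 addr0 => /eqP; rewrite !mulf_eq0 (gt_eqF a1) pnatr_eq0 /=.
  by move: E3 => /eqP; rewrite !fmorph_eq0 => /eqP-> /eqP->.
move=> /tot_psd_fev; case: Q => [[a b] c] /and3P[Ha Hc Hd] H; apply/andP.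
have an0 : a != (Z0, Z0).
  apply/eqP => a0; have := H 1 0; rewrite /= a0 /qev /= zr0.
  rewrite !(mulr0, mul0r, addr0, expr0n) /= => /(_ erefl) [/eqP].
  by rewrite oner_eq0.
split; rewrite qpos_nonneg ?Ha ?Hd //.
apply/eqP => d0; have := H (ev b) (- 2%:R * ev a).
have -> : form_val (fev (a, b, c)) (ev b) (- 2%:R * ev a) = ev a * ev (qdisc t m (a, b, c)).
  by rewrite (qev_disc wE) /=; ring.
rewrite d0 (qev_int w Z0) zr0 mulr0 => /(_ erefl) [_] /eqP.
rewrite mulf_eq0 oppr_eq0 (negPf (two_neq0 K)) /= => /eqP /qev_eq0 /eqP.
by rewrite (negPf an0).
Qed.

Lemma form_ev_minus Q H : fev (qform_minus Q H) = fev Q - fev H.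
Proof. by case: Q => [[a b] c]; case: H => [[a' b'] c'] /=; rewrite !qevB. Qed.

Lemma fev_eq0 Q : fev Q = 0 -> Q = qform0.
Proof. by case: Q => [[a b] c] [] /qev_eq0-> /qev_eq0-> /qev_eq0->. Qed.

Lemma fev0 : fev qform0 = 0.
Proof. by rewrite /qform0 /= !(qev_int w Z0). Qed.

Lemma integral_fev Q : integral_form (fev Q).
Proof. by case: Q => [[a b] c]; split; apply: (ringint_qev HK). Qed.

Lemma sense_fev cl Q : sense cl (fev Q) <-> qsense cl Q.
Proof.
rewrite /sense /qsense; case: cl => /=; last by split=> // _; apply: integral_fev.
split=> [/classical_formP[_]|Qe].
  case: Q => [[a [b1 b2]] c] /= /(qo_int HK)[[f1 f2] E].
  have : ev (b1, b2) = ev (2 * f1, 2 * f2)%coqZ.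
    rewrite -/(qscale 2%coqZ (f1, f2)) qev_scale -E zr2 mulrC divfK //.
    exact: two_neq0.
  by move=> /(qev_inj HK) [-> ->]; case: (f1); case: (f2).
apply/classical_formP; split; first exact: integral_fev.
case: Q Qe => [[a [b1 b2]] c] /= /andP[/Z.even_spec[f1 E1] /Z.even_spec[f2 E2]].
rewrite /= in E1 E2; rewrite E1 E2.
rewrite -/(qscale 2%coqZ (f1, f2)) qev_scale zr2 mulrC mulKf ?two_neq0 //.
exact: (ringint_qev HK).
Qed.

Lemma sense_integral cl (Q' : bform K) : @sense K cl Q' -> integral_form Q'.
Proof. by case: cl => //= -[]. Qed.

Lemma integral_fev_ex (Q' : bform K) : @integral_form K Q' -> exists Q, Q' = fev Q.
Proof.
case: Q' => [[a b] c] [] /(qo_int HK)[a' ->] /(qo_int HK)[b' ->] /(qo_int HK)[c' ->].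
by exists (a', b', c').
Qed.

Lemma decomposable_fev cl Q : qsense cl Q ->
  decomposable_in R (sense cl) (fev Q) <-> exists Q1, qsplits t m cl Q Q1.
Proof.
move=> Qs; split.
  move=> [Q1 [Q2 [E [n1 n2] [s1 s2] [p1 p2]]]].
  have [q1 E1] := integral_fev_ex (sense_integral s1).
  exists q1; have E2 : Q2 = fev (qform_minus Q q1).
    by rewrite form_ev_minus -E1 E [Q1 + Q2]addrC addrK.
  rewrite E1 in n1 s1 p1; rewrite E2 in n2 p2.
  apply/and5P; split.
  - exact/sense_fev.
  - by apply/eqP => q0; apply: n1; rewrite q0 fev0.
  - apply/eqP => q0; apply: n2; rewrite q0 form_ev_minus; exact: subrr.
  - exact/tot_psd_fev.
  - exact/tot_psd_fev.
move=> [Q1 /and5P[s1 /eqP n1 /eqP n2 p1 p2]].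
exists (fev Q1), (fev (qform_minus Q Q1)); split.
- by rewrite form_ev_minus addrC subrK.
- split; first by move=> /fev_eq0.
  by rewrite form_ev_minus => /subr0_eq /(form_ev_inj HK) /esym.
- split; apply/sense_fev => //; move: Qs s1; rewrite /qsense /qeven.
  case: cl => //= /andP[e1 e2] /andP[f1 f2].
  by rewrite !Z.even_sub e1 e2 f1 f2.
- by split; apply/tot_psd_fev.
Qed.

Definition qindecomposable cl Q : Prop :=
  [/\ qsense cl Q, qpd t m Q & forall Q1, ~~ qsplits t m cl Q Q1].

Lemma indecomposable_fev cl Q :
  indecomposable_in R cl (fev Q) <-> qindecomposable cl Q.
Proof.
split=> [[/sense_fev Qs /tot_pd_fev Qp Qd]|[Qs Qp Qd]].
  split=> // Q1; apply/negP => H; apply: Qd; apply/decomposable_fev => //.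
  by exists Q1.
split; [exact/sense_fev|exact/tot_pd_fev|].
by move=> /(decomposable_fev Qs) [Q1]; apply/negP.
Qed.

(** The difference of [Q] and [al (y X - x Y) ^ 2] has discriminant
    [d - 4 al Q(x, y)].  The middle coefficient of the rank one form is even, so
    that it serves for either sense. *)
Lemma rank_one_split cl Q al x y : qindecomposable cl Q ->
  qpos t m al -> (x != (Z0, Z0)) || (y != (Z0, Z0)) ->
  ~~ qle t m (qscale 4 (qmul t m al (qval t m Q x y))) (qdisc t m Q).
Proof.
move=> [Qs Qp Qd] alp xy0; apply/negP => H.
pose Q1 : qform := (qmul t m al (qsq t m y), qscale (-2)%coqZ (qmul t m al (qmul t m x y)),
                    qmul t m al (qsq t m x)).
have alp' : ev al != 0.
  by apply/eqP => /qev_eq0 E; rewrite E qpos0 in alp.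
have e2 (A : comNzRingType) : zr A (-2)%coqZ = - 2%:R by [].
have F1 : fev Q1 = (ev al * ev y ^+ 2, - 2%:R * (ev al * (ev x * ev y)), ev al * ev x ^+ 2).
  by rewrite /form_ev /Q1 !(qevM wE, qev_scale, qev_sq wE) e2.
have D1 : qdisc t m Q1 = (Z0, Z0).
  by apply: qev_eq0; rewrite (qev_disc wE) F1 /=; ring.
have D2 : ev (qdisc t m (qform_minus Q Q1)) =
    ev (qsub (qdisc t m Q) (qscale 4 (qmul t m al (qval t m Q x y)))).
  rewrite qevB qev_scale (qevM wE) (qev_val wE) !(qev_disc wE) form_ev_minus F1 zr4.
  by case: Q {Qs Qp Qd H} => [[a b] c] /=; ring.
have Q1p : qpsd t m Q1.
  move/qposP: alp => [al1 al2].
  rewrite /qpsd D1; apply/and3P; split; apply/qnonnegP; last by rewrite !(qev_int _ Z0) zr0.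
    rewrite !(qevM w1_eq, qevM w2_eq) -!expr2.
    by split; apply: mulr_ge0; rewrite ?sqr_ge0 // ltW.
  rewrite !(qevM w1_eq, qevM w2_eq) -!expr2.
  by split; apply: mulr_ge0; rewrite ?sqr_ge0 // ltW.
suff: qsplits t m cl Q Q1 by rewrite (negPf (Qd Q1)).
apply/and5P; split=> //.
- by rewrite /qsense; case: (cl); first exact: qeven_scale.
- apply/eqP => E; move: (congr1 (fun P : qform => ev P.2) E).
  move: (congr1 (fun P : qform => ev P.1.1) E).
  rewrite /= !(qevM wE, qev_sq wE) (qev_int w Z0) zr0 => /eqP + /eqP.
  rewrite !mulf_eq0 (negPf alp') /= !orbb => /eqP/qev_eq0 y0 /eqP/qev_eq0 x0.
  by move: xy0; rewrite x0 y0.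
- by apply/eqP => E; move: Qp; rewrite -E /qpd D1 qpos0 andbF.
move/qposP: alp => [al1 al2]; move: Qp H => /[dup] /qpd_psd /and3P[_ /qnonnegP[c1 c2] _].
case: Q {Qs Qd} @Q1 F1 D1 D2 Q1p c1 c2 => [[a b] c] Q1 F1 D1 D2 Q1p c1 c2.
move=> /andP[/qposP[a1 a2] /qposP[d1 d2]] /qnonnegP.
rewrite (qevB w1 (qdisc t m (a, b, c))) (qevB w2 (qdisc t m (a, b, c))).
rewrite !qev_scale !(qevM w1_eq, qevM w2_eq) !(qev_val w1_eq, qev_val w2_eq) !subr_ge0.
move: d1 d2.
rewrite !(qev_disc w1_eq, qev_disc w2_eq) !zr4 => d1 d2 [H1 H2].
apply/and3P; split; last first.
- apply/qnonnegP; rewrite (qev_inj HK D2).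
  rewrite (qevB w1 (qdisc t m (a, b, c))) (qevB w2 (qdisc t m (a, b, c))).
  rewrite !qev_scale !(qevM w1_eq, qevM w2_eq).
  by rewrite !(qev_val w1_eq, qev_val w2_eq) !(qev_disc w1_eq, qev_disc w2_eq) !zr4 !subr_ge0.
- apply/qnonnegP; rewrite /= !qevB !(qev_sq w1_eq, qev_sq w2_eq, qevM w1_eq, qevM w2_eq).
  rewrite /= in c1 c2 d1 d2 a1 a2 H1 H2.
  rewrite !subr_ge0; split.
    apply: (@rank_one_le R _ (ev1 b) (ev1 a) _ (ev1 y)) => //; last by move: H1; lra.
      by have := sqr_ge0 (ev1 b); nra.
    by move: d1; lra.
  apply: (@rank_one_le R _ (ev2 b) (ev2 a) _ (ev2 y)) => //; last by move: H2; lra.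
    by have := sqr_ge0 (ev2 b); nra.
  by move: d2; lra.
- apply/qnonnegP; rewrite /= !qevB !(qev_sq w1_eq, qev_sq w2_eq, qevM w1_eq, qevM w2_eq).
  rewrite /= in c1 c2 d1 d2 a1 a2 H1 H2.
  rewrite !subr_ge0; split.
    by apply: (@rank_one_le R _ (ev1 b) (ev1 c) _ (ev1 x)) => //; move: H1; lra.
  by apply: (@rank_one_le R _ (ev2 b) (ev2 c) _ (ev2 x)) => //; move: H2; lra.
Qed.

End Positivity.

(** * A bound for forms with a minimal first coefficient *)
Section CoverCheck.
Variables t m : Z.
Variables (S W1 W2 : Z).
Variable V : seq qmat.
Variable M : Z.
Local Open Scope Z_scope.

(** [S] times the absolute value of [e] at the place where [w] is within [1 / S]
    of [W / S] is at most this. *)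
Definition abs_bound (W : Z) (e : qint) : Z := Z.abs (e.1 * S + e.2 * W) + Z.abs e.2.

(** The box of the [u + v w] with [u0 <= M u <= u1] and [v0 <= M v <= v1] carries
    the affine function [x + y beta]; its absolute value is greatest at a corner. *)
Definition corner_bound (x y : qint) (u0 u1 v0 v1 W : Z) : Z :=
  let b u v := abs_bound W (qadd (qscale M x) (qmul t m y (u, v))) in
  Z.max (Z.max (b u0 v0) (b u0 v1)) (Z.max (b u1 v0) (b u1 v1)).

(** The product over the two places of [(x + y beta) ^ 2 + tau y ^ 2] is less than
    [1] for all [beta] in the box, if [tau] is at most [n1 / d1] at the first place
    and at most [n2 / d2] at the second one. *)
Definition leaf (n1 d1 n2 d2 : Z) (u0 u1 v0 v1 : Z) (N : qmat) : bool :=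
  let: (x, y, _, _) := N in
  let c1 := corner_bound x y u0 u1 v0 v1 W1 in
  let c2 := corner_bound x y u0 u1 v0 v1 W2 in
  let y1 := abs_bound W1 y in
  let y2 := abs_bound W2 y in
  let s := S * M in
  (d1 * (c1 * c1) + n1 * ((M * y1) * (M * y1))) *
  (d2 * (c2 * c2) + n2 * ((M * y2) * (M * y2))) <?
  (d1 * (s * s)) * (d2 * (s * s)).

(** Boxes are kept shorter in the direction of [w], in which the two conjugates move
    apart. *)
Fixpoint cover (depth : nat) (n1 d1 n2 d2 : Z) (u0 u1 v0 v1 : Z) : bool :=
  if has (leaf n1 d1 n2 d2 u0 u1 v0 v1) V then true else
  match depth with
  | O => false
  | depth.+1 =>
      if 2 * (v1 - v0) <? u1 - u0 then
        let u := (u0 + u1) / 2 in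
        cover depth n1 d1 n2 d2 u0 u v0 v1 && cover depth n1 d1 n2 d2 u u1 v0 v1
      else
        let v := (v0 + v1) / 2 in
        cover depth n1 d1 n2 d2 u0 u1 v0 v && cover depth n1 d1 n2 d2 u0 u1 v v1
  end.

Variables (Bn Bd Sr : Z) (depth : nat).

(** In the slab where [Sr * sqrt (tau1 / tau2)] is between [r] and [r'], the bound
    [tau1 tau2 <= (Bd / Bn) ^ 2] gives [tau1 <= r' Bd / (Sr Bn)] and
    [tau2 <= Sr Bd / (r Bn)]. *)
Fixpoint slabs (r : Z) (l : seq Z) : bool :=
  if l is r' :: l' then
    [&& 0 <? r, 0 <? r',
        cover depth (r' * Bd) (Sr * Bn) (Bd * Sr) (Bn * r) (- (M / 2)) (M / 2) 0 (M / 2)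
      & slabs r' l']
  else true.

End CoverCheck.

Section RealLemmas.
Variable R : realType.

Lemma zr_gt0 z : (0 <? z)%coqZ -> 0 < zr R z.
Proof. by rewrite -(zr0 R) zr_lt. Qed.

Lemma zr_abs z : zr R (Z.abs z) = `|zr R z|.
Proof.
case: (Z.abs_spec z) => -[h ->].
  by rewrite ger0_norm // -(zr0 R) zr_le; lia.
by rewrite ler0_norm ?zrN // -(zr0 R) zr_le; lia.
Qed.

Lemma zr_max x y : zr R x <= zr R (Z.max x y) /\ zr R y <= zr R (Z.max x y).
Proof. by rewrite !zr_le; lia. Qed.

Lemma affine_segment (p q u u0 u1 b : R) : u0 <= u <= u1 ->
  `|p + q * u0| <= b -> `|p + q * u1| <= b -> `|p + q * u| <= b.
Proof.
move=> /andP[h0 h1]; rewrite !ler_norml => /andP[a0 a1] /andP[b0 b1].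
by case: (lerP 0 q) => q0; apply/andP; split; nra.
Qed.

Lemma affine_box (p q r u u0 u1 v v0 v1 b : R) :
  u0 <= u <= u1 -> v0 <= v <= v1 ->
  `|p + q * u0 + r * v0| <= b -> `|p + q * u0 + r * v1| <= b ->
  `|p + q * u1 + r * v0| <= b -> `|p + q * u1 + r * v1| <= b ->
  `|p + q * u + r * v| <= b.
Proof.
move=> hu hv b00 b01 b10 b11; apply: affine_segment hv _ _.
  rewrite addrAC; apply: affine_segment hu _ _; rewrite addrAC //.
rewrite addrAC; apply: affine_segment hu _ _; rewrite addrAC //.
Qed.

Lemma ltb_mul a b : (0 <? a)%coqZ -> (0 <? b)%coqZ -> (0 <? a * b)%coqZ.
Proof. by move=> *; nia. Qed.

Lemma le_of_sqr (a b : R) : 0 <= b -> a ^+ 2 <= b ^+ 2 -> a <= b.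
Proof. by move=> b0 ab; rewrite leNgt; apply/negP => ba; nra. Qed.

End RealLemmas.

Section CoverSound.
Variables (R : realType) (t m : Z) (w1 w2 : R).
Hypothesis w1_eq : w1 ^+ 2 = zr R t * w1 + zr R m.
Hypothesis w2_eq : w2 ^+ 2 = zr R t * w2 + zr R m.
Variables (S W1 W2 : Z) (V : seq qmat) (M : Z).
Hypothesis S_gt0 : (0 <? S)%coqZ.
Hypothesis M_gt0 : (0 <? M)%coqZ.
Hypothesis W1_approx : `|zr R S * w1 - zr R W1| <= 1.
Hypothesis W2_approx : `|zr R S * w2 - zr R W2| <= 1.

Lemma abs_boundP (w : R) W e : `|zr R S * w - zr R W| <= 1 ->
  zr R S * `|qev w e| <= zr R (abs_bound S W e).
Proof.
move=> H; rewrite /abs_bound zrD !zr_abs zrD !zrM.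
have S0 : 0 <= zr R S by apply/ltW/zr_gt0.
rewrite -{1}(ger0_norm S0) -normrM.
have -> : zr R S * qev w e =
  (zr R e.1 * zr R S + zr R e.2 * zr R W) + zr R e.2 * (zr R S * w - zr R W).
  by rewrite /qev; ring.
apply: le_trans (ler_normD _ _) _; rewrite lerD2l normrM.
by rewrite -[leRHS]mulr1 ler_wpM2l.
Qed.

Lemma corner_boundP (w : R) W x y u0 u1 v0 v1 (bx by_ : R) :
  w ^+ 2 = zr R t * w + zr R m -> `|zr R S * w - zr R W| <= 1 ->
  zr R u0 <= zr R M * bx <= zr R u1 -> zr R v0 <= zr R M * by_ <= zr R v1 ->
  zr R (S * M)%coqZ * `|qev w x + qev w y * (bx + by_ * w)| <=
  zr R (corner_bound t m S M x y u0 u1 v0 v1 W).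
Proof.
move=> w_eq Hw hu hv; rewrite zrM -mulrA.
have M0 : 0 <= zr R M by apply/ltW/zr_gt0.
have S0 : 0 < zr R S by apply/zr_gt0.
rewrite -{1}(ger0_norm M0) -normrM mulrC -ler_pdivlMr //.
have -> : zr R M * (qev w x + qev w y * (bx + by_ * w)) =
  zr R M * qev w x + qev w y * (zr R M * bx) + (qev w y * w) * (zr R M * by_).
  by ring.
have E u v b : (zr R (abs_bound S W (qadd (qscale M x) (qmul t m y (u, v)))) <= b) ->
  `|zr R M * qev w x + qev w y * zr R u + (qev w y * w) * zr R v| <= b / zr R S.
  move=> H; rewrite ler_pdivlMr // mulrC; apply: le_trans H.
  have := abs_boundP (qadd (qscale M x) (qmul t m y (u, v))) Hw.
  rewrite qevD qev_scale (qevM w_eq) {4}/qev /=.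
  by have -> // : forall a b c d, a + b * (c + d * w) = a + b * c + b * w * d by move=> *; ring.
rewrite /corner_bound.
set c00 := abs_bound _ _ _; set c01 := abs_bound _ _ _.
set c10 := abs_bound _ _ _; set c11 := abs_bound _ _ _.
have [h1 h2] := zr_max R (Z.max c00 c01) (Z.max c10 c11).
have [h3 h4] := zr_max R c00 c01; have [h5 h6] := zr_max R c10 c11.
apply: affine_box hu hv _ _ _ _; apply: E.
- exact: le_trans h3 h1.
- exact: le_trans h4 h1.
- exact: le_trans h5 h2.
- exact: le_trans h6 h2.
Qed.

Lemma leaf_half (S' M' d n c y' T z y : R) :
  0 <= S' -> 0 <= M' -> 0 < d -> 0 <= T -> d * T <= n ->
  S' * M' * `|z| <= c -> S' * `|y| <= y' ->
  d * ((S' * M') * (S' * M')) * (z ^+ 2 + T * y ^+ 2) <=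
  d * (c * c) + n * ((M' * y') * (M' * y')).
Proof.
move=> S0 M0 d0 T0 Tn Hz Hy.
have A : (S' * M') ^+ 2 * z ^+ 2 <= c * c.
  rewrite -[z ^+ 2]real_normK ?num_real // -exprMn expr2.
  by apply: ler_pM => //; rewrite !mulr_ge0.
have B : S' ^+ 2 * y ^+ 2 <= y' * y'.
  rewrite -[y ^+ 2]real_normK ?num_real // -exprMn expr2.
  by apply: ler_pM => //; rewrite !mulr_ge0.
have -> : d * ((S' * M') * (S' * M')) * (z ^+ 2 + T * y ^+ 2) =
  d * ((S' * M') ^+ 2 * z ^+ 2) + (d * T) * M' ^+ 2 * (S' ^+ 2 * y ^+ 2) by ring.
apply: lerD; first by rewrite ler_pM2l.
have -> : n * ((M' * y') * (M' * y')) = n * M' ^+ 2 * (y' * y') by ring.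
apply: ler_pM => //.
- by rewrite !mulr_ge0 // ?(ltW d0) // sqr_ge0.
- by rewrite mulr_ge0 // sqr_ge0.
- by rewrite ler_wpM2r // sqr_ge0.
Qed.

Definition short_vector (bx by_ T1 T2 : R) (N : qmat) : Prop :=
  let: (x, y, _, _) := N in
  ((qev w1 x + qev w1 y * (bx + by_ * w1)) ^+ 2 + T1 * qev w1 y ^+ 2) *
  ((qev w2 x + qev w2 y * (bx + by_ * w2)) ^+ 2 + T2 * qev w2 y ^+ 2) < 1.

Lemma leafP n1 d1 n2 d2 u0 u1 v0 v1 N (bx by_ T1 T2 : R) :
  (0 <? d1)%coqZ -> (0 <? d2)%coqZ -> 0 <= T1 -> 0 <= T2 ->
  zr R d1 * T1 <= zr R n1 -> zr R d2 * T2 <= zr R n2 ->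
  zr R u0 <= zr R M * bx <= zr R u1 -> zr R v0 <= zr R M * by_ <= zr R v1 ->
  leaf t m S W1 W2 M n1 d1 n2 d2 u0 u1 v0 v1 N ->
  short_vector bx by_ T1 T2 N.
Proof.
move=> d10 d20 T10 T20 Tn1 Tn2 hu hv; case: N => [[[x y] r] s] /=.
move: (abs_boundP y W1_approx) (abs_boundP y W2_approx).
have := corner_boundP x y w1_eq W1_approx hu hv.
have := corner_boundP x y w2_eq W2_approx hu hv.
move: (abs_bound S W1 y) (abs_bound S W2 y).
move: (corner_bound _ _ _ _ _ _ _ _ _ _ _) (corner_bound _ _ _ _ _ _ _ _ _ _ _).
move=> k2 k1 Y1 Y2; rewrite zrM => c2 c1 HY1 HY2.
rewrite -(zr_lt R) !(zrM, zrD).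
have M0 : 0 < zr R M by apply/zr_gt0.
have S0 : 0 < zr R S by apply/zr_gt0.
have d10' : 0 < zr R d1 by apply/zr_gt0.
have d20' : 0 < zr R d2 by apply/zr_gt0.
have := leaf_half (ltW S0) (ltW M0) d10' T10 Tn1 c1 HY1.
have := leaf_half (ltW S0) (ltW M0) d20' T20 Tn2 c2 HY2.
move: (qev w1 x + _) (qev w2 x + _) => z1 z2.
set A1 := z1 ^+ 2 + _; set A2 := z2 ^+ 2 + _.
set b1 := (X in _ <= X -> _) => h2; set b2 := (X in _ <= X -> _) => h1 h.
have A10 : 0 <= A1 by rewrite addr_ge0 ?sqr_ge0 // mulr_ge0 // sqr_ge0.
have A20 : 0 <= A2 by rewrite addr_ge0 ?sqr_ge0 // mulr_ge0 // sqr_ge0.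
have P1 : 0 < zr R d1 * (zr R S * zr R M * (zr R S * zr R M)) by rewrite !mulr_gt0.
have P2 : 0 < zr R d2 * (zr R S * zr R M * (zr R S * zr R M)) by rewrite !mulr_gt0.
rewrite -(ltr_pM2l P1) -(ltr_pM2r P2) mulr1.
apply: le_lt_trans h.
set a := zr R d1 * _ in P1 h1 *; set b := zr R d2 * _ in P2 h2 *.
have -> : a * (A1 * A2) * b = (a * A1) * (b * A2) by ring.
apply: ler_pM; [by rewrite mulr_ge0 // ltW|by rewrite mulr_ge0 // ltW|exact: h1|exact: h2].
Qed.

Lemma coverP depth n1 d1 n2 d2 u0 u1 v0 v1 (bx by_ T1 T2 : R) :
  (0 <? d1)%coqZ -> (0 <? d2)%coqZ -> 0 <= T1 -> 0 <= T2 ->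
  zr R d1 * T1 <= zr R n1 -> zr R d2 * T2 <= zr R n2 ->
  zr R u0 <= zr R M * bx <= zr R u1 -> zr R v0 <= zr R M * by_ <= zr R v1 ->
  cover t m S W1 W2 V M depth n1 d1 n2 d2 u0 u1 v0 v1 ->
  exists2 N, N \in V & short_vector bx by_ T1 T2 N.
Proof.
move=> d10 d20 T10 T20 Tn1 Tn2.
have L u0' u1' v0' v1' : zr R u0' <= zr R M * bx <= zr R u1' ->
    zr R v0' <= zr R M * by_ <= zr R v1' ->
    has (leaf t m S W1 W2 M n1 d1 n2 d2 u0' u1' v0' v1') V ->
    exists2 N, N \in V & short_vector bx by_ T1 T2 N.
  move=> hu hv /hasP[N NV NL]; exists N => //.
  exact: (leafP d10 d20 T10 T20 Tn1 Tn2 hu hv NL).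
elim: depth u0 u1 v0 v1 => [|depth IH] u0 u1 v0 v1 hu hv /=.
  by case: ifP => // /(L _ _ _ _ hu hv).
case: ifP => [/(L _ _ _ _ hu hv) //|_].
case: ifP => _ /andP[H0 H1].
  move: H0 H1; set u := ((u0 + u1) / 2)%coqZ => H0 H1.
  case: (lerP (zr R M * bx) (zr R u)) => h.
    by apply: IH H0 => //; case/andP: hu => -> _.
  by apply: IH H1 => //; case/andP: hu => _ ->; rewrite ltW.
move: H0 H1; set v := ((v0 + v1) / 2)%coqZ => H0 H1.
case: (lerP (zr R M * by_) (zr R v)) => h.
  by apply: IH H0 => //; case/andP: hv => -> _.
by apply: IH H1 => //; case/andP: hv => _ ->; rewrite ltW.
Qed.

Variables (Bn Bd Sr : Z) (depth : nat).
Hypothesis Bn_gt0 : (0 <? Bn)%coqZ.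
Hypothesis Bd_gt0 : (0 <? Bd)%coqZ.
Hypothesis Sr_gt0 : (0 <? Sr)%coqZ.

Lemma slabsP r l (bx by_ T1 T2 : R) :
  -1 <= 2%:R * bx <= 1 -> 0 <= 2%:R * by_ <= 1 -> zr R M = 2%:R * zr R (M / 2)%coqZ -> 0 < T1 -> 0 < T2 ->
  zr R Bn ^+ 2 * (T1 * T2) <= zr R Bd ^+ 2 ->
  zr R r ^+ 2 * T2 <= zr R Sr ^+ 2 * T1 ->
  zr R Sr ^+ 2 * T1 <= zr R (last r l) ^+ 2 * T2 -> l != [::] ->
  slabs t m S W1 W2 V M Bn Bd Sr depth r l ->
  exists2 N, N \in V & short_vector bx by_ T1 T2 N.
Proof.
move=> hx hy HM T10 T20 HB; elim: l r => [//|r' l IH] r Hr Hl _ /= /and4P[r0 r1 Hc Hs].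
have M0 : 0 < zr R M by apply/zr_gt0.
have Bn0 : 0 < zr R Bn by apply/zr_gt0.
have Bd0 : 0 < zr R Bd by apply/zr_gt0.
have Sr0 : 0 < zr R Sr by apply/zr_gt0.
have r0' : 0 < zr R r by apply/zr_gt0.
have [Hr'|Hr'] := lerP (zr R Sr ^+ 2 * T1) (zr R r' ^+ 2 * T2); last first.
  case: l IH Hl Hs => [|r'' l] IH Hl Hs; first by move: Hl Hr' => /=; rewrite leNgt => /negP.
  exact: (IH r' (ltW Hr') Hl isT Hs).
have r1' : 0 < zr R r' by apply/zr_gt0.
have H0 : 0 < zr R (M / 2)%coqZ by move: M0; rewrite HM; lra.
apply: (coverP _ _ (ltW T10) (ltW T20) _ _ _ _ Hc).
- exact: ltb_mul.
- exact: ltb_mul.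
- rewrite !zrM; apply: le_of_sqr; first by rewrite mulr_ge0 ?ltW.
  apply: (@le_trans _ _ (zr R Bn ^+ 2 * (T1 * T2) * zr R r' ^+ 2)).
    have -> : (zr R Sr * zr R Bn * T1) ^+ 2 = zr R Bn ^+ 2 * T1 * (zr R Sr ^+ 2 * T1) by ring.
    have -> : zr R Bn ^+ 2 * (T1 * T2) * zr R r' ^+ 2 = zr R Bn ^+ 2 * T1 * (zr R r' ^+ 2 * T2) by ring.
    by rewrite ler_wpM2l // mulr_ge0 ?sqr_ge0 // ltW.
  by rewrite exprMn mulrC; apply: ler_wpM2l; rewrite ?sqr_ge0.
- rewrite !zrM; apply: le_of_sqr; first by rewrite mulr_ge0 ?ltW.
  apply: (@le_trans _ _ (zr R Bn ^+ 2 * (T1 * T2) * zr R Sr ^+ 2)).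
    have -> : (zr R Bn * zr R r * T2) ^+ 2 = zr R Bn ^+ 2 * T2 * (zr R r ^+ 2 * T2) by ring.
    have -> : zr R Bn ^+ 2 * (T1 * T2) * zr R Sr ^+ 2 = zr R Bn ^+ 2 * T2 * (zr R Sr ^+ 2 * T1) by ring.
    by rewrite ler_wpM2l // mulr_ge0 ?sqr_ge0 // ltW.
  by rewrite exprMn; apply: ler_wpM2r; rewrite ?sqr_ge0.
- by rewrite zrN HM; move: hx => /andP[h1 h2]; apply/andP; split; nra.
- by rewrite zr0 HM; move: hy => /andP[h1 h2]; apply/andP; split; nra.
Qed.

End CoverSound.

Lemma ex_minimal (T : Type) (P : T -> Prop) (f : T -> Z) :
  (exists x, P x) -> (forall x, P x -> (0 <= f x)%coqZ) ->
  exists2 x, P x & forall y, P y -> (f x <= f y)%coqZ.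
Proof.
move=> [x0 Px0] f0.
have ex : exists n, `[< exists2 x, P x & Z.to_nat (f x) = n >].
  by exists (Z.to_nat (f x0)); apply/asboolP; exists x0.
case: (ex_minnP ex) => n /asboolP[x Px fx] Hmin; exists x => // y Py.
have /Hmin : `[< exists2 x, P x & Z.to_nat (f x) = Z.to_nat (f y) >].
  by apply/asboolP; exists y.
by have := f0 _ Px; have := f0 _ Py; rewrite -fx; lia.
Qed.

(** The arithmetic of a field and the data of its subdivision.  The unit [fd_eps]
    has a square greater than [1] at the first place; [fd_W / fd_S] approximates
    the first conjugate of [w]; boxes are measured in units of [1 / fd_M]; the
    vectors are the first rows of unimodular matrices; [fd_Bn / fd_Bd] is the
    constant [B]; the slabs are delimited by [fd_r] and the members of [fd_slabs],
    in units of [1 / fd_Sr]. *)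
Record field_data := FieldData {
  fd_t : Z; fd_m : Z; fd_eps : qint;
  fd_S : Z; fd_W : Z; fd_M : Z;
  fd_vectors : seq qmat;
  fd_Bn : Z; fd_Bd : Z;
  fd_Sr : Z; fd_r : Z; fd_slabs : seq Z; fd_depth : nat
}.

Section CoverData.
Variable fd : field_data.
Local Notation t := (fd_t fd).
Local Notation m := (fd_m fd).
Local Notation eps2 := (qsq t m (fd_eps fd)).
Local Notation S := (fd_S fd).
Local Notation W := (fd_W fd).
Local Open Scope Z_scope.

(** The polynomial of [w], made homogeneous, changes sign between [W - 1] and
   [W + 1], and [W - 1] is not to the left of its axis. *)
Definition approx_ok : bool :=
  let f X := X * X - t * S * X - m * S * S in
  [&& 0 <? S, t * S <=? 2 * (W - 1), f (W - 1) <=? 0 & 0 <=? f (W + 1)].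

Definition unit_ok : bool :=
  [&& qunit t m (fd_eps fd), 0 <? qtr t eps2 & 0 <? eps2.2].

(** The slabs have to reach from the ratio [eps ^ -2] of the conjugates of [tau] to
    [eps ^ 2]; here [abs_bound] stands in for the first conjugate of [eps ^ 2]. *)
Definition cover_ok : bool :=
  [&& approx_ok, unit_ok,
      [&& 0 <? fd_M fd, 0 <? fd_Bn fd, 0 <? fd_Bd fd, 0 <? fd_Sr fd,
        Z.even (fd_M fd) & fd_slabs fd != [::]],
      [&& 0 <? fd_r fd,
        fd_r fd * fd_r fd * abs_bound S W eps2 <=? S * (fd_Sr fd * fd_Sr fd) &
        fd_Sr fd * fd_Sr fd * abs_bound S W eps2 <=?
          S * (last (fd_r fd) (fd_slabs fd) * last (fd_r fd) (fd_slabs fd))],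
      all (fun N => qunit t m (qdet t m N)) (fd_vectors fd) &
      slabs t m S W (t * S - W) (fd_vectors fd) (fd_M fd)
        (fd_Bn fd) (fd_Bd fd) (fd_Sr fd) (fd_depth fd) (fd_r fd) (fd_slabs fd)].

End CoverData.

Section MinimalForms.
Variables (R : realType) (K : fieldExtType rat) (fd : field_data) (w : K) (w1 w2 : R).
Local Notation t := (fd_t fd).
Local Notation m := (fd_m fd).
Local Notation eps := (fd_eps fd).
Hypothesis HK : quadratic_order t m w w1 w2.
Implicit Types (e f : qint) (Q H : qform).
Local Notation ev := (qev w).
Local Notation fev := (form_ev w).
Local Notation ev1 := (qev w1).
Local Notation ev2 := (qev w2).
Local Notation qnorm := (qnorm t m).
Local Notation qmul := (qmul t m).
Local Notation qsq := (qsq t m).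
Local Notation qtr := (qtr t).
Local Notation w1E := (w1_eq HK).
Local Notation w2E := (w2_eq HK).

Definition norm_minimal H : Prop :=
  forall H', bf_equiv (fev H) (fev H') -> (qnorm H.1.1 <= qnorm H'.1.1)%coqZ.

Lemma approxP : approx_ok fd -> `|zr R (fd_S fd) * w1 - zr R (fd_W fd)| <= 1.
Proof.
move=> /and4P[]; rewrite -!(zr_le R) -(zr_lt R) !(zrB, zrM, zrD, zrN, zr0, zr1, zr2).
rewrite -(qo_sum HK) -[zr R m]opprK -(qo_prod HK).
have := qo_lt HK; move: (zr R (fd_S fd)) (zr R (fd_W fd)) => s x lt12 s0 h1 h2 h3.
have lt' : s * w2 < s * w1 by rewrite ltr_pM2l.
have h2' : (x - 1 - s * w1) * (x - 1 - s * w2) <= 0.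
  apply: le_trans h2; rewrite le_eqVlt; apply/orP; left; apply/eqP; ring.
have h3' : 0 <= (x + 1 - s * w1) * (x + 1 - s * w2).
  apply: (le_trans h3); rewrite le_eqVlt; apply/orP; left; apply/eqP; ring.
have h1' : s * w1 + s * w2 <= 2%:R * (x - 1).
  by apply: le_trans h1; rewrite le_eqVlt; apply/orP; left; apply/eqP; ring.
clear -lt' h2' h3' h1'; move: (s * w1) (s * w2) lt' h2' h3' h1' => a b ab h2 h3 h1.
rewrite ler_norml; apply/andP; split.
  rewrite leNgt; apply/negP => h; have : 0 < (x - 1 - a) * (x - 1 - b) by apply: mulr_gt0; lra.
  lra.
rewrite leNgt; apply/negP => h; have : 0 < (a - x - 1) * (x + 1 - b) by apply: mulr_gt0; lra.
lra.
Qed.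

Lemma approx2P : approx_ok fd ->
  `|zr R (fd_S fd) * w2 - zr R (t * fd_S fd - fd_W fd)%coqZ| <= 1.
Proof.
move/approxP; rewrite -normrN zrB zrM -(qo_sum HK).
by have -> : - (zr R (fd_S fd) * w1 - zr R (fd_W fd)) =
  zr R (fd_S fd) * w2 - ((w1 + w2) * zr R (fd_S fd) - zr R (fd_W fd)) by ring.
Qed.

Lemma unit_sq : unit_ok fd -> 1 < ev1 (qsq eps) /\ ev1 (qsq eps) * ev2 (qsq eps) = 1.
Proof.
move=> /and3P[Hu Ht H2].
have P1 : ev1 (qsq eps) * ev2 (qsq eps) = 1.
  rewrite -(ev_norm HK) -[RHS](zr1 R); congr (zr R _).
  by rewrite qnorm_mul; move: Hu; rewrite /qunit; move: (qnorm eps) => n ?; nia.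
split=> //.
have lt21 : ev2 (qsq eps) < ev1 (qsq eps).
  by rewrite /qev ltrD2l ltr_pM2l ?(qo_lt HK) // zr_gt0.
have : 0 < zr R (qtr (qsq eps)) by apply: zr_gt0.
rewrite (ev_tr HK); move: (ev1 _) (ev2 _) P1 lt21 => x y; nra.
Qed.

Lemma unit_inv : unit_ok fd -> forall e,
  [/\ ev1 (qmul (qsq eps) e) = ev1 (qsq eps) * ev1 e,
      ev2 (qmul (qsq eps) e) = ev2 e / ev1 (qsq eps),
      ev1 (qmul (qsq (qconj t eps)) e) = ev1 e / ev1 (qsq eps) &
      ev2 (qmul (qsq (qconj t eps)) e) = ev1 (qsq eps) * ev2 e].
Proof.
move=> /unit_sq[E1 E12] e.
have En0 : ev1 (qsq eps) != 0 by rewrite gt_eqF // (lt_trans _ E1).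
have E2 : ev2 (qsq eps) = (ev1 (qsq eps))^-1 by apply: (mulfI En0); rewrite E12 mulfV.
have C1 : ev1 (qsq (qconj t eps)) = ev2 (qsq eps).
  by rewrite (qev_sq w1E) (ev1_conj HK) (qev_sq w2E).
have C2 : ev2 (qsq (qconj t eps)) = ev1 (qsq eps).
  by rewrite (qev_sq w2E) (ev2_conj HK) (qev_sq w1E).
by rewrite !(qevM w1E (qsq _) e) !(qevM w2E (qsq _) e) C1 C2 E2; split=> //; rewrite mulrC.
Qed.

(** Minimality of the trace under squares of units bounds the ratio of the two
    conjugates. *)
Lemma trace_minimal_ratio (T : qint) : unit_ok fd ->
  (qtr T <= qtr (qmul (qsq eps) T))%coqZ ->
  (qtr T <= qtr (qmul (qsq (qconj t eps)) T))%coqZ ->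
  ev2 T <= ev1 (qsq eps) * ev1 T /\ ev1 T <= ev1 (qsq eps) * ev2 T.
Proof.
move=> Hu h1 h2; have [E1 _] := unit_sq Hu.
have [F1 F2 F3 F4] := unit_inv Hu T.
have {h1} : zr R (qtr T) <= zr R (qtr (qmul (qsq eps) T)) by rewrite zr_le; move: h1; lia.
have {h2} : zr R (qtr T) <= zr R (qtr (qmul (qsq (qconj t eps)) T)) by rewrite zr_le; move: h2; lia.
rewrite !(ev_tr HK) F1 F2 F3 F4; move: (ev1 (qsq eps)) (ev1 T) (ev2 T) E1 => E x y E1 h2 h1.
clear -h1 h2 E1.
have E0 : 0 < E by lra.
have K1 : 0 < E - 1 by lra.
split.
  rewrite -(ler_pM2l K1) -subr_ge0; have := h1.
  rewrite -(ler_pM2l E0) [E * (E * x + _)]mulrDr [E * (y / E)]mulrC divfK ?gt_eqF //; lra.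
rewrite -(ler_pM2l K1) -subr_ge0; have := h2.
rewrite -(ler_pM2l E0) [E * (x / E + _)]mulrDr [E * (x / E)]mulrC divfK ?gt_eqF //; lra.
Qed.

(** Rounding both coordinates puts them into the square of side [2 n] around the
    origin, and the sign can be used to make the second one nonnegative. *)
Lemma recentre (n z0 z1 : Z) : (0 < n)%coqZ -> exists s k0 k1,
  [/\ s = 1 \/ s = -1, - n <= 2 * n * k0 + s * z0, 2 * n * k0 + s * z0 <= n,
      0 <= 2 * n * k1 + s * z1 & 2 * n * k1 + s * z1 <= n]%coqZ.
Proof.
move=> n0.
have D z : (exists k, - n <= 2 * n * k + z /\ 2 * n * k + z < n)%coqZ.
  exists (- ((z + n) / (2 * n)))%coqZ.
  have := Z.div_mod (z + n) (2 * n); have := Z.mod_pos_bound (z + n) (2 * n); nia.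
have [k1 [h1 h2]] := D z1.
have [h|h] := Z_le_gt_dec 0 (2 * n * k1 + z1).
  have [k0 [h3 h4]] := D z0; exists 1%coqZ, k0, k1; split; [by left|lia..].
have [k0 [h3 h4]] := D (- z0)%coqZ; exists (-1)%coqZ, k0, (- k1)%coqZ.
by split; [right|lia..].
Qed.

Lemma qnorm_sign s e : (s = 1 \/ s = -1)%coqZ -> qnorm (qscale s e) = qnorm e.
Proof.
case: e => x y s1; have ss : (s * s = 1)%coqZ by case: s1 => ->.
rewrite /qnorm /qscale /=.
by transitivity (s * s * (x * x + t * (x * y) - m * (y * y)))%coqZ; [ring|rewrite ss; ring].
Qed.

Lemma qev_lin (k x y r u v : Z) :
  ev (2 * k * x + r * u, 2 * k * y + r * v)%coqZ =
  2%:R * zr K k * ev (x, y) + zr K r * ev (u, v).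
Proof.
transitivity (zr K (2 * k * x + r * u)%coqZ + zr K (2 * k * y + r * v)%coqZ * w) => //.
by rewrite !zrD !zrM zr2 /qev /=; ring.
Qed.

Lemma shift_norm (al b c x y : R) : al != 0 ->
  al * x ^+ 2 + b * x * y + c * y ^+ 2 =
  al * ((x + y * (b / (2%:R * al))) ^+ 2 +
        (4%:R * al * c - b ^+ 2) / (4%:R * al ^+ 2) * y ^+ 2).
Proof. by move=> h; field. Qed.

(** If the bound fails, the form is brought into the domain of the subdivision by
    scaling the second basis vector with a unit that makes the trace of
    [conj(a) ^ 2 d] minimal, and by shearing.  The vector found there has a value
    of smaller norm, and it extends to an equivalence. *)
Lemma norm_minimal_bound H : cover_ok fd -> qpd t m H -> norm_minimal H ->
  (16 * (fd_Bd fd * fd_Bd fd) * (qnorm H.1.1 * qnorm H.1.1) <=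
   fd_Bn fd * fd_Bn fd * qnorm (qdisc t m H))%coqZ.
Proof.
move=> /and5P[Happ Hunit /and5P[M0 Bn0 Bd0 Sr0 /andP[Mev sl0]]].
move=> /and3P[r0 rE lE] /andP[/allP Vu Hslabs].
case: H => [[a b] c] Hp Hm; set d := qdisc t m _.
have [/(qposP HK)[a1 a2] /(qposP HK)[d1 d2]] := andP Hp.
rewrite -/d in d1 d2; rewrite /= in a1 a2.
have unit_eps : qunit t m eps by case/and3P: Hunit.
pose T e := qmul (qsq (qconj t a)) (qmul (qsq e) d).
have evT e : ev1 (T e) = ev2 a ^+ 2 * (ev1 e ^+ 2 * ev1 d) /\
             ev2 (T e) = ev1 a ^+ 2 * (ev2 e ^+ 2 * ev2 d).
  rewrite /T !(qevM w1E (qsq _)) !(qevM w2E (qsq _)).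
  by rewrite !(qev_sq w1E, qev_sq w2E) (ev1_conj HK) (ev2_conj HK).
(* The conjugates of [T e] are proportional to those of [tau]. *)
have [||e eu emin] := @ex_minimal qint (fun e => qunit t m e) (fun e => qtr (T e)).
- by exists eps.
- move=> e _; have [E1 E2] := evT e.
  suff : zr R 0 <= zr R (qtr (T e)) by rewrite zr_le; lia.
  by rewrite (ev_tr HK) E1 E2 addr_ge0 // mulr_ge0 ?sqr_ge0 // mulr_ge0 ?sqr_ge0 // ltW.
have unitM e' : qunit t m e' -> qunit t m (qmul e' e).
  by move: eu; rewrite /qunit qnorm_mul Z.abs_mul => /Z.eqb_spec-> /Z.eqb_spec->.
have [R1 R2] : ev2 (T e) <= ev1 (qsq eps) * ev1 (T e) /\
               ev1 (T e) <= ev1 (qsq eps) * ev2 (T e).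
  have TM e' : T (qmul e' e) = qmul (qsq e') (T e).
    by apply: (qev_inj HK); rewrite /T !(qevM (qo_eq HK)); ring.
  apply: trace_minimal_ratio => //; rewrite -TM; apply/emin/unitM => //.
  by rewrite /qunit qnorm_conj.
have n0 : (0 <? qnorm a)%coqZ by case/andP: (proj1 (andP Hp)).
(* The coordinates of [beta] are those of [z] over twice the norm of [a]. *)
pose z := qmul (qmul b e) (qconj t a).
have /Z.ltb_lt n0' := n0.
have [s [k0 [k1 [s1 z00 z01 z10 z11]]]] := recentre z.1 z.2 n0'.
pose N0 : qmat := ((1, 0), (0, 0), (k0, k1), qscale s e)%coqZ.
pose H2 := qact t m N0 (a, b, c).
have su : qunit t m (qdet t m N0).
  have -> : qdet t m N0 = qscale s e.
    apply: (qev_inj HK); rewrite (qev_det (qo_eq HK)) /= !(qev_int w) zr1 zr0; ring.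
  move: eu; rewrite /qunit => /Z.eqb_spec <-; apply/Z.eqb_spec; congr Z.abs.
  exact: qnorm_sign.
have E2 : bf_equiv (fev (a, b, c)) (fev H2) := bf_equiv_act HK _ su.
have s1' : zr K s ^+ 2 = 1 by rewrite expr2 -zrM; case: s1 => ->.
have H2a : H2.1.1 = a.
  have -> : H2.1.1 = qval t m (a, b, c) (1, 0)%coqZ (0, 0)%coqZ by [].
  by apply: (qev_inj HK); rewrite (qev_val (qo_eq HK)) /= !(qev_int w) zr1 zr0; ring.
have H2d : qdisc t m H2 = qmul (qsq e) d.
  apply: (qev_inj HK); rewrite (qev_disc (qo_eq HK)) (qev_act (qo_eq HK)) form_disc_sub.
  rewrite -!(qev_disc (qo_eq HK)) -/d -(qev_det (qo_eq HK)) (qevM (qo_eq HK)) (qev_sq (qo_eq HK)).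
  congr (_ * _); rewrite (qev_det (qo_eq HK)) /= !(qev_int w) qev_scale zr1 zr0.
  by rewrite mul1r mul0r subr0 exprMn s1' mul1r.
have H2b : qmul H2.1.2 (qconj t a) =
    (2 * qnorm a * k0 + s * z.1, 2 * qnorm a * k1 + s * z.2)%coqZ.
  apply: (qev_inj HK); rewrite (qevM (qo_eq HK)).
  have -> : ev H2.1.2 = 2%:R * ev a * ev (k0, k1) + ev b * (zr K s * ev e).
    have -> : ev H2.1.2 = (fev H2).1.2 by case: (H2) => [[]].
    by rewrite (qev_act (qo_eq HK)) /= !(qev_int w) qev_scale zr1 zr0; ring.
  have -> : ev (2 * qnorm a * k0 + s * z.1, 2 * qnorm a * k1 + s * z.2)%coqZ =
     2%:R * zr K (qnorm a) * ev (k0, k1) + zr K s * ev z.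
    by rewrite qev_lin -surjective_pairing.
  by rewrite (qev_norm (qo_eq HK)) /z !(qevM (qo_eq HK)); ring.
pose n : R := zr R (qnorm a).
have n0R : 0 < n by exact: zr_gt0.
have nE : n = ev1 a * ev2 a by rewrite /n (ev_norm HK).
pose bx := zr R (2 * qnorm a * k0 + s * z.1)%coqZ / (2%:R * n).
pose by_ := zr R (2 * qnorm a * k1 + s * z.2)%coqZ / (2%:R * n).
have bE1 : ev1 H2.1.2 / (2%:R * ev1 a) = bx + by_ * w1.
  have : ev1 (qmul H2.1.2 (qconj t a)) = 2%:R * n * (bx + by_ * w1).
    by rewrite H2b /bx /by_ /qev /=; field; rewrite gt_eqF.
  rewrite (qevM w1E) (ev1_conj HK) nE => E.
  apply: (@mulfI _ (ev2 a * (2%:R * ev1 a))); first by rewrite !mulf_neq0 ?gt_eqF.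
  transitivity (ev1 H2.1.2 * ev2 a); first by field; rewrite gt_eqF.
  by rewrite E; ring.
have bE2 : ev2 H2.1.2 / (2%:R * ev2 a) = bx + by_ * w2.
  have : ev2 (qmul H2.1.2 (qconj t a)) = 2%:R * n * (bx + by_ * w2).
    by rewrite H2b /bx /by_ /qev /=; field; rewrite gt_eqF.
  rewrite (qevM w2E) (ev2_conj HK) nE => E.
  apply: (@mulfI _ (ev1 a * (2%:R * ev2 a))); first by rewrite !mulf_neq0 ?gt_eqF.
  transitivity (ev2 H2.1.2 * ev1 a); first by field; rewrite gt_eqF.
  by rewrite E; ring.
have [T1 T2] := evT e.
have e12 : ev1 e ^+ 2 * ev2 e ^+ 2 = 1.
  rewrite -exprMn -(ev_norm HK) expr2 -zrM -[RHS](zr1 R); congr (zr R _).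
  by move: eu; rewrite /qunit => /Z.eqb_spec; clear; lia.
pose t1 := ev1 e ^+ 2 * ev1 d / (4%:R * ev1 a ^+ 2).
pose t2 := ev2 e ^+ 2 * ev2 d / (4%:R * ev2 a ^+ 2).
have t1E : ev1 (T e) = 4%:R * n ^+ 2 * t1 by rewrite T1 nE /t1; field; rewrite gt_eqF.
have t2E : ev2 (T e) = 4%:R * n ^+ 2 * t2 by rewrite T2 nE /t2; field; rewrite gt_eqF.
have nn0 : 0 < 4%:R * n ^+ 2 by rewrite mulr_gt0 // exprn_gt0.
have [en1 en2] : ev1 e != 0 /\ ev2 e != 0.
  by split; apply/eqP => E; move: e12; rewrite E expr0n ?mulr0 ?mul0r => /esym/eqP; rewrite oner_eq0.
have t10 : 0 < t1.
  apply: divr_gt0; apply: mulr_gt0 => //; last exact: exprn_gt0.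
  by rewrite exprn_even_gt0.
have t20 : 0 < t2.
  apply: divr_gt0; apply: mulr_gt0 => //; last exact: exprn_gt0.
  by rewrite exprn_even_gt0.
have {}R1 : t2 <= ev1 (qsq eps) * t1.
  by rewrite -(ler_pM2l nn0) -t2E mulrCA -t1E.
have {}R2 : t1 <= ev1 (qsq eps) * t2.
  by rewrite -(ler_pM2l nn0) -t1E mulrCA -t2E.
have S0 : (0 <? fd_S fd)%coqZ by case/and4P: Happ.
have t12 : t1 * t2 = zr R (qnorm d) / (16%:R * n ^+ 2).
  rewrite (ev_norm HK) nE.
  transitivity (ev1 e ^+ 2 * ev2 e ^+ 2 * (ev1 d * ev2 d) / (16%:R * (ev1 a * ev2 a) ^+ 2)).
    by rewrite /t1 /t2; field; rewrite !gt_eqF.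
  by rewrite e12 mul1r.
apply/Z.nlt_ge => Hlt.
have {Hlt} HB : zr R (fd_Bn fd) ^+ 2 * (t1 * t2) <= zr R (fd_Bd fd) ^+ 2.
  move/Z.ltb_lt: Hlt; rewrite -(zr_lt R) !zrM => /ltW H.
  rewrite t12 mulrA ler_pdivrMr ?mulr_gt0 ?exprn_gt0 // !expr2.
  by apply: le_trans H _; rewrite le_eqVlt; apply/orP; left; apply/eqP; rewrite -/n; ring.
have HE : zr R (fd_S fd) * ev1 (qsq eps) <= zr R (abs_bound (fd_S fd) (fd_W fd) (qsq eps)).
  apply: (le_trans _ (abs_boundP S0 (qsq eps) (approxP Happ))).
  by rewrite ler_pM2l ?zr_gt0 // ler_norm.
have S0' : 0 < zr R (fd_S fd) by exact: zr_gt0.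
have K2 (k l : Z) : (k * k * abs_bound (fd_S fd) (fd_W fd) (qsq eps) <=?
     fd_S fd * (l * l))%coqZ -> zr R k ^+ 2 * ev1 (qsq eps) <= zr R l ^+ 2.
  rewrite -(zr_le R) !zrM => H; rewrite -(ler_pM2l S0').
  apply: (le_trans _ H); rewrite mulrCA expr2.
  by apply: ler_wpM2l HE; rewrite -expr2 sqr_ge0.
(* The minimality of the trace of [T e] places [t1 / t2] within the slabs. *)
have [N NV] : exists2 N, N \in fd_vectors fd & short_vector w1 w2 bx by_ t1 t2 N.
  apply: (slabsP w1E w2E S0 M0 (approxP Happ) (approx2P Happ) Bn0 Bd0 Sr0 _ _ _ t10 t20 HB _ _ sl0 Hslabs).
  - rewrite /bx mulrA [2%:R * _]mulrC -mulrA -[2%:R / _](_ : n^-1 = _); last by field; rewrite gt_eqF.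
    rewrite ler_pdivlMr // ler_pdivrMr // mulN1r mul1r /n -zrN !zr_le.
    by apply/andP; split; apply/Z.leb_le.
  - rewrite /by_ mulrA [2%:R * _]mulrC -mulrA -[2%:R / _](_ : n^-1 = _); last by field; rewrite gt_eqF.
    rewrite ler_pdivlMr // ler_pdivrMr // mul0r mul1r /n -(zr0 R) !zr_le.
    by apply/andP; split; apply/Z.leb_le.
  - by move/Z.even_spec: Mev => [k ->]; rewrite [(2 * k)%coqZ]Z.mul_comm Z.div_mul // zrM zr2 mulrC.
  - apply: (@le_trans _ _ (zr R (fd_r fd) ^+ 2 * (ev1 (qsq eps) * t1))).
      by rewrite ler_wpM2l ?sqr_ge0.
    by rewrite mulrA ler_wpM2r ?(ltW t10) // K2.
  - apply: (@le_trans _ _ (zr R (fd_Sr fd) ^+ 2 * (ev1 (qsq eps) * t2))).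
      by rewrite ler_wpM2l ?sqr_ge0.
    by rewrite mulrA ler_wpM2r ?(ltW t20) // K2.
case: N NV => [[[x y] r] s'] NV.
rewrite /short_vector -bE1 -bE2 => Hshort.
pose H3 := qact t m (x, y, r, s') H2.
have E3 : bf_equiv (fev H2) (fev H3) := bf_equiv_act HK _ (Vu _ NV).
have := Hm H3 (bf_equiv_trans HK E2 E3); apply/Z.nle_gt/Z.ltb_lt.
rewrite -(zr_lt R) (ev_norm HK).
have -> : H3.1.1 = qval t m H2 x y by rewrite /H3; case: (H2) => [[]].
have F1 : ev1 (qval t m H2 x y) = ev1 a *
  ((ev1 x + ev1 y * (ev1 H2.1.2 / (2%:R * ev1 a))) ^+ 2 + t1 * ev1 y ^+ 2).
  have D1 : ev1 (qdisc t m H2) = ev1 e ^+ 2 * ev1 d by rewrite H2d (qevM w1E) (qev_sq w1E).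
  rewrite (qev_val w1E) /t1 -D1 (qev_disc w1E); case: (H2) H2a => [[a' b'] c'] /= ->.
  by rewrite -shift_norm // gt_eqF.
have F2 : ev2 (qval t m H2 x y) = ev2 a *
  ((ev2 x + ev2 y * (ev2 H2.1.2 / (2%:R * ev2 a))) ^+ 2 + t2 * ev2 y ^+ 2).
  have D2 : ev2 (qdisc t m H2) = ev2 e ^+ 2 * ev2 d by rewrite H2d (qevM w2E) (qev_sq w2E).
  rewrite (qev_val w2E) /t2 -D2 (qev_disc w2E); case: (H2) H2a => [[a' b'] c'] /= ->.
  by rewrite -shift_norm // gt_eqF.
rewrite F1 F2 -/n nE mulrACA -{2}[ev1 a * ev2 a]mulr1 ltr_pM2l //.
exact: mulr_gt0.
Qed.

End MinimalForms.

(** * Normal forms *)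
Fixpoint zrange (lo : Z) (n : nat) : seq Z :=
  if n is n'.+1 then lo :: zrange (lo + 1)%coqZ n' else [::].

Lemma mem_zrange lo n x :
  (lo <= x)%coqZ -> (x < lo + Z.of_nat n)%coqZ -> x \in zrange lo n.
Proof.
elim: n lo => [|n IH] lo h1 h2 /=; first by exfalso; lia.
rewrite inE; case: eqP => //= ne; apply: IH; lia.
Qed.

Lemma mem_zrange_to lo n x :
  (lo <= x)%coqZ -> (x < lo + n)%coqZ -> x \in zrange lo (Z.to_nat n).
Proof. by move=> h1 h2; apply: mem_zrange => //; lia. Qed.

(** Bounds for the enumeration.  The totally positive elements [sd_stair] are
    ordered by their first conjugate; [sd_corner] is an element whose conjugates
    have the ratio [eps ^ 2]; [sd_A] bounds the norm of the first coefficient, and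
    [sd_H] and [sd_h] bound the difference of the conjugates of [d / 4 a]. *)
Record search_data := SearchData {
  sd_stair : seq qint; sd_corner : qint;
  sd_A : Z; sd_H : Z; sd_h : Z
}.

Section Enumeration.
Variables (fd : field_data) (sd : search_data) (cl : bool).
Local Notation t := (fd_t fd).
Local Notation m := (fd_m fd).
Local Notation eps2 := (qsq t m (fd_eps fd)).
Local Notation epsc2 := (qsq t m (qconj t (fd_eps fd))).
Local Notation S := (fd_S fd).
Local Notation W := (fd_W fd).
Local Notation qmul := (qmul t m).
Local Notation qsq := (qsq t m).
Local Notation qnorm := (qnorm t m).
Local Notation qtr := (qtr t).
Local Open Scope Z_scope.

Definition sign (s : bool) : Z := if s then -1 else 1.

Definition qDelta : Z := t * t + 4 * m.

(** The corner between two neighbours takes its first conjugate from the later one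
    and its second conjugate from the earlier one; its coordinates have as product
    a conjugate of [al' conj(al)].  Beyond the last step, and before the first one,
    the product is bounded through the ratio of the two coordinates. *)
Fixpoint stair_corners (al : qint) (l : seq qint) : seq qint :=
  if l is al' :: l' then qmul al' (qconj t al) :: stair_corners al' l'
  else [:: qmul eps2 (qsq (qconj t al))].

Definition search_ok : bool :=
  [&& 0 <=? t, 0 <? qDelta, all (qpos t m) (sd_stair sd),
      (1, 0) \in sd_stair sd,
      (if sd_stair sd is al :: l then
         all (fun e => fd_Bn fd * fd_Bn fd * abs_bound S W e <=?
                       fd_Bd fd * fd_Bd fd * (S * sd_A sd))
             (qmul eps2 (qsq al) :: stair_corners al l)
       else false) &
      [&& qpos t m (sd_corner sd), qmul eps2 (qconj t (sd_corner sd)) == sd_corner sd,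
          0 <? sd_h sd,
          abs_bound S W (sd_corner sd) * abs_bound S W (sd_corner sd) <=? S * S * sd_H sd &
          sd_H sd <=? sd_h sd * sd_h sd * qDelta]].

Definition reduced_scalar (a : qint) : bool :=
  [&& qpos t m a, qnorm a <=? sd_A sd, qtr a <=? qtr (qmul eps2 a) &
      qtr a <=? qtr (qmul epsc2 a)].

Definition scalars : seq qint :=
  let L := Z.sqrt ((qtr eps2 + 2) * sd_A sd) in
  let Y := Z.sqrt ((qtr eps2 + 2) * sd_A sd / qDelta) in
  [seq a <- [seq (x, y) | x <- zrange (- (t * Y)) (Z.to_nat ((L + t * Y) / 2 + t * Y + 1)),
                          y <- zrange (- Y) (Z.to_nat (2 * Y + 1))]
   | reduced_scalar a].

(** Representatives modulo [e] and up to sign.  The ideal of [e] has a basis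
    [(n, 0), (k, g)] with [g] the content of [e] and [n g] its norm, and negation
    acts on the second coordinate modulo [g], or on the first one modulo [n] if
    the second one vanishes. *)
Definition residues (e : qint) : seq qint :=
  let g := Z.gcd e.1 e.2 in
  let n := Z.abs (qnorm e) / g in
  [seq (x, 0) | x <- zrange 0 (Z.to_nat (n / 2 + 1))] ++
  [seq (x, y) | x <- zrange 0 (Z.to_nat n), y <- zrange 1 (Z.to_nat (g / 2))].

Definition middles (a : qint) : seq qint :=
  if cl then [seq qscale 2 b | b <- residues a] else residues (qscale 2 a).

(** For given [a] and [b] the third coefficient is found through
    [P = conj(a) d = 4 n c - conj(a) b ^ 2], where [n] is the norm of [a].  The
    second coordinate [P1] of [P] lies in one residue class modulo [4 n] and is
    bounded.  Then [P] is totally positive when its trace [T] exceeds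
    [s = sqrt (Delta P1 ^ 2)], and [P - 4 n] is not, so that [T] lies in an interval
    of length [8 n] and is known from its residue.  What remains is filtered by the
    bound for minimal forms, with [T ^ 2 - D1] for four times the norm of [P], and
    by the staircase. *)
Definition lasts (a : qint) : qint -> seq qint :=
  let n := qnorm a in
  let n4 := 4 * n in
  let n8 := 8 * n in
  let P1max := Z.sqrt (16 * (n * n) * sd_H sd / qDelta) in
  let N4min := 64 * (fd_Bd fd * fd_Bd fd) * (n * n * n) / (fd_Bn fd * fd_Bn fd) in
  let steps := [seq qscale n4 al | al <- sd_stair sd] in
  let ds := zrange (- sd_h sd) (Z.to_nat (2 * sd_h sd + 1)) in
  fun b =>
  let r := qmul (qsq b) (qconj t a) in
  let q := r.2 / n4 in
  let p := r.2 mod n4 in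
  let e := n8 + 2 * r.1 in
  flatten [seq
    let P1 := n4 * d - p in
    if Z.abs P1 <=? P1max then
      let D1 := qDelta * (P1 * P1) in
      let s := Z.sqrt D1 in
      let v := s + e - t * P1 in
      let T := s + n8 - v mod n8 in
      if N4min <=? T * T - D1 then
        let c0 := v / n8 in
        if has (fun u => qle t m u (n4 * c0 - r.1, P1)) steps then [::] else [:: (c0, q + d)]
      else [::]
    else [::] | d <- ds].

Definition all_normal_forms (test : qform -> bool) : bool :=
  all (fun a => let lasts_a := lasts a in
         all (fun b => all (fun c => test (a, b, c)) (lasts_a b)) (middles a))
    scalars.

(** The form after a shear that makes [b / 2 a] small, for which short vectors are
    found with small coefficients. *)
Definition recentred (Q : qform) : qform :=
  let: (a, b, c) := Q in
  let z := qmul b (qconj t a) in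
  let n := 2 * qnorm a in
  let k := (- ((2 * z.1 + n) / (2 * n)), - ((2 * z.2 + n) / (2 * n))) in
  (a, qadd b (qscale 2 (qmul a k)), qadd (qadd (qmul a (qsq k)) (qmul b k)) c).

Variables (shifts : seq qint) (rank_ones : seq (qint * qint * qint)) (known : seq qform).

(** The value at [(x, 1)]. *)
Definition shrinks (Q : qform) (x : qint) : bool :=
  qnorm (qadd (qmul x (qadd (qmul Q.1.1 x) Q.1.2)) Q.2) <? qnorm Q.1.1.

Definition rank_one_splits (Q : qform) (v : qint * qint * qint) : bool :=
  let: (x, y, al) := v in
  qle t m (qscale 4 (qmul al (qval t m Q x y))) (qdisc t m Q).

Definition settled (Q : qform) : bool :=
  let H := recentred Q in
  [|| has (shrinks H) shifts, has (rank_one_splits H) rank_ones | H \in known].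

End Enumeration.

Section NormalForms.
Variables (R : realType) (K : fieldExtType rat) (fd : field_data) (w : K) (w1 w2 : R).
Local Notation t := (fd_t fd).
Local Notation m := (fd_m fd).
Hypothesis HK : quadratic_order t m w w1 w2.
Implicit Types (e f : qint) (Q H : qform).
Local Notation qnorm := (qnorm t m).
Local Notation qmul := (qmul t m).
Local Notation qtr := (qtr t).

Lemma trace_norm e : (4 * qnorm e = qtr e * qtr e - qDelta fd * (e.2 * e.2))%coqZ.
Proof. rewrite /qnorm /qtr /qDelta; ring. Qed.

(** The Hermite normal form of the ideal of [e]: Bezout coefficients for the
    content [g] give an element with second coordinate [g], and
    the integer [conj(e) e / g] lies in it up to sign. *)
Lemma ideal_rectangle e : qnorm e <> Z0 ->
  let g := Z.gcd e.1 e.2 in let n := (Z.abs (qnorm e) / g)%coqZ in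
  [/\ (0 < g)%coqZ, (0 < n)%coqZ, exists k, qmul k e = (n, 0)%coqZ &
      forall b, exists k x, [/\ (0 <= x < n)%coqZ & qadd b (qmul k e) = (x, b.2 mod g)%coqZ]].
Proof.
move=> e0 g n.
have g0 : (0 < g)%coqZ.
  have := Z.gcd_nonneg e.1 e.2; have : g <> Z0; last by rewrite -/g; lia.
  move=> /Z.gcd_eq_0 [E1 E2]; apply: e0; rewrite /qnorm E1 E2.
  by rewrite !Z.mul_0_r.
have [e1' E1] : (g | e.1)%coqZ by apply: Z.gcd_divide_l.
have [e2' E2] : (g | e.2)%coqZ by apply: Z.gcd_divide_r.
have [u [v Euv]] := Z.gcd_bezout e.1 e.2 g erefl.
have En : (qnorm e = g * (e.1 * e1' + t * (e1' * e.2) - m * (e2' * e.2)))%coqZ.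
  rewrite /qnorm {1 3}E1 {2}E2; ring.
pose n' := (e.1 * e1' + t * (e1' * e.2) - m * (e2' * e.2))%coqZ.
have nE : n = Z.abs n'.
  rewrite /n En -/n' Z.abs_mul (Z.abs_eq g); last lia.
  by rewrite Z.mul_comm Z.div_mul //; lia.
have n0 : (0 < n)%coqZ.
  rewrite nE; suff : n' <> Z0 by lia.
  by move=> h; apply: e0; rewrite En -/n' h Z.mul_0_r.
have [k0 Hk0] : exists k, qmul k e = (n, Z0)%coqZ.
  pose s := Z.sgn n'; exists ((e1' + t * e2') * s, - e2' * s)%coqZ.
  have E : (e2' * e.1 = e1' * e.2)%coqZ by rewrite E1 E2; ring.
  rewrite /qmul /=; congr (_, _).
    have -> : (n = n' * s)%coqZ by rewrite nE /s; clear; lia.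
    transitivity (s * (e.1 * e1' + t * (e2' * e.1) - m * (e2' * e.2)))%coqZ.
      by ring.
    by rewrite E /n'; ring.
  transitivity (s * (e1' * e.2 - e2' * e.1))%coqZ; first by ring.
  by rewrite E; ring.
split=> // [|b]; first by exists k0.
pose q2 := (- (b.2 / g))%coqZ.
pose f : qint := ((v - t * u) * q2, u * q2)%coqZ.
pose b' := qadd b (qmul f e).
have b'2 : b'.2 = (b.2 mod g)%coqZ.
  rewrite /b' /f /qadd /qmul /= Z.mod_eq; last lia.
  have -> : (b.2 + ((v - t * u) * q2 * e.2 + u * q2 * e.1 + t * (u * q2 * e.2)) =
    b.2 + q2 * (u * e.1 + v * e.2))%coqZ by ring.
  rewrite Euv /q2; ring.
pose q1 := (- (b'.1 / n))%coqZ.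
exists (qadd f (qscale q1 k0)), (b'.1 mod n)%coqZ.
split; first exact: Z.mod_pos_bound.
have -> : qadd b (qmul (qadd f (qscale q1 k0)) e) = qadd b' (qscale q1 (qmul k0 e)).
  by rewrite /b' /qadd /qmul /qscale; cbn [fst snd]; congr (_, _); ring.
rewrite Hk0 /qadd /qscale; cbn [fst snd]; congr (_, _); last by rewrite b'2; ring.
by rewrite /q1 Z.mod_eq; [ring|lia].
Qed.

Lemma residuesP b e : qnorm e <> Z0 ->
  exists s k, qadd (qscale (sign s) b) (qmul k e) \in residues fd e.
Proof.
move=> /ideal_rectangle; rewrite /residues.
set g := Z.gcd e.1 e.2; set n := (Z.abs (qnorm e) / g)%coqZ => -[g0 n0 [k0 Hk0] Hb].
have Hn : (n = 2 * (n / 2) + n mod 2)%coqZ /\ (0 <= n mod 2 < 2)%coqZ.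
  by split; [apply: Z.div_mod|apply: Z.mod_pos_bound].
have Hg : (g = 2 * (g / 2) + g mod 2)%coqZ /\ (0 <= g mod 2 < 2)%coqZ.
  by split; [apply: Z.div_mod|apply: Z.mod_pos_bound].
have b1 : qscale (sign false) b = b.
  by rewrite /qscale !Z.mul_1_l -surjective_pairing.
have [k [x [Hx Ex]]] := Hb b; have Hy := Z.mod_pos_bound b.2 g g0.
case: (Z.eq_dec (b.2 mod g) 0) => y0.
  rewrite y0 in Ex; case: (Z_le_gt_dec x (n / 2)) => hx.
    exists false, k; rewrite b1 Ex mem_cat; apply/orP; left; apply/mapP; exists x => //.
    by apply: mem_zrange_to; move: Hx hx; clear; lia.
  exists true, (qsub k0 k); rewrite mem_cat; apply/orP; left; apply/mapP; exists (n - x)%coqZ.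
    by apply: mem_zrange_to; move: Hx hx Hn; clear; lia.
  have -> : qadd (qscale (sign true) b) (qmul (qsub k0 k) e) =
      qsub (qmul k0 e) (qadd b (qmul k e)).
    by rewrite /qadd /qsub /qmul /qscale; cbn [fst snd sign]; congr (_, _); ring.
  by rewrite Hk0 Ex /qsub; cbn [fst snd].
case: (Z_le_gt_dec (b.2 mod g) (g / 2)) => hy.
  exists false, k; rewrite b1 Ex mem_cat; apply/orP; right.
  by apply: allpairs_f; apply: mem_zrange_to; move: Hx Hy hy y0; clear; lia.
have [k' [x' [Hx' Ex']]] := Hb (qscale (sign true) b).
exists true, k'; rewrite Ex' mem_cat; apply/orP; right.
have -> : ((qscale (sign true) b).2 mod g = g - b.2 mod g)%coqZ.
  rewrite /qscale; cbn [fst snd sign]; rewrite (_ : (-1 * b.2 = - b.2)%coqZ); last by ring.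
  by rewrite Z.mod_opp_l_nz //; move: g0; clear; lia.
by apply: allpairs_f; apply: mem_zrange_to; move: Hx' Hy hy Hg; clear; lia.
Qed.

End NormalForms.

Section Reduction.
Variables (R : realType) (K : fieldExtType rat) (fd : field_data) (w : K) (w1 w2 : R).
Local Notation t := (fd_t fd).
Local Notation m := (fd_m fd).
Local Notation eps := (fd_eps fd).
Hypothesis HK : quadratic_order t m w w1 w2.
Implicit Types (e f : qint) (Q H : qform).
Local Notation ev := (qev w).
Local Notation fev := (form_ev w).
Local Notation ev1 := (qev w1).
Local Notation ev2 := (qev w2).
Local Notation qnorm := (qnorm t m).
Local Notation qmul := (qmul t m).
Local Notation qsq := (qsq t m).
Local Notation qtr := (qtr t).
Local Notation wE := (qo_eq HK).
Local Notation w1E := (w1_eq HK).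
Local Notation w2E := (w2_eq HK).

(** Multiplying [d] by the conjugate of [a] makes it [4 N(a)] times [d / 4 a], and
    an affine function of [c] with rational slope. *)
Definition qlast Q : qint := qmul (qconj t Q.1.1) (qdisc t m Q).

Lemma ev_qlast H : ev1 (qlast H) = ev2 H.1.1 * ev1 (qdisc t m H) /\
                   ev2 (qlast H) = ev1 H.1.1 * ev2 (qdisc t m H).
Proof. by rewrite /qlast (qevM w1E) (qevM w2E) (ev1_conj HK) (ev2_conj HK). Qed.

Lemma qpd_equiv Q H : bf_equiv (fev Q) (fev H) -> qpd t m Q -> qpd t m H.
Proof.
move=> QH /(tot_pd_fev HK) Qp; apply/(tot_pd_fev HK).
exact: bf_equiv_tot_pd QH Qp.
Qed.

Lemma qindecomposable_equiv cl Q H : bf_equiv (fev Q) (fev H) ->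
  qindecomposable t m cl Q -> qindecomposable t m cl H.
Proof.
move=> QH /(indecomposable_fev HK) Qi; apply/(indecomposable_fev HK).
exact: (bf_equiv_indecomposable HK QH Qi).
Qed.

Lemma qpos_norm_gt0 e : qpos t m e -> (0 < qnorm e)%coqZ.
Proof. by case/andP=> _ /Z.ltb_lt. Qed.
Lemma qpos_tr_gt0 e : qpos t m e -> (0 < qtr e)%coqZ.
Proof. by case/andP=> /Z.ltb_lt. Qed.

Lemma qlast_pos H : qpd t m H -> qpos t m (qlast H).
Proof.
move=> /andP[/(qposP HK)[a1 a2] /(qposP HK)[d1 d2]]; apply/(qposP HK).
by have [-> ->] := ev_qlast H; rewrite !mulr_gt0.
Qed.

(** Minimality of the norm of [a] gives access to the bound above; the two traces
    fix the unit multiples of the basis vectors, and so balance the conjugates of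
    [a] and of [d / 4 a]. *)
Record lex_minimal H : Prop := LexMinimal {
  lm_norm : norm_minimal fd w H;
  lm_trace : forall H', bf_equiv (fev H) (fev H') ->
    qnorm H'.1.1 = qnorm H.1.1 -> (qtr H.1.1 <= qtr H'.1.1)%coqZ;
  lm_last : forall H', bf_equiv (fev H) (fev H') ->
    H'.1.1 = H.1.1 -> (qtr (qlast H) <= qtr (qlast H'))%coqZ
}.

Lemma lex_minimal_ex Q : qpd t m Q ->
  exists2 H, bf_equiv (fev Q) (fev H) & lex_minimal H.
Proof.
move=> Qp.
have [||H1 e1 m1] := @ex_minimal qform (fun H => bf_equiv (fev Q) (fev H))
    (fun H => qnorm H.1.1).
- by exists Q; apply: (bf_equiv_refl HK).
- move=> H /qpd_equiv /(_ Qp) /andP[/qpos_norm_gt0 h _]; exact: Z.lt_le_incl.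
have [||H2 [e2 n2] m2] := @ex_minimal qform
    (fun H => bf_equiv (fev Q) (fev H) /\ qnorm H.1.1 = qnorm H1.1.1)
    (fun H => qtr H.1.1).
- by exists H1.
- move=> H [/qpd_equiv /(_ Qp) /andP[/qpos_tr_gt0 h _] _]; exact: Z.lt_le_incl.
have [||H3 [e3 a3] m3] := @ex_minimal qform
    (fun H => bf_equiv (fev Q) (fev H) /\ H.1.1 = H2.1.1) (fun H => qtr (qlast H)).
- by exists H2.
- move=> H [/qpd_equiv /(_ Qp) /qlast_pos /qpos_tr_gt0 h _]; exact: Z.lt_le_incl.
exists H3 => //; split.
- by move=> H' /(bf_equiv_trans HK e3) /m1; rewrite a3 n2.
- move=> H' /(bf_equiv_trans HK e3) E' En; rewrite a3; apply: m2; split=> //.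
  by rewrite En a3.
- by move=> H' /(bf_equiv_trans HK e3) E' En; apply: m3; split=> //; rewrite En.
Qed.

(** Adds a multiple of the first basis vector to the second one or to its
    negative; neither [a] nor [d] changes. *)
Definition shear s k : qmat := ((1, 0), (0, 0), k, (sign s, 0))%coqZ.

Lemma qunit1 : qunit t m (1, 0)%coqZ.
Proof. by rewrite /qunit /qnorm /= !Z.mul_0_r. Qed.

Lemma sign_sqr s : (sign s * sign s = 1)%coqZ. Proof. by case: s. Qed.

Lemma shear_det s k : qdet t m (shear s k) = (sign s, 0)%coqZ.
Proof. by apply: (qev_inj HK); rewrite (qev_det wE) /= !(qev_int w) zr1 zr0; ring. Qed.

Lemma shear_unit s k : qunit t m (qdet t m (shear s k)).
Proof. by rewrite shear_det /qunit /qnorm; case: s; rewrite /= !Z.mul_0_r. Qed.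

Lemma shear_first s k H : (qact t m (shear s k) H).1.1 = H.1.1.
Proof.
case: H => [[a b] c].
apply: (qev_inj HK); rewrite (qev_val wE) /= !(qev_int w) zr1 zr0; ring.
Qed.

Lemma shear_disc s k H : qdisc t m (qact t m (shear s k) H) = qdisc t m H.
Proof.
apply: (qev_inj HK); rewrite (qev_disc wE) (qev_act wE) form_disc_sub -(qev_disc wE).
by rewrite -(qev_det wE) shear_det qev_int expr2 -zrM sign_sqr zr1 mul1r.
Qed.

Lemma shear_middle s k H : (qact t m (shear s k) H).1.2 =
  qadd (qscale (sign s) H.1.2) (qmul k (qscale 2 H.1.1)).
Proof.
apply: (qev_inj HK).
have -> : ev (qact t m (shear s k) H).1.2 = (fev (qact t m (shear s k) H)).1.2.
  by case: (qact _ _ _ _) => [[]].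
rewrite (qev_act wE); case: H => [[a b] c].
by rewrite qevD (qevM wE) !qev_scale zr2 /= !(qev_int w) zr1 zr0; ring.
Qed.

Lemma shear_lex_minimal s k H :
  lex_minimal H -> lex_minimal (qact t m (shear s k) H).
Proof.
move=> [h1 h2 h3]; have E := bf_equiv_act HK H (shear_unit s k).
have L : qlast (qact t m (shear s k) H) = qlast H.
  by rewrite /qlast shear_first shear_disc.
split; rewrite /norm_minimal ?L ?shear_first => H' /(bf_equiv_trans HK E).
- exact: h1.
- exact: h2.
- exact: h3.
Qed.

(** Rescaling either basis vector by the unit [eps] shows that the first
    coefficient and [qlast] of a minimal form are balanced. *)
Lemma lex_minimal_scalar H : unit_ok fd -> lex_minimal H ->
  (qtr H.1.1 <= qtr (qmul (qsq eps) H.1.1))%coqZ /\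
  (qtr H.1.1 <= qtr (qmul (qsq (qconj t eps)) H.1.1))%coqZ.
Proof.
move=> /and3P[eu _ _] Hm.
suff S e : qunit t m e -> (qtr H.1.1 <= qtr (qmul (qsq e) H.1.1))%coqZ.
  by split; apply: S => //; rewrite /qunit qnorm_conj.
move=> ue; pose N : qmat := (e, (0, 0), (0, 0), (1, 0))%coqZ.
have Nu : qunit t m (qdet t m N).
  have -> // : qdet t m N = e.
  by apply: (qev_inj HK); rewrite (qev_det wE) /= !(qev_int w) zr1 zr0; ring.
have Ha : (qact t m N H).1.1 = qmul (qsq e) H.1.1.
  apply: (qev_inj HK); case: (H) => [[a b] c].
  rewrite (qev_val wE) !(qevM wE) /= !(qev_int w) zr0; ring.
have := lm_trace Hm (bf_equiv_act HK H Nu); rewrite Ha; apply.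
rewrite !qnorm_mul; move: ue; rewrite /qunit => /Z.eqb_spec ue.
by have -> : (qnorm e * qnorm e = 1)%coqZ; [move: ue; clear; lia|rewrite Z.mul_1_l].
Qed.

Lemma lex_minimal_last H : unit_ok fd -> lex_minimal H ->
  (qtr (qlast H) <= qtr (qmul (qsq eps) (qlast H)))%coqZ /\
  (qtr (qlast H) <= qtr (qmul (qsq (qconj t eps)) (qlast H)))%coqZ.
Proof.
move=> /and3P[eu _ _] Hm.
suff S e : qunit t m e -> (qtr (qlast H) <= qtr (qmul (qsq e) (qlast H)))%coqZ.
  by split; apply: S => //; rewrite /qunit qnorm_conj.
move=> ue; pose N : qmat := ((1, 0), (0, 0), (0, 0), e)%coqZ.
have Nd : qdet t m N = e.
  by apply: (qev_inj HK); rewrite (qev_det wE) /= !(qev_int w) zr1 zr0; ring.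
have Nu : qunit t m (qdet t m N) by rewrite Nd.
have Ha : (qact t m N H).1.1 = H.1.1.
  apply: (qev_inj HK); case: (H) => [[a b] c].
  rewrite (qev_val wE) /= !(qev_int w) zr1 zr0; ring.
have := lm_last Hm (bf_equiv_act HK H Nu) Ha.
have -> // : qlast (qact t m N H) = qmul (qsq e) (qlast H).
apply: (qev_inj HK); rewrite /qlast Ha !(qevM wE (qconj _ _)) (qevM wE (qsq _)).
rewrite (qevM wE (qconj _ _)) (qev_disc wE) (qev_act wE) form_disc_sub -!(qev_disc wE).
by rewrite -(qev_det wE) Nd (qev_sq wE) mulrCA.
Qed.

Lemma middlesP cl H : qindecomposable t m cl H ->
  exists s k, (qact t m (shear s k) H).1.2 \in middles fd cl H.1.1.
Proof.
move=> [Hs /andP[/qpos_norm_gt0 a0 _] _]; rewrite /middles.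
have a0' : qnorm H.1.1 <> Z0 by move=> h; rewrite h in a0.
case: cl Hs => [/andP[Hb1 Hb2]|_].
  have [b' Eb] : exists b', H.1.2 = qscale 2 b'.
    move/Z.even_spec: Hb1 => [x Ex]; move/Z.even_spec: Hb2 => [y Ey].
    by exists (x, y); rewrite [LHS]surjective_pairing Ex Ey.
  have [s [k Hk]] := residuesP b' a0'; exists s, k.
  apply/mapP; exists (qadd (qscale (sign s) b') (qmul k H.1.1)) => //.
  rewrite shear_middle Eb; apply: (qev_inj HK).
  by rewrite !(qevD, qev_scale, qevM wE) zr2; ring.
have a2 : qnorm (qscale 2 H.1.1) <> Z0.
  have -> : (qnorm (qscale 2 H.1.1) = 4 * qnorm H.1.1)%coqZ.
    by rewrite /qnorm /qscale; cbn [fst snd]; ring.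
  by move: a0'; clear; lia.
have [s [k Hk]] := residuesP H.1.2 a2; exists s, k.
by rewrite shear_middle.
Qed.

End Reduction.

Section Bounds.
Variables (R : realType) (K : fieldExtType rat) (fd : field_data) (w : K) (w1 w2 : R).
Local Notation t := (fd_t fd).
Local Notation m := (fd_m fd).
Local Notation eps := (fd_eps fd).
Hypothesis HK : quadratic_order t m w w1 w2.
Implicit Types (e f : qint) (Q H : qform).
Local Notation ev1 := (qev w1).
Local Notation ev2 := (qev w2).
Local Notation qnorm := (qnorm t m).
Local Notation qmul := (qmul t m).
Local Notation qsq := (qsq t m).
Local Notation wE := (qo_eq HK).
Local Notation w1E := (w1_eq HK).
Local Notation w2E := (w2_eq HK).
Variable sd : search_data.

(** The conjugates of [d / 4 a]. *)
Definition gap1 H : R := ev1 (qdisc t m H) / (4%:R * ev1 H.1.1).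
Definition gap2 H : R := ev2 (qdisc t m H) / (4%:R * ev2 H.1.1).

Lemma gap_gt0 H : qpd t m H -> 0 < gap1 H /\ 0 < gap2 H.
Proof.
move=> /andP[/(qposP HK)[a1 a2] /(qposP HK)[d1 d2]].
by split; apply: divr_gt0 => //; apply: mulr_gt0.
Qed.

(** The case [(x, y) = (1, 0)] of [rank_one_split]. *)
Lemma gap_scalar cl H al : qindecomposable t m cl H -> qpos t m al ->
  ev1 al <= gap1 H -> ev2 al <= gap2 H -> False.
Proof.
move=> Hi alp h1 h2.
have /negP := @rank_one_split _ _ _ _ _ _ _ HK cl H al (1, 0)%coqZ (0, 0)%coqZ Hi alp isT.
apply; rewrite /qle.
have [_ /andP[/(qposP HK)[a1 a2] _] _] := Hi.
have E : qval t m H (1, 0)%coqZ (0, 0)%coqZ = H.1.1.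
  apply: (qev_inj HK); rewrite (qev_val wE) !(qev_int w) zr1 zr0.
  by case: (H) => [[a b] c] /=; ring.
rewrite E; apply/(qnonnegP HK).
rewrite !qevB !qev_scale !(qevM w1E, qevM w2E) zr4 !subr_ge0.
move: h1 h2; rewrite /gap1 /gap2 !ler_pdivlMr ?mulr_gt0 //.
by move=> h1 h2; split; [move: h1; lra|move: h2; lra].
Qed.

Lemma gap_ratio H : unit_ok fd -> qpd t m H -> lex_minimal fd w H ->
  gap2 H <= ev1 (qsq eps) * gap1 H /\ gap1 H <= ev1 (qsq eps) * gap2 H.
Proof.
move=> Hu Hp Hm; have [h1 h2] := lex_minimal_last HK Hu Hm.
have [] := trace_minimal_ratio HK Hu h1 h2.
have [-> ->] := ev_qlast HK H.
have /andP[/(qposP HK)[a1 a2] _] := Hp.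
have n0 : 0 < 4%:R * (ev1 H.1.1 * ev2 H.1.1) by rewrite !mulr_gt0.
have -> : ev2 H.1.1 * ev1 (qdisc t m H) = 4%:R * (ev1 H.1.1 * ev2 H.1.1) * gap1 H.
  by rewrite /gap1; field; rewrite gt_eqF.
have -> : ev1 H.1.1 * ev2 (qdisc t m H) = 4%:R * (ev1 H.1.1 * ev2 H.1.1) * gap2 H.
  by rewrite /gap2; field; rewrite gt_eqF.
by rewrite !(mulrCA (ev1 (qsq eps))) !(ler_pM2l n0).
Qed.

Lemma search_S_gt0 : cover_ok fd -> 0 < zr R (fd_S fd).
Proof. by case/and5P => /and4P[S0 _ _ _] _ _ _ _; apply: zr_gt0. Qed.

Lemma ev1_corner e f : ev1 (qmul e (qconj t f)) = ev1 e * ev2 f.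
Proof. by rewrite (qevM w1E) (ev1_conj HK). Qed.

(** A point below the staircase of [al :: l], in the cone where the ratio of
    its coordinates is at most eps^2, is below one of the outer corners. *)
Lemma stair_cornersP (p1 p2 b : R) al l : 0 < p1 -> 0 < p2 ->
  p2 <= ev1 (qsq eps) * p1 -> p1 <= ev1 (qsq eps) * p2 ->
  (forall be, be \in al :: l -> ev1 be <= p1 -> ev2 be <= p2 -> False) ->
  (forall be, be \in al :: l -> 0 < ev1 be /\ 0 < ev2 be) ->
  (forall e, e \in qmul (qsq eps) (qsq al) :: stair_corners fd al l -> ev1 e <= b) ->
  p1 * p2 <= b.
Proof.
move=> p10 p20 r21 r12 Hno Hpos Hb.
have E0 : 0 < ev1 (qsq eps) by rewrite -(pmulr_lgt0 _ p10); apply: lt_le_trans r21.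
have [al1 al2] := Hpos al (mem_head _ _).
have [h|h] := lerP p1 (ev1 al).
  have := Hb _ (mem_head _ _); rewrite (qevM w1E) (qev_sq w1E al); apply: le_trans.
  apply: (@le_trans _ _ (p1 * (ev1 (qsq eps) * p1))); first by rewrite ler_pM2l.
  by rewrite mulrCA ler_pM2l // -expr2 ler_pXn2r // ?nnegrE ltW.
have {Hb} : forall e, e \in stair_corners fd al l -> ev1 e <= b.
  by move=> e he; apply: Hb; rewrite inE he orbT.
elim: l al h al1 al2 Hno Hpos => [|al' l IH] al h al1 al2 Hno Hpos Hb.
  have := Hb _ (mem_head _ _); rewrite (qevM w1E) (qev_sq w1E (qconj t al)) (ev1_conj HK); apply: le_trans.
  have h2 : p2 < ev2 al.
    by rewrite ltNge; apply/negP => h'; apply: (Hno al (mem_head _ _)) => //; apply: ltW.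
  apply: (@le_trans _ _ (ev1 (qsq eps) * p2 * p2)); first by rewrite ler_pM2r.
  by rewrite -mulrA ler_pM2l // -expr2 ler_pXn2r // ?nnegrE ltW.
have h2 : p2 < ev2 al.
  by rewrite ltNge; apply/negP => h'; apply: (Hno al (mem_head _ _)) => //; apply: ltW.
have [al1' al2'] : 0 < ev1 al' /\ 0 < ev2 al' by apply: Hpos; rewrite !inE eqxx orbT.
have [h'|h'] := lerP p1 (ev1 al').
  have := Hb _ (mem_head _ _); rewrite ev1_corner; apply: le_trans.
  by apply: ler_pM => //; apply: ltW.
apply: (IH al' h' al1' al2').
- by move=> be hbe; apply: Hno; rewrite inE hbe orbT.
- by move=> be hbe; apply: Hpos; rewrite inE hbe orbT.
- by move=> e he; apply: Hb; rewrite inE he orbT.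
Qed.

Lemma gap_norm H : qpd t m H ->
  zr R (qnorm (qdisc t m H)) = 16%:R * zr R (qnorm H.1.1) * (gap1 H * gap2 H).
Proof.
move=> /andP[/(qposP HK)[a1 a2] _].
by rewrite !(ev_norm HK) /gap1 /gap2; field; rewrite !gt_eqF.
Qed.

(** [N(d) = 16 N(a) N(d / 4 a)], so the bound for minimal forms reads
    [N(a) <= B ^ 2 N(d / 4 a)]. *)
Lemma scalar_norm_le cl H : cover_ok fd -> search_ok fd sd ->
  qindecomposable t m cl H -> lex_minimal fd w H ->
  (qnorm H.1.1 <= sd_A sd)%coqZ.
Proof.
move=> Hc /and5P[_ _ /allP Hpos _ /andP[Hst _]] Hi Hm.
have [_ Hp _] := Hi; have Hu : unit_ok fd by case/and5P: Hc.
have [p10 p20] := gap_gt0 Hp; have [r21 r12] := gap_ratio Hu Hp Hm.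
have S0 := search_S_gt0 Hc.
have [Happ _ /and5P[_ /zr_gt0 Bn0 /zr_gt0 Bd0 _ _] _ _] := and5P Hc.
have {Bn0} Bn0 := Bn0 R; have {Bd0} Bd0 := Bd0 R.
have S0b : (0 <? fd_S fd)%coqZ by case/and4P: Happ.
have B20 : 0 < zr R (fd_Bn fd) ^+ 2 by rewrite exprn_gt0.
have := norm_minimal_bound HK Hc Hp (lm_norm Hm).
move/Z.leb_le; rewrite -(zr_le R) !zrM (gap_norm Hp).
have /andP[/(qposP HK)[a1 a2] _] := Hp.
have n0 : 0 < zr R (qnorm H.1.1) by rewrite (ev_norm HK) mulr_gt0.
move=> Hbound.
have {Hbound} Hbound : zr R (fd_Bd fd) ^+ 2 * zr R (qnorm H.1.1) <=
    zr R (fd_Bn fd) ^+ 2 * (gap1 H * gap2 H).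
  have k0 : 0 < 16%:R * zr R (qnorm H.1.1) by rewrite mulr_gt0.
  rewrite -(ler_pM2l k0); move: Hbound; rewrite (_ : zr R 16%coqZ = 16%:R) //; lra.
suff Hle : gap1 H * gap2 H <= zr R (fd_Bd fd) ^+ 2 * zr R (sd_A sd) / zr R (fd_Bn fd) ^+ 2.
  apply/Z.leb_le; rewrite -(zr_le R) -(ler_pM2l (_ : 0 < zr R (fd_Bd fd) ^+ 2)); last by rewrite exprn_gt0.
  by apply: le_trans Hbound _; rewrite mulrC -ler_pdivlMr.
case: (sd_stair sd) Hst Hpos => // al l /allP Hst Hpos.
apply: (stair_cornersP p10 p20 r21 r12).
- by move=> be /Hpos; apply: gap_scalar Hi.
- by move=> be /Hpos /(qposP HK).
- move=> e /Hst; rewrite -(zr_le R) !zrM => h.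
  have g1 : zr R (fd_S fd) * ev1 e <= zr R (fd_S fd) * `|ev1 e|.
    by rewrite ler_pM2l // ler_norm.
  have := le_trans g1 (abs_boundP S0b e (approxP HK Happ)).
  rewrite -(ler_pM2l B20) => g; rewrite ler_pdivlMr // -(ler_pM2l S0).
  by move: g h; rewrite !expr2; lra.
Qed.

End Bounds.

Section Completeness.
Variables (R : realType) (K : fieldExtType rat) (fd : field_data) (w : K) (w1 w2 : R).
Local Notation t := (fd_t fd).
Local Notation m := (fd_m fd).
Local Notation eps := (fd_eps fd).
Hypothesis HK : quadratic_order t m w w1 w2.
Implicit Types (e f : qint) (Q H : qform).
Local Notation ev1 := (qev w1).
Local Notation ev2 := (qev w2).
Local Notation qnorm := (qnorm t m).
Local Notation qmul := (qmul t m).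
Local Notation qsq := (qsq t m).
Local Notation qtr := (qtr t).
Local Notation w1E := (w1_eq HK).
Variable sd : search_data.

(** Of two positive numbers with product fixed and ratio at most [E], the sum is
    greatest at the ratio [E]. *)
Lemma balanced_sum (E x y : R) : 0 < E -> y <= E * x -> x <= E * y ->
  E * (x + y) ^+ 2 <= (E + 1) ^+ 2 * (x * y).
Proof.
move=> E0 h1 h2; have : 0 <= (E * x - y) * (E * y - x) by rewrite mulr_ge0 // subr_ge0.
rewrite !expr2; lra.
Qed.

Lemma reduced_trace a : unit_ok fd -> reduced_scalar fd sd a ->
  (qtr a * qtr a <= (qtr (qsq eps) + 2) * sd_A sd)%coqZ.
Proof.
move=> Hu /and4P[ap /Z.leb_le An /Z.leb_le h1 /Z.leb_le h2].
have [r1 r2] := trace_minimal_ratio HK Hu h1 h2.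
have [E1 E12] := unit_sq HK Hu.
have /(qposP HK)[a1 a2] := ap.
have E0 : 0 < ev1 (qsq eps) by apply: lt_trans E1.
have tp : zr R 0 <= zr R (qtr (qsq eps) + 2)%coqZ.
  rewrite zrD (ev_tr HK) zr2 zr0 addr_ge0 // addr_ge0 ?ltW //.
  by rewrite -(pmulr_lgt0 _ E0) mulrC E12.
have H : (qtr a * qtr a <= (qtr (qsq eps) + 2) * qnorm a)%coqZ.
  apply/Z.leb_le; rewrite -(zr_le R) !zrM zrD !(ev_tr HK) (ev_norm HK) zr2.
  rewrite -(ler_pM2l E0).
  have -> : ev1 (qsq eps) * ((ev1 (qsq eps) + ev2 (qsq eps) + 2%:R) * (ev1 a * ev2 a)) =
    (ev1 (qsq eps) ^+ 2 + ev1 (qsq eps) * ev2 (qsq eps) + 2%:R * ev1 (qsq eps)) * (ev1 a * ev2 a) by ring.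
  rewrite E12; apply: (le_trans _ (_ : (ev1 (qsq eps) + 1) ^+ 2 * (ev1 a * ev2 a) <= _)).
    by rewrite -expr2; apply: balanced_sum.
  by rewrite le_eqVlt; apply/orP; left; apply/eqP; ring.
move: tp; rewrite zr_le => /Z.leb_le tp; apply: Z.le_trans H _.
exact: Z.mul_le_mono_nonneg_l.
Qed.

Lemma le_sqrt x y : (0 <= x)%coqZ -> (x * x <= y)%coqZ -> (x <= Z.sqrt y)%coqZ.
Proof.
move=> x0 xy; have y0 : (0 <= y)%coqZ by nia.
have [] := Z.sqrt_spec y y0; have := Z.sqrt_nonneg y; nia.
Qed.

Lemma scalarsP a : unit_ok fd -> search_ok fd sd -> reduced_scalar fd sd a ->
  a \in scalars fd sd.
Proof.
move=> Hu /and3P[/Z.leb_le t0 /Z.ltb_lt D0 _] Ha.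
rewrite /scalars mem_filter Ha andTb.
have T2 := reduced_trace Hu Ha; move: Ha T2 => /and4P[ap _ _ _].
move: ((qtr (qsq eps) + 2) * sd_A sd)%coqZ => L T2.
have T0 := qpos_tr_gt0 ap; have N0 := qpos_norm_gt0 ap; have NE := trace_norm fd a.
set Y := Z.sqrt (L / qDelta fd).
have TL : (qtr a <= Z.sqrt L)%coqZ by apply: le_sqrt => //; clear -T0; lia.
have HY : (- Y <= a.2 <= Y)%coqZ.
  have H1 : (a.2 * a.2 <= L / qDelta fd)%coqZ.
    by apply: Z.div_le_lower_bound => //; move: T2 N0 NE; clear; lia.
  have H2 : (Z.abs a.2 <= Y)%coqZ.
    by apply: le_sqrt; [exact: Z.abs_nonneg|rewrite -Z.abs_mul Z.abs_eq //; nia].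
  by move: H2; clear; lia.
have HtY : (- (t * Y) <= t * a.2 <= t * Y)%coqZ by clear -HY t0; nia.
have Ex : (2 * a.1 = qtr a - t * a.2)%coqZ by rewrite /qtr; ring.
rewrite [a]surjective_pairing; apply: allpairs_f.
  have Y0 : (0 <= t * Y)%coqZ by move: HtY; clear; lia.
  have H3 : (a.1 <= (Z.sqrt L + t * Y) / 2)%coqZ.
    by apply: Z.div_le_lower_bound => //; move: TL HtY Ex; clear; lia.
  by apply: mem_zrange_to; move: H3 HtY Ex T0 Y0; clear; lia.
by apply: mem_zrange_to; move: HY; clear; lia.
Qed.

Lemma qlastE a b c :
  qlast fd (a, b, c) = (4 * qnorm a * c.1 - (qmul (qsq b) (qconj t a)).1,
                        4 * qnorm a * c.2 - (qmul (qsq b) (qconj t a)).2)%coqZ.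
Proof.
rewrite /qlast /qdisc /qsq /qmul /qnorm /qconj /qsub /qscale.
case: a => a1 a2; case: b => b1 b2; case: c => c1 c2.
by cbn [fst snd]; congr (_, _); ring.
Qed.

Lemma qDeltaE : zr R (qDelta fd) = (w1 - w2) ^+ 2.
Proof.
rewrite /qDelta !(zrD, zrM) zr4 -(qo_sum HK) -[zr R m]opprK -(qo_prod HK); ring.
Qed.

(** If one conjugate of [d / 4 a] reached that of the corner, then the other one
    would reach the conjugate by the ratio bound, and the corner would be
    dominated. *)
Lemma gap_lt_corner cl H : cover_ok fd -> search_ok fd sd ->
  qindecomposable t m cl H -> lex_minimal fd w H ->
  gap1 fd w1 H < ev1 (sd_corner sd) /\ gap2 fd w2 H < ev1 (sd_corner sd).
Proof.
move=> Hc /and5P[_ _ _ _ /andP[_ /and5P[cp /eqP cE _ _ _]]] Hi Hm.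
have [_ Hp _] := Hi; have Hu : unit_ok fd by case/and5P: Hc.
have [r21 r12] := gap_ratio HK Hu Hp Hm.
have [E1 _] := unit_sq HK Hu; have E0 : 0 < ev1 (qsq eps) by apply: lt_trans E1.
have c1 : ev1 (sd_corner sd) = ev1 (qsq eps) * ev2 (sd_corner sd).
  by rewrite -{1}cE (qevM w1E) (ev1_conj HK).
have c2 : qpos t m (qconj t (sd_corner sd)).
  by apply/(qposP HK); rewrite (ev1_conj HK) (ev2_conj HK); move/(qposP HK): cp => [].
split; rewrite ltNge; apply/negP => h.
  apply: (gap_scalar HK Hi cp) => //.
  by rewrite -(ler_pM2l E0) -c1; apply: le_trans h r12.
apply: (gap_scalar HK Hi c2); rewrite ?(ev1_conj HK) ?(ev2_conj HK) //.
by rewrite -(ler_pM2l E0) -c1; apply: le_trans h r21.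
Qed.

Lemma qlast_second cl H : cover_ok fd -> search_ok fd sd ->
  qindecomposable t m cl H -> lex_minimal fd w H ->
  (qDelta fd * ((qlast fd H).2 * (qlast fd H).2) <=
   16 * (qnorm H.1.1 * qnorm H.1.1) * sd_H sd)%coqZ.
Proof.
move=> Hc Hs Hi Hm; have [g1 g2] := gap_lt_corner Hc Hs Hi Hm.
have [_ Hp _] := Hi; have [p1 p2] := gap_gt0 HK Hp.
have [Happ _ _ _ _] := and5P Hc.
have S0b : (0 <? fd_S fd)%coqZ by case/and4P: Happ.
have S0 : 0 < zr R (fd_S fd) by exact: zr_gt0.
have /andP[/(qposP HK)[a1 a2] _] := Hp.
have cH : ev1 (sd_corner sd) ^+ 2 <= zr R (sd_H sd).
  move: Hs => /and5P[_ _ _ _ /andP[_ /and5P[cp _ _ + _]]].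
  rewrite -(zr_le R) !zrM => h.
  have g := abs_boundP S0b (sd_corner sd) (approxP HK Happ).
  have /(qposP HK)[c0 _] := cp; rewrite ger0_norm ?(ltW c0) // in g.
  have S20 : 0 < zr R (fd_S fd) * zr R (fd_S fd) by rewrite mulr_gt0.
  rewrite -(ler_pM2l S20); apply: (le_trans _ h).
  have -> : zr R (fd_S fd) * zr R (fd_S fd) * ev1 (sd_corner sd) ^+ 2 =
    (zr R (fd_S fd) * ev1 (sd_corner sd)) * (zr R (fd_S fd) * ev1 (sd_corner sd)) by ring.
  by apply: ler_pM => //; rewrite mulr_ge0 // ltW.
apply/Z.leb_le; rewrite -(zr_le R) !zrM qDeltaE (ev_norm HK) (_ : zr R 16 = 16%:R) //.
have -> : (w1 - w2) ^+ 2 * (zr R (qlast fd H).2 * zr R (qlast fd H).2) =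
  (ev1 (qlast fd H) - ev2 (qlast fd H)) ^+ 2 by rewrite /qev; ring.
have [-> ->] := ev_qlast HK H.
have -> : ev2 H.1.1 * ev1 (qdisc t m H) - ev1 H.1.1 * ev2 (qdisc t m H) =
  4%:R * (ev1 H.1.1 * ev2 H.1.1) * (gap1 fd w1 H - gap2 fd w2 H).
  by rewrite /gap1 /gap2; field; rewrite !gt_eqF.
have -> : (4%:R * (ev1 H.1.1 * ev2 H.1.1) * (gap1 fd w1 H - gap2 fd w2 H)) ^+ 2 =
  16%:R * (ev1 H.1.1 * ev2 H.1.1 * (ev1 H.1.1 * ev2 H.1.1)) *
  (gap1 fd w1 H - gap2 fd w2 H) ^+ 2 by ring.
apply: ler_wpM2l; first by do ?apply: mulr_ge0 => //; apply: ltW.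
apply: le_trans cH; move: p1 p2 g1 g2.
move: (gap1 fd w1 H) (gap2 fd w2 H) (ev1 _) => x y z p1 p2 g1 g2; nra.
Qed.

Lemma abs_le_of_sqr x y d : (0 <= y)%coqZ -> (0 < d)%coqZ ->
  (d * (x * x) <= d * (y * y))%coqZ -> (Z.abs x <= y)%coqZ.
Proof. by move=> y0 d0 h; have := proj2 (Z.mul_le_mono_pos_l _ _ d d0) h; nia. Qed.

Lemma div_interval x y k : (0 < k)%coqZ -> (y * k <= x)%coqZ -> (x < (y + 1) * k)%coqZ ->
  (x / k = y)%coqZ.
Proof.
move=> k0 h1 h2; symmetry; apply: (Z.div_unique_pos x k y (x - y * k)); lia.
Qed.

(** The point [d / 4 a] does not dominate [1], which leaves one value for the first
    coordinate of [c] once the second one is known. *)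
Lemma lastsP cl a b c : cover_ok fd -> search_ok fd sd ->
  qindecomposable t m cl (a, b, c) -> lex_minimal fd w (a, b, c) ->
  c \in lasts fd sd a b.
Proof.
move=> Hc Hs Hi Hm; have [_ Hp _] := Hi.
have HL := qlast_second Hc Hs Hi Hm; rewrite qlastE /= in HL.
have Pp := qlast_pos HK Hp.
have n0 : (0 < qnorm a)%coqZ by case/andP: Hp => /qpos_norm_gt0.
rewrite /lasts; set n := qnorm a in n0 HL *; set r := qmul (qsq b) (qconj t a) in HL *.
have Hgap al : qpos t m al -> ~ qle t m (qscale (4 * n) al) (qlast fd (a, b, c)).
  move=> alp /(qnonnegP HK); rewrite !qevB !qev_scale zrM zr4 => -[h1 h2].
  have /andP[/(qposP HK)[a1 a2] _] := Hp.
  have [e1 e2] := ev_qlast HK (a, b, c); rewrite e1 e2 (ev_norm HK) /= in h1 h2 a1 a2.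
  apply: (gap_scalar HK Hi alp); rewrite ler_pdivlMr ?mulr_gt0 //.
    by rewrite -(ler_pM2l a2) /=; lra.
  by rewrite -(ler_pM2l a1) /=; lra.
have Hsmall : ~ qnonneg t m (qsub (qlast fd (a, b, c)) (4 * n, 0)%coqZ).
  have ap1 : qpos t m (1, 0)%coqZ.
    by move: Hs => /and5P[_ _ /allP Hpos /Hpos].
  have := Hgap _ ap1; rewrite /qle.
  by have -> : qscale (4 * n)%coqZ (1, 0)%coqZ = (4 * n, 0)%coqZ
    by rewrite /qscale; cbn [fst snd]; congr (_, _); ring.
have [_ /and5P[_ _ /Z.ltb_lt h0 _ /Z.leb_le Hh]] : True /\
    [&& true, true, (0 <? sd_h sd)%coqZ, true & (sd_H sd <=? sd_h sd * sd_h sd * qDelta fd)%coqZ].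
  by move: Hs => /and5P[_ _ _ _ /andP[_ /and5P[_ _ -> _ ->]]].
have D0 : (0 < qDelta fd)%coqZ by move: Hs => /and5P[_ /Z.ltb_lt].
have q1 := Z.div_mod r.2 (4 * n); have q2 := Z.mod_pos_bound r.2 (4 * n).
set q := (r.2 / (4 * n))%coqZ in q1 *.
set P1 := (4 * n * c.2 - r.2)%coqZ in HL.
apply/flatten_mapP; exists (c.2 - q)%coqZ.
  have Habs : (Z.abs P1 <= 4 * n * sd_h sd)%coqZ.
    apply: (@abs_le_of_sqr _ (4 * n * sd_h sd)%coqZ (qDelta fd)) D0 _.
      by move: h0 n0; clear; nia.
    have n20 : (0 <= 16 * (n * n))%coqZ by move: n0; clear; nia.
    apply: (Z.le_trans _ _ _ HL); apply: Z.le_trans (Z.mul_le_mono_nonneg_l _ _ _ n20 Hh) _.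
    by apply: Z.eq_le_incl; ring.
  by apply: mem_zrange_to; move: Habs q1 q2 n0; rewrite /P1; clear; nia.
have -> : (q + (c.2 - q) = c.2)%coqZ by ring.
have -> : (4 * n * (c.2 - q) - r.2 mod (4 * n) = P1)%coqZ.
  by rewrite /P1; move: q1 n0; clear; lia.
have -> : (Z.abs P1 <=? Z.sqrt (16 * (n * n) * sd_H sd / qDelta fd))%coqZ.
  apply/Z.leb_le; apply: le_sqrt; first exact: Z.abs_nonneg.
  apply: Z.div_le_lower_bound => //; rewrite -Z.abs_mul Z.abs_eq //.
  by move: (P1); clear; nia.
set D1 := (qDelta fd * (P1 * P1))%coqZ in HL *.
pose U := (8 * n * c.1 - 2 * r.1 + t * P1)%coqZ.
have PU : qtr (qlast fd (a, b, c)) = U.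
  by rewrite qlastE -/n -/r /qtr /U /P1; cbn [fst snd]; ring.
have P2 : (qlast fd (a, b, c)).2 = P1 by rewrite qlastE.
have D10 : (0 <= D1)%coqZ by rewrite /D1; move: D0; clear; nia.
have [s1 s2] := Z.sqrt_spec D1 D10; have s0 := Z.sqrt_nonneg D1.
have U1 : (Z.sqrt D1 < U)%coqZ.
  have /andP[/Z.ltb_lt + /Z.ltb_lt] := Pp.
  have := trace_norm fd (qlast fd (a, b, c)); rewrite PU P2 -/D1.
  by move: s1 s2 s0; clear; nia.
have U2 : (U - 8 * n <= Z.sqrt D1)%coqZ.
  apply/Z.nlt_ge => U2; apply: Hsmall; rewrite /qnonneg.
  have := trace_norm fd (qsub (qlast fd (a, b, c)) (4 * n, 0)%coqZ).
  have -> : qtr (qsub (qlast fd (a, b, c)) (4 * n, 0)%coqZ) = (U - 8 * n)%coqZ.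
    by rewrite -PU /qtr /qsub; cbn [fst snd]; ring.
  have -> : (qsub (qlast fd (a, b, c)) (4 * n, 0)%coqZ).2 = P1.
    by rewrite -P2 /qsub; cbn [fst snd]; ring.
  rewrite -/D1 => E; apply/andP; split; apply/Z.leb_le; move: E U2 s1 s2 s0; clear; nia.
set v := (Z.sqrt D1 + (8 * n + 2 * r.1) - t * P1)%coqZ.
have c0E : (v / (8 * n) = c.1)%coqZ.
  by apply: div_interval; move: U1 U2 n0; rewrite /v /U; clear; lia.
have TE : (Z.sqrt D1 + 8 * n - v mod (8 * n) = U)%coqZ.
  have n8 : (8 * n <> 0)%coqZ by move: n0; clear; lia.
  by have := Z.div_mod v _ n8; rewrite c0E /v /U; move: (v mod _)%coqZ; clear; lia.
rewrite TE c0E.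
have -> : (64 * (fd_Bd fd * fd_Bd fd) * (n * n * n) / (fd_Bn fd * fd_Bn fd) <=?
    U * U - D1)%coqZ.
  have := norm_minimal_bound HK Hc Hp (lm_norm Hm).
  have := trace_norm fd (qlast fd (a, b, c)); rewrite PU P2 -/D1.
  rewrite {1}/qlast qnorm_mul qnorm_conj; cbn [fst snd]; rewrite -/n => <- Hb.
  have B0 : (0 < fd_Bn fd * fd_Bn fd)%coqZ.
    by move: Hc => /and5P[_ _ /and5P[_ /Z.ltb_lt + _ _ _] _ _]; clear; nia.
  apply/Z.leb_le; apply: Z.div_le_upper_bound => //.
  by move: (Z.mul_le_mono_nonneg_l _ _ (4 * n) ltac:(lia) Hb); clear; lia.
rewrite ifF; first by rewrite -surjective_pairing mem_head.
have -> : ((4 * n * c.1 - r.1)%coqZ, P1) = qlast fd (a, b, c) by rewrite qlastE.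
apply/hasP => -[_ /mapP[al Hal ->]]; apply: Hgap.
by move: Hs => /and5P[_ _ /allP/(_ al Hal)].
Qed.

End Completeness.

(** * Classification and separation of classes *)

(** How the normal forms are settled: the [x] for which [(x, 1)] is tried as a
    vector of smaller norm; the [(x, y, al)] for which a rank one form is split
    off; and forms with matrices that produce normal forms from them, as
    representatives of indecomposable classes or along with a summand. *)
Record class_data := ClassData {
  cd_shifts : seq qint;
  cd_rank_ones : seq (qint * qint * qint);
  cd_reps : seq (qform * seq qmat);
  cd_splits : seq (qform * qform * seq qmat)
}.

Section Checks.
Variables (fd : field_data) (sd : search_data) (cl : bool) (cd : class_data).
Local Notation t := (fd_t fd).
Local Notation m := (fd_m fd).
Local Notation qmul := (qmul t m).
Local Notation qsq := (qsq t m).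
Local Notation qnorm := (qnorm t m).
Local Notation qtr := (qtr t).
Local Open Scope Z_scope.

Definition known_forms : seq qform :=
  flatten [seq [seq qact t m N RN.1 | N <- RN.2] | RN <- cd_reps cd] ++
  flatten [seq [seq qact t m N RN.1.1 | N <- RN.2] | RN <- cd_splits cd].

Definition units_ok (l : seq qmat) : bool := all (fun N => qunit t m (qdet t m N)) l.

Definition classification_ok : bool :=
  let known := known_forms in
  [&& all (fun v : qint * qint * qint =>
             ((v.1.1 != (0, 0)) || (v.1.2 != (0, 0))) && qpos t m v.2)
          (cd_rank_ones cd),
      all (fun RN => units_ok RN.2) (cd_reps cd),
      all (fun RN => [&& units_ok RN.2, qsense cl RN.1.1 & qsplits t m cl RN.1.1 RN.1.2])
          (cd_splits cd) &
      all_normal_forms fd sd cl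
        (settled fd (cd_shifts cd) (cd_rank_ones cd) known)].

(** Large enough for all [e] with [Tr(e) ^ 2 <= k] and [Delta e.2 ^ 2 <= k]. *)
Definition small_box (k : Z) : seq qint :=
  let Y := Z.sqrt (k / qDelta fd) in
  let X := (Z.sqrt k + t * Y) / 2 in
  [seq (x, y) | x <- zrange (- X) (Z.to_nat (2 * X + 1)),
                y <- zrange (- Y) (Z.to_nat (2 * Y + 1))].

(** Between [0] and [a] the trace is at most that of [a]. *)
Definition order_interval (a : qint) : seq qint :=
  [seq z <- small_box (qtr a * qtr a) | qnonneg t m z && qle t m z a].

(** Twice the trace of [b ^ 2] is [Tr(b) ^ 2 + Delta y ^ 2], with [y] the second
   coordinate of [b]. *)
Definition roots_below (q : qint) : seq qint :=
  [seq b <- small_box (2 * qtr q) | (~~ cl || qeven b) && qle t m (qsq b) q].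

Definition indecomposable_ok (Q : qform) : bool :=
  let As := order_interval Q.1.1 in
  let Cs := order_interval Q.2 in
  let Bs := roots_below (qscale 4 (qmul Q.1.1 Q.2)) in
  [&& qsense cl Q, qpd t m Q &
      all (fun a => all (fun c => all (fun b => ~~ qsplits t m cl Q (a, b, c)) Bs) Cs) As].

(** If [Q] takes the value [q] at [(x, y)] then [d x ^ 2 <= 4 c q] and
    [d y ^ 2 <= 4 a q]; after multiplication by [conj(d)] the traces bound [x] and
    [y]. *)
Definition represents (Q : qform) (q : qint) : bool :=
  let d := qdisc t m Q in
  let box k := small_box (2 * qtr (qscale 4 (qmul (qmul k q) (qconj t d))) / qnorm d) in
  let ys := box Q.1.1 in
  has (fun x => has (fun y => qval t m Q x y == q) ys) (box Q.2).

Definition is_square (k : Z) : bool := Z.sqrt k * Z.sqrt k =? k.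

(** A necessary condition for the quotient of the discriminants to be the square of
    a unit [e]: the trace of [e ^ 2] is [Tr(e) ^ 2 - 2 N(e)]. *)
Definition same_disc_class (Q H : qform) : bool :=
  let z := qmul (qdisc t m H) (qconj t (qdisc t m Q)) in
  let n := qnorm (qdisc t m Q) in
  let u := (z.1 / n, z.2 / n) in
  (z == qscale n u) && (is_square (qtr u + 2) || is_square (qtr u - 2)).

(** The test is not symmetric: it looks for the first coefficient of [H], the form
    that comes earlier in the list, among the values of [Q]. *)
Definition distinguished (H Q : qform) : bool :=
  ~~ same_disc_class Q H || ~~ represents Q H.1.1.

End Checks.

Section Soundness.
Variables (R : realType) (K : fieldExtType rat) (fd : field_data) (w : K) (w1 w2 : R).
Local Notation t := (fd_t fd).
Local Notation m := (fd_m fd).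
Hypothesis HK : quadratic_order t m w w1 w2.
Implicit Types (e f : qint) (Q H : qform).
Local Notation fev := (form_ev w).
Local Notation qnorm := (qnorm t m).
Local Notation qmul := (qmul t m).
Local Notation qtr := (qtr t).
Local Notation wE := (qo_eq HK).
Variables (sd : search_data) (cl : bool) (cd : class_data).

Lemma recentredE Q : exists k, recentred fd Q = qact t m (shear false k) Q.
Proof.
case: Q => [[a b] c]; rewrite /recentred.
set k := ((- _)%coqZ, (- _)%coqZ); exists k; apply: (form_ev_inj HK).
rewrite (qev_act wE) /= !(qev_int w) !(qevD, qev_scale, qevM wE) zr1 zr0 zr2.
by congr (_, _, _); ring.
Qed.

(** For a minimal indecomposable form the first two ways of being settled are
    impossible, and so is equivalence to a form with a known summand. *)
Lemma lex_minimal_settled Q :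
  classification_ok fd sd cl cd ->
  qindecomposable t m cl Q -> lex_minimal fd w Q ->
  settled fd (cd_shifts cd) (cd_rank_ones cd) (known_forms fd cd) Q ->
  exists2 RN, RN \in cd_reps cd & bf_equiv (fev Q) (fev RN.1).
Proof.
move=> /and4P[/allP Hr /allP Hreps /allP Hsplits _] Qi Qm.
rewrite /settled; have [k ->] := recentredE Q.
have E := bf_equiv_act HK Q (shear_unit HK false k).
have Fa := shear_first HK false k Q.
set H := qact t m (shear false k) Q in E Fa *.
have Hi : qindecomposable t m cl H := qindecomposable_equiv HK E Qi.
case/or3P.
- move=> /hasP[x _ /Z.ltb_lt]; rewrite Fa => Hx.
  pose N : qmat := (x, (1, 0), (-1, 0), (0, 0))%coqZ.
  have Nu : qunit t m (qdet t m N).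
    have -> : qdet t m N = (1, 0)%coqZ; last by rewrite /qunit /qnorm /= !Z.mul_0_r.
    by apply: (qev_inj HK); rewrite (qev_det wE) /= !(qev_int w) zr0 (_ : zr K (-1)%coqZ = -1) //; ring.
  have := lm_norm Qm (bf_equiv_trans HK E (bf_equiv_act HK H Nu)).
  have -> : (qact t m N H).1.1 = qadd (qmul x (qadd (qmul H.1.1 x) H.1.2)) H.2.
    apply: (qev_inj HK); case: (H) => [[a b] c].
    by rewrite (qev_val wE) /= !(qevD, qevM wE) qev_int zr1; ring.
  by rewrite Fa => h; case: (Zlt_not_le _ _ Hx h).
- move=> /hasP[[[x y] al] /Hr /= /andP[xy0 alp]].
  by rewrite (negPf (rank_one_split HK Hi alp xy0)).
- rewrite mem_cat => /orP[|] /flatten_mapP[].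
    move=> [R0 Ns] RN /mapP[N HN HE]; exists (R0, Ns) => //.
    apply: (bf_equiv_trans HK E); rewrite HE; apply: (bf_equiv_sym HK).
    by apply: (bf_equiv_act HK); have /allP := Hreps _ RN; apply.
  move=> [[R0 Q1] Ns] /Hsplits /and3P[/allP HNs Rs Rsp] /mapP[N HN HE].
  have ER : bf_equiv (fev H) (fev R0).
    rewrite HE; apply: (bf_equiv_sym HK); apply: (bf_equiv_act HK); exact: HNs.
  have [_ _ /(_ Q1)] := qindecomposable_equiv HK ER Hi.
  by rewrite Rsp.
Qed.

Lemma classification Q : cover_ok fd -> search_ok fd sd ->
  classification_ok fd sd cl cd -> qindecomposable t m cl Q ->
  exists2 RN, RN \in cd_reps cd & bf_equiv (fev Q) (fev RN.1).
Proof.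
move=> Hc Hs Hcl Qi; have Hu : unit_ok fd by case/and5P: Hc.
have [_ Qp _] := Qi; have [H QH Hm] := lex_minimal_ex HK Qp.
have Hi := qindecomposable_equiv HK QH Qi.
have [s [k Hk]] := middlesP HK Hi; have E := bf_equiv_act HK H (shear_unit HK s k).
have Ga := shear_first HK s k H.
have Gm := shear_lex_minimal HK s k Hm; have Gi := qindecomposable_equiv HK E Hi.
set G := qact t m (shear s k) H in E Ga Gm Gi Hk.
suff : settled fd (cd_shifts cd) (cd_rank_ones cd) (known_forms fd cd) G.
  move=> /(lex_minimal_settled Hcl Gi Gm)[RN RNin GR]; exists RN => //.
  exact: (bf_equiv_trans HK QH (bf_equiv_trans HK E GR)).
rewrite -Ga in Hk; case: G Hk Gm Gi {E Ga} => [[a b] c] /= Hb Gm Gi.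
have Ha : a \in scalars fd sd.
  apply: (scalarsP HK Hu Hs); have [_ /andP[ap _] _] := Gi.
  have [h1 h2] := lex_minimal_scalar HK Hu Gm.
  apply/and4P; split=> //; apply/Z.leb_le => //.
  exact: (scalar_norm_le HK Hc Hs Gi Gm).
have Hc' := lastsP HK Hc Hs Gi Gm.
by case/and4P: Hcl => _ _ _ /allP/(_ a Ha)/allP/(_ b Hb)/allP/(_ c Hc').
Qed.

Lemma small_boxP k e : (0 < qDelta fd)%coqZ -> (0 <= t)%coqZ ->
  (qtr e * qtr e <= k)%coqZ -> (qDelta fd * (e.2 * e.2) <= k)%coqZ ->
  e \in small_box fd k.
Proof.
move=> D0 t0 h1 h2; rewrite /small_box.
set Y := Z.sqrt (k / qDelta fd).
have HY : (- Y <= e.2 <= Y)%coqZ.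
  have H1 : (e.2 * e.2 <= k / qDelta fd)%coqZ.
    by apply: Z.div_le_lower_bound => //; move: h2; clear; lia.
  have H2 : (Z.abs e.2 <= Y)%coqZ.
    by apply: le_sqrt; [exact: Z.abs_nonneg|rewrite -Z.abs_mul Z.abs_eq //; nia].
  by move: H2; clear; lia.
have HtY : (- (t * Y) <= t * e.2 <= t * Y)%coqZ by clear -HY t0; nia.
have HT : (Z.abs (qtr e) <= Z.sqrt k)%coqZ.
  by apply: le_sqrt; [exact: Z.abs_nonneg|rewrite -Z.abs_mul Z.abs_eq //; nia].
have Ex : (2 * e.1 = qtr e - t * e.2)%coqZ by rewrite /qtr; ring.
have HX : (Z.abs e.1 <= (Z.sqrt k + t * Y) / 2)%coqZ.
  by apply: Z.div_le_lower_bound => //; move: HT HtY Ex; clear; lia.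
rewrite [e]surjective_pairing; apply: allpairs_f; apply: mem_zrange_to.
- by move: HX; clear; lia.
- by move: HX; clear; lia.
- by move: HY; clear; lia.
- by move: HY; clear; lia.
Qed.

End Soundness.

Section Representatives.
Variables (R : realType) (K : fieldExtType rat) (fd : field_data) (w : K) (w1 w2 : R).
Local Notation t := (fd_t fd).
Local Notation m := (fd_m fd).
Hypothesis HK : quadratic_order t m w w1 w2.
Implicit Types (e f : qint) (Q H : qform).
Local Notation fev := (form_ev w).
Local Notation ev1 := (qev w1).
Local Notation ev2 := (qev w2).
Local Notation qnorm := (qnorm t m).
Local Notation qmul := (qmul t m).
Local Notation qsq := (qsq t m).
Local Notation qtr := (qtr t).
Local Notation wE := (qo_eq HK).
Local Notation w1E := (w1_eq HK).
Local Notation w2E := (w2_eq HK).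
Variable cl : bool.
Hypothesis D0 : (0 < qDelta fd)%coqZ.
Hypothesis t0 : (0 <= t)%coqZ.

Lemma mem_intervalP z a : qnonneg t m z -> qle t m z a -> z \in order_interval fd a.
Proof.
move=> z0 za; rewrite mem_filter z0 za andTb.
have /andP[/Z.leb_le T0 /Z.leb_le N0] := z0.
have /andP[/Z.leb_le T1 _] := za.
have Ts : qtr (qsub a z) = (qtr a - qtr z)%coqZ by rewrite /qtr /qsub; cbn [fst snd]; ring.
rewrite Ts in T1; have NE := trace_norm fd z.
have h : (qtr z * qtr z <= qtr a * qtr a)%coqZ by move: T0 T1; clear; nia.
by apply: small_boxP => //; move: NE h N0; clear; lia.
Qed.

Lemma trace_sq b : (2 * qtr (qsq b) = qtr b * qtr b + qDelta fd * (b.2 * b.2))%coqZ.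
Proof. by rewrite /qtr /qsq /qmul /qDelta; cbn [fst snd]; ring. Qed.

Lemma qtr_le e f : qle t m e f -> (qtr e <= qtr f)%coqZ.
Proof.
move=> /andP[/Z.leb_le + _].
have -> : qtr (qsub f e) = (qtr f - qtr e)%coqZ by rewrite /qtr /qsub; cbn [fst snd]; ring.
by clear; lia.
Qed.

Lemma small_box_sq b k : (2 * qtr (qsq b) <= k)%coqZ -> b \in small_box fd k.
Proof.
rewrite trace_sq => h; have h2 := Z.square_nonneg b.2; have h1 := Z.square_nonneg (qtr b).
have h3 : (0 <= qDelta fd * (b.2 * b.2))%coqZ by apply: Z.mul_nonneg_nonneg => //; exact: Z.lt_le_incl.
by apply: small_boxP => //; move: h h1 h3; clear; lia.
Qed.

(** In a decomposition both outer coefficients of the summand lie between [0] and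
    those of [Q], and its middle one satisfies [b1 ^ 2 <= 4 a1 c1 <= 4 a c]. *)
Lemma indecomposable_okP Q : indecomposable_ok fd cl Q -> qindecomposable t m cl Q.
Proof.
move=> /and3P[Qs Qp Hall]; split=> // -[[a1 b1] c1]; apply/negP => Hsp.
have /and5P[s1 _ _ /and3P[a10 c10 d10] /and3P[a20 c20 d20]] := Hsp.
case: Q Qs Qp Hall Hsp a20 c20 d20 => [[a b] c] Qs Qp Hall Hsp a20 c20 d20.
have Ha : a1 \in order_interval fd a by apply: mem_intervalP.
have Hc : c1 \in order_interval fd c by apply: mem_intervalP.
have Hb : b1 \in roots_below fd cl (qscale 4 (qmul a c)).
  have sq_le : qle t m (qsq b1) (qscale 4 (qmul a c)).
    move: a10 a20 c10 c20 d10 => /(qnonnegP HK)[a11 a12] /(qnonnegP HK)[a21 a22].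
    move=> /(qnonnegP HK)[c11 c12] /(qnonnegP HK)[c21 c22] /(qnonnegP HK).
    rewrite (qev_disc w1E) (qev_disc w2E) /= => -[d11 d12].
    rewrite qevB in a21; rewrite qevB in a22; rewrite qevB in c21; rewrite qevB in c22.
    apply/(qnonnegP HK); rewrite !qevB !qev_scale !(qevM w1E a) !(qevM w2E a).
    rewrite !(qev_sq w1E, qev_sq w2E) zr4 !subr_ge0 in a21 a22 c21 c22 d11 d12 *.
    split.
      have := ler_pM a11 c11 a21 c21; lra.
    have := ler_pM a12 c12 a22 c22; lra.
  rewrite mem_filter sq_le andbT; apply/andP; split; first by case: (cl) s1.
  by apply: small_box_sq; have := qtr_le sq_le; clear; lia.
by move: Hall => /allP/(_ _ Ha)/allP/(_ _ Hc)/allP/(_ _ Hb); rewrite Hsp.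
Qed.

(** Both bounds come from completing the square:
    [4 c q = (2 c y + b x) ^ 2 + d x ^ 2], and likewise with [a] and [y]. *)
Lemma representsP Q x y : qpd t m Q -> represents fd Q (qval t m Q x y).
Proof.
move=> Qp; have Qps := qpd_psd HK Qp; set q := qval t m Q x y.
have /andP[/(qposP HK)[a1 a2] dp] := Qp.
have /(qposP HK)[d1 d2] := dp; have nd := qpos_norm_gt0 dp.
have /and3P[_ /(qnonnegP HK)[c1 c2] _] := Qps.
have bound k z :
    ev1 (qdisc t m Q) * ev1 z ^+ 2 <= 4%:R * ev1 k * ev1 q ->
    ev2 (qdisc t m Q) * ev2 z ^+ 2 <= 4%:R * ev2 k * ev2 q ->
    z \in small_box fd (2 * qtr (qscale 4 (qmul (qmul k q) (qconj t (qdisc t m Q)))) /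
                        qnorm (qdisc t m Q))%coqZ.
  move=> h1 h2; apply: small_box_sq; apply: Z.div_le_lower_bound => //.
  suff h : (qnorm (qdisc t m Q) * qtr (qsq z) <=
            qtr (qscale 4 (qmul (qmul k q) (qconj t (qdisc t m Q)))))%coqZ.
    by move: h; clear; lia.
  apply/Z.leb_le; rewrite -(zr_le R) zrM !(ev_tr HK) (ev_norm HK).
  rewrite !qev_scale !(qevM w1E (qmul _ _)) !(qevM w2E (qmul _ _)) !(qevM w1E k) !(qevM w2E k).
  rewrite (ev1_conj HK) (ev2_conj HK) !(qev_sq w1E, qev_sq w2E) zr4.
  move: h1 h2; rewrite -(ler_pM2l d2) => h1; rewrite -(ler_pM2l d1) => h2.
  by move: h1 h2; lra.
apply/hasP; exists x.
  apply: bound; rewrite ?(qev_val w1E) ?(qev_val w2E) ?(qev_disc w1E) ?(qev_disc w2E).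
    case: (Q) => [[a b] c] /=; rewrite -subr_ge0.
    have := sqr_ge0 (2%:R * ev1 c * ev1 y + ev1 b * ev1 x); rewrite !expr2; lra.
  case: (Q) => [[a b] c] /=; rewrite -subr_ge0.
  have := sqr_ge0 (2%:R * ev2 c * ev2 y + ev2 b * ev2 x); rewrite !expr2; lra.
apply/hasP; exists y => //.
apply: bound; rewrite ?(qev_val w1E) ?(qev_val w2E) ?(qev_disc w1E) ?(qev_disc w2E).
  case: (Q) => [[a b] c] /=; rewrite -subr_ge0.
  have := sqr_ge0 (2%:R * ev1 a * ev1 x + ev1 b * ev1 y); rewrite !expr2; lra.
case: (Q) => [[a b] c] /=; rewrite -subr_ge0.
have := sqr_ge0 (2%:R * ev2 a * ev2 x + ev2 b * ev2 y); rewrite !expr2; lra.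
Qed.

Lemma is_squareP k x : (k = x * x)%coqZ -> is_square k.
Proof.
move=> ->; rewrite /is_square; apply/Z.eqb_spec.
by rewrite -(Z.abs_square x) Z.sqrt_square //; apply: Z.abs_nonneg.
Qed.

Lemma same_disc_classP Q H : qpd t m Q -> bf_equiv (fev Q) (fev H) ->
  same_disc_class fd Q H.
Proof.
move=> /andP[_ /qpos_norm_gt0 n0] /(bf_equiv_act_ex HK)[N Nu /(form_ev_inj HK) ->].
set e := qdet t m N in Nu *; set d := qdisc t m Q in n0 *.
have E : qmul (qdisc t m (qact t m N Q)) (qconj t d) = qscale (qnorm d) (qsq e).
  apply: (qev_inj HK); rewrite (qevM wE) (qev_disc wE) (qev_act wE) form_disc_sub.
  rewrite -(qev_det wE) -(qev_disc wE) qev_scale (qev_norm wE) (qev_sq wE) -/e -/d.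
  ring.
rewrite /same_disc_class -/d E.
have U : (((qscale (qnorm d) (qsq e)).1 / qnorm d)%coqZ,
          ((qscale (qnorm d) (qsq e)).2 / qnorm d)%coqZ) = qsq e.
  rewrite [RHS]surjective_pairing /qscale; cbn [fst snd].
  by rewrite ![(qnorm d * _)%coqZ]Z.mul_comm !Z.div_mul //; move: n0; clear; lia.
rewrite U eqxx andTb.
have T : (qtr (qsq e) = qtr e * qtr e - 2 * qnorm e)%coqZ.
  by rewrite /qtr /qsq /qmul /qnorm; cbn [fst snd]; ring.
have [N1|N1] : qnorm e = 1%coqZ \/ qnorm e = (-1)%coqZ.
  by move: Nu; rewrite /qunit => /Z.eqb_spec; clear; lia.
  by apply/orP; left; apply: (@is_squareP _ (qtr e)); rewrite T N1; clear; lia.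
by apply/orP; right; apply: (@is_squareP _ (qtr e)); rewrite T N1; clear; lia.
Qed.

Lemma distinguishedP H Q : qpd t m Q -> distinguished fd H Q ->
  ~ bf_equiv (fev Q) (fev H).
Proof.
move=> Qp /orP[/negP h|/negP h] E; apply: h; first exact: same_disc_classP.
move: E => /(bf_equiv_act_ex HK)[[[[x y] r] s] _ /(form_ev_inj HK) ->].
have -> : (qact t m (x, y, r, s) Q).1.1 = qval t m Q x y by case: (Q) => [[]].
exact: representsP.
Qed.

End Representatives.

Local Open Scope classical_set_scope.
Local Open Scope card_scope.

(** * Counting classes *)
Section Counting.
Variables (R : realType) (K : fieldExtType rat) (fd : field_data) (w : K) (w1 w2 : R).
Local Notation t := (fd_t fd).
Local Notation m := (fd_m fd).
Hypothesis HK : quadratic_order t m w w1 w2.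
Variables (sd : search_data) (cl : bool).

Definition reps_ok (L : seq qform) : bool :=
  [&& (0 <? qDelta fd)%coqZ, (0 <=? t)%coqZ, all (indecomposable_ok fd cl) L &
      pairwise (distinguished fd) L].

Definition class_of (Q : qform) : set (bform K) :=
  [set H | bf_equiv (form_ev w Q) H].

Local Notation classes := (bf_classes (indecomposable_in R cl : set (bform K))).

Lemma class_of_inj L : reps_ok L ->
  set_inj `I_(size L) (fun i => class_of (nth qform0 L i)).
Proof.
move=> /and4P[/Z.ltb_lt D0 /Z.leb_le t0 /allP Hi Hp] i j.
rewrite !inE /= => iL jL E.
have D k l : (k < l)%N -> (l < size L)%N ->
    class_of (nth qform0 L k) <> class_of (nth qform0 L l).
  move=> kl lL Ekl.
  have kL : (k < size L)%N by apply: ltn_trans lL.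
  have [_ Hpd _] := indecomposable_okP HK D0 t0 (Hi _ (mem_nth qform0 lL)).
  have Hd : distinguished fd (nth qform0 L k) (nth qform0 L l).
    by move/(pairwiseP qform0): Hp; apply.
  apply: (distinguishedP HK D0 t0 Hpd Hd).
  have : class_of (nth qform0 L k) (form_ev w (nth qform0 L k)).
    exact: (bf_equiv_refl HK).
  by rewrite Ekl.
case: (ltngtP i j) => // h; first by case: (D _ _ h jL E).
by case: (D _ _ h iL (esym E)).
Qed.

Lemma class_of_classes L : reps_ok L ->
  (fun i => class_of (nth qform0 L i)) @` `I_(size L) `<=` classes.
Proof.
move=> /and4P[/Z.ltb_lt D0 /Z.leb_le t0 /allP Hi _] _ [i /= iL <-].
exists (form_ev w (nth qform0 L i)) => //.
apply/(indecomposable_fev HK)/(indecomposable_okP HK D0 t0).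
exact: Hi (mem_nth _ iL).
Qed.

Lemma classes_ge L : reps_ok L -> `I_(size L) #<= classes.
Proof.
move=> HL; apply: card_le_trans (subset_card_le (class_of_classes HL)).
by have := inj_card_eq (class_of_inj HL); rewrite card_eq_le => /andP[].
Qed.

Definition rep_forms (cd : class_data) : seq qform := [seq RN.1 | RN <- cd_reps cd].

Lemma classes_eq (cd : class_data) :
  cover_ok fd -> search_ok fd sd -> classification_ok fd sd cl cd ->
  reps_ok (rep_forms cd) ->
  classes #= `I_(size (cd_reps cd)).
Proof.
rewrite /rep_forms => Hc Hs Hcl HL.
have := inj_card_eq (class_of_inj HL); rewrite size_map.
suff -> : (fun i => class_of (nth qform0 [seq RN.1 | RN <- cd_reps cd] i)) @`
    `I_(size (cd_reps cd)) = classes by [].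
apply/seteqP; split.
  by have := class_of_classes HL; rewrite size_map.
move=> _ [Q Qi <-].
have [Qs _ _] := Qi; have [q Eq] := integral_fev_ex HK (sense_integral Qs).
rewrite Eq in Qi *; move/(indecomposable_fev HK): Qi => qi.
have [RN RNin E] := classification HK Hc Hs Hcl qi.
have RNin' : RN.1 \in [seq RN.1 | RN <- cd_reps cd] by apply: map_f.
exists (index RN.1 [seq RN.1 | RN <- cd_reps cd]).
  by rewrite /= -(size_map fst) index_mem.
rewrite nth_index //; apply/seteqP; split=> H /=.
  exact: (bf_equiv_trans HK E).
exact: (bf_equiv_trans HK (bf_equiv_sym HK E)).
Qed.

End Counting.

(** * Data of the five fields *)

Section Data.
Local Open Scope Z_scope.

Definition field2 : field_data := {|
  fd_t := 0; fd_m := 2; fd_eps := (1, 1);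
  fd_S := 1024; fd_W := 1448; fd_M := 64;
  fd_vectors := [::
    ((0, 0), (1, 0), (-1, 0), (0, 0)); ((-1, 0), (0, 1), (0, 0), (-1, 0));
    ((-1, 0), (1, 0), (-1, 0), (0, 0)); ((1, 0), (1, 0), (-1, 0), (0, 0));
    ((1, -1), (1, 0), (-1, 0), (0, 0)); ((0, -1), (1, 0), (-1, 0), (0, 0));
    ((-1, -1), (1, 0), (-1, 0), (0, 0))];
  fd_Bn := 5; fd_Bd := 2;
  fd_Sr := 1000; fd_r := 413;
  fd_slabs := [:: 516; 644; 802; 1000; 1247; 1554; 1937; 2417];
  fd_depth := 10
|}.

Definition field3 : field_data := {|
  fd_t := 0; fd_m := 3; fd_eps := (2, 1);
  fd_S := 1024; fd_W := 1774; fd_M := 64;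
  fd_vectors := [::
    ((0, 0), (1, 0), (-1, 0), (0, 0)); ((-1, 0), (1, 0), (-1, 0), (0, 0));
    ((2, -1), (1, -1), (0, 1), (-1, 0)); ((1, 0), (1, 0), (-1, 0), (0, 0));
    ((1, -1), (1, 0), (-1, 0), (0, 0)); ((-1, -1), (1, 0), (-1, 0), (0, 0));
    ((1, 0), (1, -1), (1, 1), (-1, 0)); ((-1, 0), (0, 1), (0, 0), (-1, 0))];
  fd_Bn := 9; fd_Bd := 2;
  fd_Sr := 1000; fd_r := 266;
  fd_slabs := [:: 349; 454; 591; 768; 1000; 1301; 1693; 2204; 2868; 3735];
  fd_depth := 8
|}.

Definition field5 : field_data := {|
  fd_t := 1; fd_m := 1; fd_eps := (0, 1);
  fd_S := 1024; fd_W := 1657; fd_M := 64;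
  fd_vectors := [::
    ((0, 0), (0, 1), (1, -1), (0, 0)); ((0, -1), (0, 1), (1, -1), (0, 0))];
  fd_Bn := 11; fd_Bd := 5;
  fd_Sr := 1000; fd_r := 617;
  fd_slabs := [:: 786; 1000; 1272; 1621];
  fd_depth := 8
|}.

Definition field6 : field_data := {|
  fd_t := 0; fd_m := 6; fd_eps := (5, 2);
  fd_S := 1024; fd_W := 2508; fd_M := 256;
  fd_vectors := [::
    ((0, 0), (1, 0), (-1, 0), (0, 0)); ((3, -1), (2, -1), (1, 1), (-1, 0));
    ((2, -1), (3, -1), (-1, 0), (-1, 0)); ((-1, 0), (1, 0), (-1, 0), (0, 0));
    ((2, -1), (1, 0), (-1, 0), (0, 0)); ((1, 0), (1, 0), (-1, 0), (0, 0));
    ((-2, -1), (1, 0), (-1, 0), (0, 0)); ((1, -1), (2, 0), (2, 0), (-1, -1));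
    ((-1, -1), (2, 0), (3, 1), (-1, -1)); ((1, -1), (1, 0), (-1, 0), (0, 0));
    ((-1, -1), (1, 0), (-1, 0), (0, 0)); ((1, 0), (2, -1), (2, 1), (-1, 0));
    ((4, -2), (3, -1), (-1, -1), (1, 0));
    ((-1, -1), (3, 1), (-2, 1), (-1, 0));
    ((5, -2), (2, -1), (0, 1), (-1, 0)); ((2, 0), (1, -1), (1, 1), (-2, 0));
    ((-2, 0), (1, 1), (5, -1), (0, -2)); ((1, -1), (3, -1), (-2, -1), (1, 0))];
  fd_Bn := 6; fd_Bd := 1;
  fd_Sr := 1000; fd_r := 100;
  fd_slabs := [::
    135; 179; 239; 318; 423; 564; 751; 1000; 1332; 1774; 2362; 3146; 4190;
    5581; 7433; 9901];
  fd_depth := 10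
|}.

Definition field21 : field_data := {|
  fd_t := 1; fd_m := 5; fd_eps := (2, 1);
  fd_S := 1024; fd_W := 2858; fd_M := 256;
  fd_vectors := [::
    ((0, 0), (1, 0), (-1, 0), (0, 0)); ((-2, -1), (1, 1), (1, 0), (-1, 0));
    ((-1, 0), (1, 0), (-1, 0), (0, 0)); ((1, 0), (1, 0), (-1, 0), (0, 0));
    ((-1, -1), (1, 0), (-1, 0), (0, 0)); ((1, -1), (1, 0), (-1, 0), (0, 0));
    ((0, -1), (2, 0), (2, 1), (-1, -1)); ((-1, -1), (2, 0), (2, 1), (0, -1));
    ((2, -1), (1, 0), (-1, 0), (0, 0)); ((-1, 0), (1, 1), (0, 0), (-1, 0));
    ((1, -1), (2, 0), (2, 0), (0, -1)); ((-3, -1), (1, 1), (4, 0), (0, -1))];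
  fd_Bn := 6; fd_Bd := 1;
  fd_Sr := 1000; fd_r := 207;
  fd_slabs := [::
    271; 352; 457; 593; 770; 1000; 1298; 1686; 2189; 2842; 3690; 4794];
  fd_depth := 12
|}.

(** The stairs consist of totally positive units, joined for [D = 2] and [D = 6] by
    elements of norm two and three. *)
Definition search2 : search_data := {|
  sd_stair := [:: (2, -1); (1, 0); (2, 1)]; sd_corner := (2, 1);
  sd_A := 22; sd_H := 12; sd_h := 2
|}.

Definition search3 : search_data := {|
  sd_stair := [:: (2, -1); (1, 0); (2, 1)]; sd_corner := (2, 1);
  sd_A := 76; sd_H := 14; sd_h := 2
|}.

Definition search5 : search_data := {|
  sd_stair := [:: (2, -1); (1, 0); (1, 1)]; sd_corner := (2, 1);
  sd_A := 13; sd_H := 14; sd_h := 2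
|}.

Definition search6 : search_data := {|
  sd_stair := [:: (5, -2); (3, -1); (1, 0); (3, 1); (5, 2)]; sd_corner := (5, 2);
  sd_A := 197; sd_H := 99; sd_h := 3
|}.

Definition search21 : search_data := {|
  sd_stair := [:: (3, -1); (1, 0); (2, 1)]; sd_corner := (2, 1);
  sd_A := 173; sd_H := 23; sd_h := 2
|}.

(** Each matrix listed with a form produces a recentred normal form from it; each
   representative occurs among them itself, under the identity matrix. *)
Definition classical2 : class_data := {|
  cd_shifts := [:: (0, 0)];
  cd_rank_ones := [::];
  cd_reps := [::
    (((2, -1), (2, -2), (2, -1)), [::
      ((1, 0), (0, 0), (0, 0), (1, 0)); ((0, -1), (-1, 0), (1, 0), (-1, 0));
      ((-2, -1), (-1, -1), (1, 1), (1, 0));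
      ((-2, -1), (-1, -1), (1, 1), (0, 0))])];
  cd_splits := [::]
|}.

Definition integral2 : class_data := {|
  cd_shifts := [::
    (0, 0); (1, 0); (-1, 0); (-1, -1); (1, 1); (1, -1); (-1, 1)];
  cd_rank_ones := [:: ((0, 0), (1, 0), (1, 0)); ((0, 1), (1, 0), (1, 0))];
  cd_reps := [::
    (((1, 0), (0, -1), (1, 0)), [::
      ((1, 0), (0, 0), (0, 0), (1, 0)); ((0, -1), (-1, 0), (1, 0), (1, 0));
      ((0, -1), (-1, 0), (1, 0), (-1, 0))]);
    (((1, 0), (-1, 0), (1, 0)), [:: ((1, 0), (0, 0), (0, 0), (1, 0))]);
    (((2, -1), (2, -2), (2, -1)), [::
      ((1, 0), (0, 0), (0, 0), (1, 0)); ((0, -1), (-1, 0), (1, 0), (-1, 0));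
      ((-2, -1), (-1, -1), (1, 1), (1, 0));
      ((-2, -1), (-1, -1), (1, 1), (0, 0))]);
    (((1, 0), (-1, 0), (2, -1)), [::
      ((1, 0), (0, 0), (0, 0), (1, 0)); ((-1, 0), (0, 0), (0, 0), (-1, -1))]);
    (((1, 0), (-1, 0), (2, 1)), [::
      ((1, 0), (0, 0), (0, 0), (1, 0)); ((-1, 0), (0, 0), (1, 0), (1, -1))]);
    (((2, -1), (0, -1), (2, 1)), [::
      ((1, 0), (0, 0), (0, 0), (1, 0)); ((-1, 0), (1, -1), (0, 0), (-1, 1));
      ((-1, -1), (-1, 0), (0, 0), (1, 0));
      ((-1, -1), (-1, 0), (1, 1), (0, 1))]);
    (((2, -1), (-1, 1), (2, -1)), [::
      ((1, 0), (0, 0), (0, 0), (1, 0)); ((-1, 0), (0, 0), (0, 0), (1, 0));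
      ((-1, -1), (0, 0), (0, 0), (1, 1));
      ((-1, -1), (0, 0), (0, 0), (-1, -1));
      ((-1, 0), (0, 0), (1, 0), (-1, -1));
      ((-1, -1), (0, 0), (1, 1), (-1, 0))])];
  cd_splits := [::
    (((3, -1), (2, -3), (3, -1)), ((2, -1), (2, -2), (2, -1)), [:: ((1, 0), (0, 0), (0, 0), (1, 0))]);
    (((3, 1), (-2, -3), (3, 1)), ((1, 0), (0, -1), (1, 0)), [:: ((1, 0), (0, 0), (0, 0), (1, 0))])]
|}.

Definition classical3 : class_data := {|
  cd_shifts := [:: (0, 0); (1, 0); (-1, 0); (-1, 1); (-1, -1)];
  cd_rank_ones := [::
    ((-1, 0), (1, 0), (1, 0)); ((0, 0), (1, 0), (2, -1));
    ((0, 0), (1, 0), (1, 0))];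
  cd_reps := [::
    (((2, 0), (0, -2), (2, 0)), [::
      ((1, 0), (0, 0), (0, 0), (1, 0)); ((1, -1), (-1, 0), (-1, 0), (0, 0));
      ((-2, -1), (-2, -1), (2, 0), (0, 1));
      ((1, -1), (-1, 0), (2, -1), (-1, 1));
      ((-2, -1), (-2, -1), (1, 1), (2, 1))]);
    (((3, -1), (0, -2), (3, 1)), [::
      ((1, 0), (0, 0), (0, 0), (1, 0)); ((-1, -1), (-1, 0), (2, 1), (1, 0))]);
    (((4, -1), (-4, 4), (5, -2)), [::
      ((1, 0), (0, 0), (0, 0), (1, 0)); ((-1, 0), (1, 1), (1, 1), (-2, -1));
      ((0, 0), (-1, 0), (-1, 0), (0, 0));
      ((-1, -1), (2, 1), (1, 0), (-1, -1))])];
  cd_splits := [::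
    (((6, -2), (6, -6), (6, -2)), ((4, -2), (6, -4), (4, -2)), [::
      ((1, 0), (0, 0), (0, 0), (1, 0)); ((-2, -1), (-2, -1), (1, 1), (2, 1))])]
|}.

Definition integral3 : class_data := {|
  cd_shifts := [:: (0, 0); (1, 0); (-1, 0); (-1, 1); (1, 1); (-1, -1)];
  cd_rank_ones := [::
    ((0, 0), (1, 0), (1, 0)); ((-1, 0), (1, 0), (1, 0));
    ((0, 1), (1, 0), (1, 0)); ((-1, 0), (1, -1), (1, 0));
    ((1, 0), (1, 1), (1, 0)); ((-1, -1), (1, 0), (2, -1));
    ((1, -1), (1, 0), (2, 1))];
  cd_reps := [::
    (((1, 0), (0, -1), (1, 0)), [::
      ((1, 0), (0, 0), (0, 0), (1, 0)); ((0, -1), (-2, 0), (1, 0), (1, 0));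
      ((0, -1), (-2, 0), (-1, 0), (1, 0));
      ((1, -1), (-1, 0), (-1, 0), (0, 0));
      ((-2, -1), (-2, -1), (2, 0), (0, 1));
      ((1, -1), (-1, 0), (2, -1), (-1, 1));
      ((-2, -1), (-2, -1), (1, 1), (2, 1))]);
    (((1, 0), (-1, -1), (2, 0)), [::
      ((1, 0), (0, 0), (0, 0), (1, 0)); ((-2, -1), (-1, -1), (2, 1), (2, 1));
      ((0, -1), (-1, 0), (1, 0), (0, 0));
      ((-3, -2), (-2, -1), (4, 2), (2, 1))]);
    (((1, 0), (-1, 0), (1, 0)), [:: ((1, 0), (0, 0), (0, 0), (1, 0))]);
    (((2, -1), (-2, 1), (2, -1)), [::
      ((1, 0), (0, 0), (0, 0), (1, 0)); ((-2, -1), (-2, -1), (0, 0), (2, 1));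
      ((-1, 0), (-1, 0), (-1, 0), (1, 1));
      ((-2, -1), (-2, -1), (1, 1), (2, 1))])];
  cd_splits := [::
    (((2, 0), (0, -2), (2, 0)), ((1, 0), (0, -1), (1, 0)), [::
      ((1, 0), (0, 0), (0, 0), (1, 0)); ((1, -1), (-1, 0), (-1, 0), (0, 0));
      ((-2, -1), (-2, -1), (2, 0), (0, 1));
      ((1, -1), (-1, 0), (2, -1), (-1, 1));
      ((-2, -1), (-2, -1), (1, 1), (2, 1))]);
    (((3, -1), (3, -3), (3, -1)), ((2, -1), (3, -2), (2, -1)), [::
      ((1, 0), (0, 0), (0, 0), (1, 0)); ((-2, -1), (-2, -1), (1, 1), (2, 1))]);
    (((2, 0), (-1, -2), (3, 0)), ((1, 0), (0, -1), (1, 0)), [::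
      ((1, 0), (0, 0), (0, 0), (1, 0)); ((-1, 0), (0, 0), (0, 1), (1, 0));
      ((-1, 0), (-1, 0), (1, 0), (0, 0));
      ((-1, 0), (-1, 0), (-1, 0), (0, 0));
      ((-2, -1), (-2, -1), (2, 1), (1, 1))]);
    (((2, 0), (-1, -2), (3, 1)), ((1, 0), (0, -1), (1, 0)), [::
      ((1, 0), (0, 0), (0, 0), (1, 0)); ((-1, 0), (0, 0), (0, 1), (1, 0));
      ((-1, -1), (-1, 0), (1, 0), (0, 0));
      ((-1, -1), (-1, 0), (-1, 0), (0, 0));
      ((1, -1), (-2, 1), (1, 0), (-1, 1))]);
    (((3, 0), (0, -3), (3, 0)), ((1, 0), (0, -1), (1, 0)), [::
      ((1, 0), (0, 0), (0, 0), (1, 0)); ((1, -1), (-1, 0), (-1, 0), (0, 0));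
      ((-2, -1), (-2, -1), (2, 0), (0, 1));
      ((1, -1), (-1, 0), (2, -1), (-1, 1));
      ((-2, -1), (-2, -1), (1, 1), (2, 1))]);
    (((3, -1), (0, -2), (3, 1)), ((2, -1), (1, -1), (1, 0)), [::
      ((1, 0), (0, 0), (0, 0), (1, 0)); ((-1, -1), (-1, 0), (2, 1), (1, 0))]);
    (((4, -1), (3, -4), (4, -1)), ((2, -1), (3, -2), (2, -1)), [::
      ((1, 0), (0, 0), (0, 0), (1, 0)); ((-2, -1), (-2, -1), (1, 1), (2, 1))]);
    (((4, 1), (-3, -4), (4, 1)), ((1, 0), (0, -1), (1, 0)), [::
      ((1, 0), (0, 0), (0, 0), (1, 0)); ((1, -1), (-1, 0), (2, -1), (-1, 1))]);
    (((3, -1), (-3, 1), (3, -1)), ((2, -1), (-2, 1), (2, -1)), [:: ((1, 0), (0, 0), (0, 0), (1, 0))]);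
    (((3, 1), (-3, -1), (3, 1)), ((1, 0), (-1, 0), (1, 0)), [:: ((1, 0), (0, 0), (0, 0), (1, 0))]);
    (((4, -1), (-4, 4), (5, -2)), ((2, -1), (-5, 3), (4, -2)), [::
      ((1, 0), (0, 0), (0, 0), (1, 0)); ((-1, 0), (1, 1), (1, 1), (-2, -1));
      ((0, 0), (-1, 0), (-1, 0), (0, 0));
      ((-1, -1), (2, 1), (1, 0), (-1, -1))]);
    (((5, -1), (3, -5), (5, -1)), ((2, -1), (3, -2), (2, -1)), [::
      ((1, 0), (0, 0), (0, 0), (1, 0)); ((-2, -1), (-2, -1), (1, 1), (2, 1))]);
    (((5, 1), (-3, -5), (5, 1)), ((1, 0), (0, -1), (1, 0)), [::
      ((1, 0), (0, 0), (0, 0), (1, 0)); ((1, -1), (-1, 0), (2, -1), (-1, 1))]);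
    (((6, -2), (6, -6), (6, -2)), ((4, -2), (6, -4), (4, -2)), [::
      ((1, 0), (0, 0), (0, 0), (1, 0)); ((-2, -1), (-2, -1), (1, 1), (2, 1))]);
    (((7, -2), (6, -7), (7, -2)), ((4, -2), (6, -4), (4, -2)), [::
      ((1, 0), (0, 0), (0, 0), (1, 0)); ((-2, -1), (-2, -1), (1, 1), (2, 1))]);
    (((7, 2), (-6, -7), (7, 2)), ((1, 0), (0, -1), (1, 0)), [::
      ((1, 0), (0, 0), (0, 0), (1, 0)); ((1, -1), (-1, 0), (2, -1), (-1, 1))]);
    (((9, -3), (9, -9), (9, -3)), ((7, -4), (12, -7), (7, -4)), [::
      ((1, 0), (0, 0), (0, 0), (1, 0)); ((-2, -1), (-2, -1), (1, 1), (2, 1))])]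
|}.

Definition classical5 : class_data := {|
  cd_shifts := [::];
  cd_rank_ones := [::];
  cd_reps := [::
    (((2, 0), (0, -2), (2, 0)), [::
      ((1, 0), (0, 0), (0, 0), (1, 0)); ((0, -1), (0, -1), (0, 1), (1, 1))])];
  cd_splits := [::]
|}.

Definition integral5 : class_data := {|
  cd_shifts := [:: (0, 0)];
  cd_rank_ones := [::];
  cd_reps := [::
    (((1, 0), (0, -1), (1, 0)), [::
      ((1, 0), (0, 0), (0, 0), (1, 0)); ((0, -1), (0, -1), (0, 0), (0, 1));
      ((0, -1), (0, -1), (1, 0), (-1, 1)); ((0, -1), (0, -1), (0, 1), (1, 1))]);
    (((1, 0), (-1, 0), (1, 0)), [::
      ((1, 0), (0, 0), (0, 0), (1, 0)); ((-1, 0), (-1, 0), (0, 0), (0, 1));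
      ((-1, 0), (-1, 0), (1, 0), (0, 1))])];
  cd_splits := [::
    (((2, 0), (0, -2), (2, 0)), ((1, 0), (0, -1), (1, 0)), [::
      ((1, 0), (0, 0), (0, 0), (1, 0)); ((0, -1), (0, -1), (0, 1), (1, 1))])]
|}.

Definition classical6 : class_data := {|
  cd_shifts := [::
    (0, 0); (1, 0); (-1, 0); (2, -1); (2, 1); (1, 1); (-2, -1); (-2, 1);
    (1, -1); (-1, 1); (-1, -1); (-3, 1); (3, 1); (-3, -1)];
  cd_rank_ones := [::
    ((-1, 0), (1, 0), (1, 0)); ((1, 0), (1, 0), (1, 0));
    ((0, 0), (1, 0), (1, 0)); ((-3, 1), (2, -1), (5, 2));
    ((0, 0), (1, 0), (5, -2)); ((0, 0), (1, 0), (5, 2));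
    ((-3, 1), (2, -1), (1, 0)); ((3, 1), (2, 1), (1, 0));
    ((2, 1), (1, 0), (5, -2)); ((-1, 1), (1, 0), (5, 2));
    ((-2, 1), (1, 0), (5, 2)); ((1, -1), (2, -1), (1, 0));
    ((-3, 1), (1, 0), (5, 2)); ((-1, 0), (1, 0), (5, -2));
    ((-1, -1), (1, 0), (5, -2)); ((3, -1), (2, -1), (5, 2));
    ((-1, 0), (1, 0), (5, 2)); ((1, 0), (1, 0), (3, 1));
    ((1, 1), (1, 0), (1, 0)); ((2, -1), (1, 0), (5, 2));
    ((3, -1), (2, -1), (1, 0)); ((3, -1), (2, -1), (3, 1));
    ((-1, -1), (1, 0), (1, 0)); ((-1, 1), (1, 0), (1, 0));
    ((1, 1), (1, 0), (5, -2)); ((-3, -1), (1, 0), (5, -2));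
    ((-1, 0), (2, -1), (1, 0)); ((1, 0), (2, -1), (1, 0));
    ((-1, 1), (2, -1), (1, 0)); ((-1, 0), (2, 1), (1, 0));
    ((1, 0), (2, 1), (1, 0)); ((-3, -1), (2, 1), (1, 0));
    ((3, 2), (2, 1), (1, 0))];
  cd_reps := [::
    (((2, 0), (-2, -2), (4, 1)), [::
      ((1, 0), (0, 0), (0, 0), (1, 0)); ((3, -1), (-2, 1), (1, -1), (-1, 0));
      ((3, -1), (-2, 1), (-1, -2), (-3, 0));
      ((-5, -2), (-2, -1), (10, 3), (3, 2));
      ((-5, -2), (-2, -1), (7, 3), (3, 1))]);
    (((3, -1), (-4, 2), (3, -1)), [::
      ((1, 0), (0, 0), (0, 0), (1, 0)); ((-3, -1), (2, 1), (2, 1), (-3, -1))]);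
    (((2, 0), (-2, -2), (6, 0)), [::
      ((1, 0), (0, 0), (0, 0), (1, 0)); ((-5, -2), (-3, -1), (5, 2), (2, 1));
      ((-1, -1), (-2, 0), (3, 1), (1, 1));
      ((-17, -7), (-10, -4), (29, 12), (17, 7))]);
    (((3, -1), (-4, 2), (4, 0)), [::
      ((1, 0), (0, 0), (0, 0), (1, 0)); ((-1, 0), (-1, 0), (0, 0), (1, 0))]);
    (((4, -1), (-8, 4), (8, -3)), [::
      ((1, 0), (0, 0), (0, 0), (1, 0)); ((-2, -1), (3, 1), (3, 1), (-2, -1));
      ((1, -1), (2, 0), (2, 0), (-1, -1));
      ((-3, -1), (2, 1), (-2, -1), (3, 1))]);
    (((6, -2), (6, -4), (6, -1)), [::
      ((1, 0), (0, 0), (0, 0), (1, 0)); ((-5, -2), (-2, -1), (7, 3), (3, 1))]);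
    (((6, -2), (6, -4), (6, 0)), [::
      ((1, 0), (0, 0), (0, 0), (1, 0)); ((-2, -1), (-1, 0), (5, 1), (-1, 1))]);
    (((8, -3), (-4, 2), (4, 1)), [::
      ((1, 0), (0, 0), (0, 0), (1, 0)); ((-2, -1), (1, 0), (1, 0), (2, -1));
      ((-1, 0), (-2, 1), (1, 0), (3, -1));
      ((0, 0), (-1, 0), (-1, 0), (-1, 1))]);
    (((4, -1), (6, -4), (8, -2)), [::
      ((1, 0), (0, 0), (0, 0), (1, 0)); ((-3, -1), (-2, -1), (2, 1), (3, 1))]);
    (((4, -1), (6, -4), (8, -1)), [::
      ((1, 0), (0, 0), (0, 0), (1, 0)); ((3, -1), (-2, 1), (2, -2), (-3, 1))]);
    (((4, 1), (-6, -4), (8, 1)), [::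
      ((1, 0), (0, 0), (0, 0), (1, 0)); ((-3, -1), (-2, -1), (4, 1), (3, 1))]);
    (((4, 1), (-6, -4), (8, 2)), [::
      ((1, 0), (0, 0), (0, 0), (1, 0)); ((3, -1), (-2, 1), (4, -2), (-3, 1))]);
    (((4, -1), (6, -4), (10, 0)), [::
      ((1, 0), (0, 0), (0, 0), (1, 0)); ((-1, -1), (-1, 0), (4, 0), (-1, 1))]);
    (((4, 1), (-6, -4), (10, 0)), [::
      ((1, 0), (0, 0), (0, 0), (1, 0)); ((1, -1), (-1, 0), (2, -1), (-1, 0))])];
  cd_splits := [::
    (((6, -1), (0, 4), (6, 1)), ((4, -1), (-2, 2), (2, 0)), [::
      ((1, 0), (0, 0), (0, 0), (1, 0)); ((-1, -1), (2, 0), (2, 0), (1, -1));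
      ((2, -1), (3, -1), (3, 0), (1, -1));
      ((-3, -1), (2, 1), (-1, -1), (3, 0))]);
    (((5, -1), (-6, 4), (7, -2)), ((3, -1), (-4, 2), (3, -1)), [::
      ((1, 0), (0, 0), (0, 0), (1, 0)); ((-3, -1), (2, 1), (2, 1), (-3, -1))]);
    (((5, 1), (-6, -4), (7, 2)), ((2, 0), (-2, -2), (4, 1)), [::
      ((1, 0), (0, 0), (0, 0), (1, 0)); ((3, -1), (-2, 1), (-2, 1), (3, -1))]);
    (((5, -1), (-2, 4), (10, 2)), ((3, -1), (-4, 2), (4, 0)), [::
      ((1, 0), (0, 0), (0, 0), (1, 0)); ((-1, 0), (-1, 0), (0, 0), (1, 0))]);
    (((5, 1), (-2, -4), (10, -2)), ((2, 0), (2, -2), (6, -2)), [::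
      ((1, 0), (0, 0), (0, 0), (1, 0)); ((-1, 0), (-1, 0), (0, 0), (1, 0))]);
    (((8, -2), (4, -6), (12, -1)), ((6, -2), (6, -4), (6, -1)), [::
      ((1, 0), (0, 0), (0, 0), (1, 0)); ((-1, -1), (-2, 0), (3, 1), (1, 1));
      ((-5, -2), (-2, -1), (10, 4), (5, 2))]);
    (((8, -2), (4, -6), (12, 2)), ((6, -2), (6, -4), (6, 0)), [::
      ((1, 0), (0, 0), (0, 0), (1, 0)); ((-2, -1), (-1, 0), (5, 1), (-1, 1))]);
    (((12, -4), (8, -6), (8, -1)), ((8, -3), (8, -4), (4, -1)), [::
      ((1, 0), (0, 0), (0, 0), (1, 0)); ((-3, -1), (-2, -1), (2, 1), (3, 1));
      ((-5, -2), (-2, -1), (7, 3), (3, 1))]);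
    (((16, -6), (20, -10), (12, -2)), ((10, -4), (14, -6), (6, -2)), [::
      ((1, 0), (0, 0), (0, 0), (1, 0)); ((-2, -1), (-1, 0), (5, 1), (-1, 1))]);
    (((14, -5), (14, -8), (10, -2)), ((10, -4), (14, -6), (6, -2)), [::
      ((1, 0), (0, 0), (0, 0), (1, 0));
      ((-5, -2), (-2, -1), (-2, -1), (-1, 0));
      ((-1, -1), (-2, 0), (-2, 0), (1, -1));
      ((-3, -1), (-2, -1), (2, 1), (3, 1))])]
|}.

(** The members are in order of the norm of their discriminants and then of the
   traces of their outer coefficients, which makes the one-sided test of
   [distinguished] succeed. *)
Definition integral6 : seq qform := [::
  ((1, 0), (-1, -1), (3, 0)); ((1, 0), (0, -1), (2, 0));
  ((1, 0), (0, -1), (4, -1)); ((1, 0), (-1, 0), (1, 0));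
  ((3, -1), (3, -2), (3, 0)); ((5, -2), (-5, 2), (5, -2));
  ((3, -1), (-4, 2), (3, -1)); ((2, 0), (-2, -2), (4, 1));
  ((1, 0), (-1, 0), (3, -1)); ((1, 0), (-1, 0), (3, 1));
  ((5, -2), (-5, 2), (3, -1)); ((5, -2), (-5, 2), (3, 0));
  ((3, -1), (6, -3), (6, -2)); ((3, -1), (6, -3), (6, -1));
  ((3, -1), (-3, 1), (2, 0)); ((3, 1), (-3, -1), (2, 0));
  ((3, -1), (-3, 1), (4, 1)); ((3, 1), (-3, -1), (4, -1));
  ((3, -1), (-4, 2), (4, 0)); ((3, -1), (-3, 1), (3, -1));
  ((3, 1), (-3, -1), (3, 1)); ((3, -1), (2, -1), (3, -1));
  ((3, 1), (2, 1), (3, 1)); ((4, -1), (2, -3), (5, 0));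
  ((8, -3), (10, -5), (7, -2)); ((3, -1), (-1, 0), (3, 1))].

Definition classical21 : class_data := {|
  cd_shifts := [::
    (0, 0); (1, 0); (-1, 0); (-1, 1); (-1, -1); (1, 1); (1, -1); (-2, 1)];
  cd_rank_ones := [::
    ((0, 0), (1, 0), (1, 0)); ((-1, 0), (1, 0), (1, 0));
    ((2, 1), (1, 1), (3, -1)); ((2, 1), (1, 1), (1, 0));
    ((3, 1), (1, 1), (3, -1)); ((1, 1), (2, 0), (3, -1));
    ((2, 0), (2, -1), (1, 0)); ((0, 0), (1, 0), (3, -1));
    ((0, -1), (1, 0), (3, -1)); ((0, 1), (1, 0), (3, -1));
    ((0, 1), (1, 0), (1, 0)); ((1, 0), (1, 0), (2, 1));
    ((1, -1), (1, 0), (1, 0)); ((1, -1), (1, 0), (2, 1));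
    ((-2, 0), (1, 1), (1, 0)); ((3, 1), (1, 1), (1, 0))];
  cd_reps := [::
    (((2, 0), (0, -2), (4, 0)), [::
      ((1, 0), (0, 0), (0, 0), (1, 0)); ((-3, -1), (-1, -1), (3, 2), (2, 1));
      ((0, -1), (-2, 0), (2, 1), (1, 1));
      ((-5, -3), (-4, -2), (7, 4), (5, 3))]);
    (((4, -1), (-2, 2), (3, 0)), [::
      ((1, 0), (0, 0), (0, 0), (1, 0)); ((-2, -1), (1, 1), (2, 1), (-2, -1))]);
    (((2, 0), (0, -2), (4, 1)), [:: ((1, 0), (0, 0), (0, 0), (1, 0))]);
    (((2, 0), (-2, -2), (5, 1)), [:: ((1, 0), (0, 0), (0, 0), (1, 0))]);
    (((4, 2), (-4, -2), (3, 0)), [::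
      ((1, 0), (0, 0), (0, 0), (1, 0)); ((3, -1), (0, 0), (2, -1), (-1, 0))]);
    (((6, -2), (-6, 2), (3, 0)), [::
      ((1, 0), (0, 0), (0, 0), (1, 0)); ((-2, -1), (0, 0), (3, 2), (-1, 0))]);
    (((4, 0), (2, -4), (6, 0)), [::
      ((1, 0), (0, 0), (0, 0), (1, 0)); ((0, -1), (-2, 0), (2, 1), (1, 1));
      ((-3, -1), (-1, -1), (0, 1), (2, 0));
      ((-3, -1), (-1, -1), (0, -1), (-2, 0));
      ((3, -1), (-3, 1), (0, 1), (2, 0));
      ((3, -1), (-3, 1), (0, -1), (-2, 0));
      ((3, -1), (-3, 1), (3, -1), (-2, 1));
      ((-3, -1), (-1, -1), (3, 2), (2, 1))]);
    (((4, 1), (-4, -4), (5, 2)), [::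
      ((1, 0), (0, 0), (0, 0), (1, 0)); ((0, -1), (-2, 0), (2, 0), (-1, 1));
      ((2, -1), (-3, 1), (-3, 1), (3, -1));
      ((3, -1), (-3, 1), (-2, 1), (3, -1))]);
    (((4, -1), (-2, 2), (4, 1)), [:: ((1, 0), (0, 0), (0, 0), (1, 0))]);
    (((3, 1), (-6, -4), (8, 2)), [:: ((1, 0), (0, 0), (0, 0), (1, 0))]);
    (((6, -1), (0, 4), (6, 2)), [::
      ((1, 0), (0, 0), (0, 0), (1, 0)); ((-1, 0), (-2, 1), (-1, -1), (2, 0));
      ((-1, -1), (2, 0), (3, 1), (0, -1));
      ((-1, -1), (1, 0), (2, 1), (-1, 0))])];
  cd_splits := [::
    (((8, -2), (2, -4), (6, 2)), ((6, -2), (4, -2), (2, 0)), [::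
      ((1, 0), (0, 0), (0, 0), (1, 0)); ((-1, -1), (-2, 0), (2, 1), (0, 1))]);
    (((8, 2), (-8, -8), (10, 4)), ((2, 0), (-2, -2), (4, 2)), [::
      ((1, 0), (0, 0), (0, 0), (1, 0)); ((0, -1), (-2, 0), (2, 0), (-1, 1));
      ((2, -1), (-3, 1), (-3, 1), (3, -1));
      ((3, -1), (-3, 1), (-2, 1), (3, -1))])]
|}.

Definition integral21 : seq qform := [::
  ((1, 0), (0, -1), (2, 0)); ((1, 0), (-1, 0), (1, 0));
  ((3, -1), (-3, 1), (3, -1)); ((2, 0), (1, -2), (3, 0));
  ((3, -1), (-3, 1), (2, 0)); ((1, 0), (0, -1), (3, 1));
  ((2, 1), (-2, -1), (2, 0)); ((1, 0), (-1, -1), (4, 0))].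

End Data.

(** * Class numbers of indecomposable forms *)

Fact cover_ok2 : cover_ok field2. Proof. by vm_compute. Qed.
Fact cover_ok3 : cover_ok field3. Proof. by vm_compute. Qed.
Fact cover_ok5 : cover_ok field5. Proof. by vm_compute. Qed.
Fact cover_ok6 : cover_ok field6. Proof. by vm_compute. Qed.
Fact cover_ok21 : cover_ok field21. Proof. by vm_compute. Qed.

Fact search_ok2 : search_ok field2 search2. Proof. by vm_compute. Qed.
Fact search_ok3 : search_ok field3 search3. Proof. by vm_compute. Qed.
Fact search_ok5 : search_ok field5 search5. Proof. by vm_compute. Qed.
Fact search_ok6 : search_ok field6 search6. Proof. by vm_compute. Qed.
Fact search_ok21 : search_ok field21 search21. Proof. by vm_compute. Qed.

Fact classical2_ok : classification_ok field2 search2 true classical2.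
Proof. by vm_compute. Qed.
Fact integral2_ok : classification_ok field2 search2 false integral2.
Proof. by vm_compute. Qed.
Fact classical3_ok : classification_ok field3 search3 true classical3.
Proof. by vm_compute. Qed.
Fact integral3_ok : classification_ok field3 search3 false integral3.
Proof. by vm_compute. Qed.
Fact classical5_ok : classification_ok field5 search5 true classical5.
Proof. by vm_compute. Qed.
Fact integral5_ok : classification_ok field5 search5 false integral5.
Proof. by vm_compute. Qed.
Fact classical6_ok : classification_ok field6 search6 true classical6.
Proof. by vm_compute. Qed.
Fact classical21_ok : classification_ok field21 search21 true classical21.
Proof. by vm_compute. Qed.

Fact classical2_reps : reps_ok field2 true (rep_forms classical2).
Proof. by vm_compute. Qed.
Fact integral2_reps : reps_ok field2 false (rep_forms integral2).
Proof. by vm_compute. Qed.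
Fact classical3_reps : reps_ok field3 true (rep_forms classical3).
Proof. by vm_compute. Qed.
Fact integral3_reps : reps_ok field3 false (rep_forms integral3).
Proof. by vm_compute. Qed.
Fact classical5_reps : reps_ok field5 true (rep_forms classical5).
Proof. by vm_compute. Qed.
Fact integral5_reps : reps_ok field5 false (rep_forms integral5).
Proof. by vm_compute. Qed.
Fact classical6_reps : reps_ok field6 true (rep_forms classical6).
Proof. by vm_compute. Qed.
Fact integral6_reps : reps_ok field6 false integral6.
Proof. by vm_compute. Qed.
Fact classical21_reps : reps_ok field21 true (rep_forms classical21).
Proof. by vm_compute. Qed.
Fact integral21_reps : reps_ok field21 false integral21.
Proof. by vm_compute. Qed.

Lemma squarefree_check D : (0 < D < 25)%N ->
  all (fun d => ~~ (d * d %| D))%N [:: 2; 3; 4]%N ->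
  forall d, (d * d %| D)%N -> d = 1%N.
Proof.
move=> /andP[D0 D25] /and4P[h2 h3 h4 _] [|[|[|[|[|d]]]]] //; do ?exact: contraTeq.
  by rewrite mul0n dvd0n => /eqP E; rewrite E in D0.
by move=> /(dvdn_leq D0); move: D25; clear; rewrite !mulSn; lia.
Qed.

Theorem theorem1p6 (R : realType) (D : nat) (K : fieldExtType rat)
    (hK : is_quadratic_field D K) :
  let c := bf_classes (@classical_indecomposable R K) in
  let i := bf_classes (@integral_indecomposable R K) in
  [/\ D = 2%N -> c #= `I_1 /\ i #= `I_7,
      D = 3%N -> c #= `I_3 /\ i #= `I_4,
      D = 5%N -> c #= `I_1 /\ i #= `I_2,
      D = 6%N -> c #= `I_14 /\ `I_26 #<= i
    & D = 21%N -> c #= `I_11 /\ `I_8 #<= i].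
Proof.
case: hK => s s_sq s_gen c i.
split=> DE; rewrite {}DE in s_sq.
- have HK := @quadratic_order_0 R K 2 s s_sq s_gen isT (@squarefree_check 2 isT isT) (or_introl erefl).
  split.
    exact: (classes_eq (fd := field2) HK cover_ok2 search_ok2 classical2_ok classical2_reps).
  exact: (classes_eq (fd := field2) HK cover_ok2 search_ok2 integral2_ok integral2_reps).
- have HK := @quadratic_order_0 R K 3 s s_sq s_gen isT (@squarefree_check 3 isT isT) (or_intror erefl).
  split.
    exact: (classes_eq (fd := field3) HK cover_ok3 search_ok3 classical3_ok classical3_reps).
  exact: (classes_eq (fd := field3) HK cover_ok3 search_ok3 integral3_ok integral3_reps).
- have HK := @quadratic_order_1 R K 5 s s_sq s_gen isT (@squarefree_check 5 isT isT) erefl.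
  split.
    exact: (classes_eq (fd := field5) HK cover_ok5 search_ok5 classical5_ok classical5_reps).
  exact: (classes_eq (fd := field5) HK cover_ok5 search_ok5 integral5_ok integral5_reps).
- have HK := @quadratic_order_0 R K 6 s s_sq s_gen isT (@squarefree_check 6 isT isT) (or_introl erefl).
  split.
    exact: (classes_eq (fd := field6) HK cover_ok6 search_ok6 classical6_ok classical6_reps).
  exact: (classes_ge (fd := field6) HK integral6_reps).
- have HK := @quadratic_order_1 R K 21 s s_sq s_gen isT (@squarefree_check 21 isT isT) erefl.
  split.
    exact: (classes_eq (fd := field21) HK cover_ok21 search_ok21 classical21_ok classical21_reps).
  exact: (classes_ge (fd := field21) HK integral21_reps).
Qed.
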